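(* Let $X$ be a Niebrzydowski algebra and let $\Gamma$ be a $Y$-oriented trivalent spatial graph. Then the number $\Phi_X^{\mathbb{Z}}(\Gamma)$ of $X$-colorings of a diagram of $\Gamma$ is invariant under $Y$-oriented Reidemeister moves: any two diagrams related by a finite sequence of $Y$-oriented Reidemeister moves have the same number of $X$-colorings. If, moreover, $X$ is idempotent, then $\Phi_X^{\mathbb{Z}}(\Gamma)$ is an invariant of $Y$-oriented handlebody-links, i.e. it is also unchanged by $Y$-oriented IH-moves.
   Context: Tribracket. A Niebrzydowski tribracket on a set $X$ is a ternary operation $[\,,,]:X\times X\times X\to X$ such that (i) in the equation $[a,b,c]=d$, any three of $a,b,c,d\in X$ uniquely determine the fourth; (ii) for all $a,b,c,d\in X$, $$[a,b,[b,c,d]]=[a,[a,b,c],[[a,b,c],c,d]],\qquad [[a,b,c],c,d]=[[a,b,[b,c,d]],[b,c,d],d].$$ Niebrzydowski algebra. This is a set $X$ with a Niebrzydowski tribracket and a partially defined product $(a,b)\mapsto ab$ such that: (i) in the equation $ab=c$ any two of $a,b,c$ determine the third (i.e. if $ab=ab'$ with both sides defined then $b=b'$, and if $ab=a'b$ with both sides defined then $a=a'$); (ii) $[a,ab,b]=ab$ for all $a,b\in X$; (iii) for all $a,b,c\in X$, $$a[a,b,c]=[a,b,bc],\quad [a,b,c]c=[ab,b,c],\quad [a,b,c]=[[a,b,bc],bc,c],\quad [a,b,c]=[a,ab,[ab,b,c]].$$ Because the product is only partially defined, these equations are read as follows: $[a,ab,b]=ab$ is required when $ab$ is defined; in $a[a,b,c]=[a,b,bc]$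 one side is defined if and only if the other is (that is, $a[a,b,c]$ is defined if and only if $bc$ is defined) and then they are equal; likewise in $[a,b,c]c=[ab,b,c]$ (that is, $[a,b,c]c$ is defined if and only if $ab$ is defined); the third equation is required when $bc$ is defined and the fourth when $ab$ is defined. $X$ is idempotent if $a(ab)=ab=(ab)b$ for all $a,b\in X$ with $ab$ defined; by (i) this means that $ab$ is defined only when $a=b$, and then $aa=a$ (so all three colors around any vertex in a coloring as below are equal). Graphs and diagrams. A trivalent spatial graph is a finite graph with all vertices of degree 3 (circle components without vertices are allowed) embedded in $\mathbb{R}^3$, up to ambient isotopy. A $Y$-orientation is an orientation of its edges such that no vertex is a source or a sink, so each vertex has either one incoming and two outgoing edges or two incoming and one outgoing edge. Diagrams are generic planar projections with crossing information, up to planar isotopy; the regions of a diagram are the connected components of the complement of the projection in the plane. Colorings. An $X$-coloring of a diagram is an assignment of an element of $X$ to each region such that the following hold. At each crossing, rotate so that both strands point upward, and let $x_W,x_S,x_E,x_N$ be the colors of the left, bottom, right and top regions: at a positive crossing (the over strand runs from bottom left to top right) $x_N=[x_W,x_S,x_E]$, and at a negative crossing $x_S=[x_W,x_N,x_E]$. At each vertex, rotate so that all edges point upward, and let $x_W$ and $x_E$ be the colors of the left and right regions and $x_M$ the color of the region between the two incoming edges or between the two outgoing edges (whichever pair exists): then $x_Wx_E$ is defined and $x_M=x_Wx_E$. The number of $X$-colorings means the cardinality of the set of $X$-colorings. Moves. The $Y$-oriented Reidemeister moves are all versions, with all $Y$-orientations, of the classical moves R1, R2, R3 and of the following two moves.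 R4: at a vertex with incident edges $e_0,e_1,e_2$, exchange the cyclic order of $e_1$ and $e_2$ at the vertex while introducing one crossing of either kind between $e_1$ and $e_2$ next to the vertex (a half twist), or the inverse of this. R5: a strand crossing the edge $e_0$ once near a vertex with incident edges $e_0,e_1,e_2$ is pushed across the vertex, entirely over or entirely under, so that it crosses $e_1$ and $e_2$ once each instead of $e_0$, or the inverse of this. An IH-move takes place in a disk meeting the diagram in a tree with four boundary points and two trivalent vertices joined by one edge, with no crossings (shape I), and replaces it by the other such planar tree with the same four boundary points (shape H); a $Y$-oriented IH-move is one in which both sides are $Y$-oriented with the same orientations at the four boundary points. $Y$-oriented handlebody-links are represented by diagrams of $Y$-oriented trivalent spatial graphs, up to $Y$-oriented Reidemeister moves and $Y$-oriented IH-moves. *)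

(* Defs.v *)
From Stdlib Require Import Relation_Operators.
From mathcomp Require Import all_boot all_order all_algebra.
From mathcomp Require Import all_classical all_reals all_analysis.
Set Implicit Arguments.
Unset Strict Implicit.
Unset Printing Implicit Defensive.
Import Order.TTheory GRing.Theory Num.Theory.
Import numFieldNormedType.Exports.
Local Open Scope classical_set_scope.
Local Open Scope ring_scope.

Record tribracket (X : Type) := Tribracket {
  tri :> X -> X -> X -> X;
  tri_inv1 : forall b c d, exists! a, tri a b c = d;
  tri_inv2 : forall a c d, exists! b, tri a b c = d;
  tri_inv3 : forall a b d, exists! c, tri a b c = d;
  tri_ax1 : forall a b c d,
    tri a b (tri b c d) = tri a (tri a b c) (tri (tri a b c) c d);
  tri_ax2 : forall a b c d,
    tri (tri a b c) c d = tri (tri a b (tri b c d)) (tri b c d) d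
}.

(* [nmul a b = Some c] means that the product ab is defined and equal to c,
   [nmul a b = None] that it is undefined.  The equations [nmul_tril] and
   [nmul_trir] hold in [option X]: one side is defined iff the other one is. *)
Record niebrzydowski_algebra (X : Type) := NiebrzydowskiAlgebra {
  ntri :> tribracket X;
  nmul : X -> X -> option X;
  nmul_injr : forall a b b' c, nmul a b = Some c -> nmul a b' = Some c -> b = b';
  nmul_injl : forall a a' b c, nmul a b = Some c -> nmul a' b = Some c -> a = a';
  ntri_mul : forall a b ab, nmul a b = Some ab -> ntri a ab b = ab;
  nmul_tril : forall a b c,
    nmul a (ntri a b c) = omap (fun bc => ntri a b bc) (nmul b c);
  nmul_trir : forall a b c,
    nmul (ntri a b c) c = omap (fun ab => ntri ab b c) (nmul a b);
  ntri_mulr : forall a b c bc, nmul b c = Some bc ->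
    ntri a b c = ntri (ntri a b bc) bc c;
  ntri_mull : forall a b c ab, nmul a b = Some ab ->
    ntri a b c = ntri a ab (ntri ab b c)
}.

Definition idempotent_algebra X (N : niebrzydowski_algebra X) : Prop :=
  forall a b ab, nmul N a b = Some ab ->
    nmul N a ab = Some ab /\ nmul N ab b = Some ab.

Notation plane R := (R * R)%type.

Section Plane.
Variable R : realType.
Implicit Types (p u v w : plane R).

Definition det2 u v : R := u.1 * v.2 - u.2 * v.1.

(* The rays spanned by u, v, w from a common point are met in this cyclic order
   when turning counterclockwise: the three successive angles are in ]0, 2pi[
   and add up to 2pi, so at most one of them is >= pi. *)
Definition ccw u v w : bool :=
  [|| (0 < det2 u v) && (0 < det2 v w),
      (0 < det2 v w) && (0 < det2 w u) |
      (0 < det2 w u) && (0 < det2 u v)].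

Definition shift p w (t : R) : plane R := (p.1 + t * w.1, p.2 + t * w.2).

(* The segment from e.1 to e.2, oriented in this direction. *)
Definition segment := (plane R * plane R)%type.
Implicit Types (e f g : segment).

Definition dir e : plane R := e.2 - e.1.
Definition param e (t : R) : plane R := shift e.1 (dir e) t.
Definition on_segment e p := exists t : R, 0 <= t <= 1 /\ p = param e t.
Definition inner e p := exists t : R, 0 < t < 1 /\ p = param e t.
Definition endpoint e p : bool := (p == e.1) || (p == e.2).

(* Raw diagrams need not be closed, nor in general position; they are also used
   for the pictures describing the local moves.  [over e f] is meaningful only
   when the segments e and f cross. *)
Record prediagram := Prediagram {
  segs : seq segment;
  over : rel segment
}.
Implicit Types (D : prediagram).

Definition carrier D : set (plane R) :=
  [set p | exists2 e, e \in segs D & on_segment e p].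

Definition indeg D p := count (fun e => e.2 == p) (segs D).
Definition outdeg D p := count (fun e => e.1 == p) (segs D).

(* Polygonal diagrams of Y-oriented trivalent spatial graphs.  An edge of the
   graph is a chain of segments: a point of in- and outdegree 1 is a bend of the
   polygonal line, the other endpoints are the vertices of the graph. *)
Definition is_diagram D : Prop :=
  [/\ uniq (segs D) /\ (forall e, e \in segs D -> e.1 != e.2),
      (forall e p, e \in segs D -> endpoint e p ->
        (indeg D p, outdeg D p) \in [:: (1, 1); (1, 2); (2, 1)]%N),
      (forall e f p, e \in segs D -> f \in segs D -> e != f ->
        on_segment e p -> on_segment f p ->
        (endpoint e p && endpoint f p) \/
        [/\ inner e p, inner f p & det2 (dir e) (dir f) != 0]),
      (forall e f g p, e \in segs D -> f \in segs D -> g \in segs D ->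
        uniq [:: e; f; g] -> ~ [/\ inner e p, inner f p & inner g p]) &
      (forall e f p, e \in segs D -> f \in segs D -> e != f ->
        inner e p -> inner f p -> over D e f (+) over D f e)].

Record diagram := Diagram {
  prediag :> prediagram;
  diagramP : is_diagram prediag
}.

Definition crossing D e f p : Prop :=
  [/\ e \in segs D, f \in segs D, e != f, inner e p /\ inner f p & over D e f].

Definition regions D : set (set (plane R)) :=
  [set connected_component (~` carrier D) p | p in ~` carrier D].

Section Coloring.
Variables (X : Type) (N : niebrzydowski_algebra X) (D : prediagram).
Variable c : regions D -> X.

Definition colored p (x : X) : Prop :=
  exists r : regions D, set_val r p /\ c r = x.

(* x is the color of the region between the rays u and v from p, where one goes
   from u to v counterclockwise. *)
Definition sector p u v (x : X) : Prop :=
  forall w, ccw u w v -> \forall t \near 0^'+, colored (shift p w t) x.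

(* Strands u and v through p both point upward, u towards the right and v
   towards the left: [0 < det2 u v]. *)
Definition around p u v (xW xS xE xN : X) : Prop :=
  [/\ sector p v (- u) xW, sector p (- u) (- v) xS,
      sector p (- v) u xE & sector p u v xN].

Definition crossing_ok : Prop :=
  forall e f p, crossing D e f p ->
  exists xW xS xE xN,
    if 0 < det2 (dir e) (dir f)
    then around p (dir e) (dir f) xW xS xE xN /\ xN = N xW xS xE
    else around p (dir f) (dir e) xW xS xE xN /\ xS = N xW xN xE.

(* At a vertex, e0 is the only incoming (resp. only outgoing) edge and e0, e1,
   e2 are in counterclockwise order; the incoming edges are at the bottom. *)
Definition vertex_ok : Prop :=
  forall e0 e1 e2 p, e0 \in segs D -> e1 \in segs D -> e2 \in segs D ->
  (e0.2 = p -> e1.1 = p -> e2.1 = p ->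
   ccw (- dir e0) (dir e1) (dir e2) ->
   exists xW xM xE,
     [/\ sector p (- dir e0) (dir e1) xE, sector p (dir e1) (dir e2) xM,
         sector p (dir e2) (- dir e0) xW & nmul N xW xE = Some xM]) /\
  (e0.1 = p -> e1.2 = p -> e2.2 = p ->
   ccw (dir e0) (- dir e1) (- dir e2) ->
   exists xW xM xE,
     [/\ sector p (dir e0) (- dir e1) xW, sector p (- dir e1) (- dir e2) xM,
         sector p (- dir e2) (dir e0) xE & nmul N xW xE = Some xM]).

Definition is_coloring : Prop := crossing_ok /\ vertex_ok.

End Coloring.

Definition colorings X (N : niebrzydowski_algebra X) D : set (regions D -> X) :=
  [set c | is_coloring N c].

(* The oriented structure of a diagram near a point x is recorded by: whether x
   is a vertex, which points y near x come after or before x on an oriented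
   segment through x, and, if x is a crossing, which points y near x are on the
   over strand.  It does not depend on the subdivision into segments. *)
Definition vertex D p : Prop :=
  exists e f, [/\ e \in segs D, f \in segs D, e != f &
    (e.1 = p /\ f.1 = p) \/ (e.2 = p /\ f.2 = p)].

Definition before D p q : Prop :=
  exists e (s t : R), [/\ e \in segs D, 0 <= s, s < t, t <= 1 &
    p = param e s /\ q = param e t].

Definition on_over_strand D p q : Prop :=
  exists e f, crossing D e f p /\ on_segment e q.

(* h identifies D near p with D' near h p. *)
Definition same_near (h : plane R -> plane R) D D' p : Prop :=
  (vertex D p <-> vertex D' (h p)) /\
  \forall q \near p,
    [/\ before D p q <-> before D' (h p) (h q),
        before D q p <-> before D' (h q) (h p) &
        on_over_strand D p q <-> on_over_strand D' (h p) (h q)].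

Definition homeomorphism (h : plane R -> plane R) : Prop :=
  continuous h /\
  exists g : plane R -> plane R, [/\ continuous g, cancel h g & cancel g h].

Definition isotopic_to_id (h : plane R -> plane R) : Prop :=
  exists H : R -> plane R -> plane R,
    [/\ {within `[0, 1]%classic `*` [set: plane R],
           continuous (fun x : R * plane R => H x.1 x.2)},
        (forall t, 0 <= t <= 1 -> homeomorphism (H t)),
        H 0 = id & H 1 = h].

(* This includes the subdivision of segments, with the constant isotopy. *)
Definition planar_isotopic (D D' : diagram) : Prop :=
  exists2 h, isotopic_to_id h & forall p, same_near h D D' p.

Definition polyline := seq (plane R).

Definition chain (l : polyline) : seq segment := zip l (behead l).

(* The picture made of the given oriented polygonal lines, the first ones in the
   list passing over the last ones. *)
Definition picture (L : seq polyline) : prediagram :=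
  let level e := find (fun l => e \in chain l) L in
  Prediagram (flatten [seq chain l | l <- L]) (fun e f => level e < level f)%N.

Definition orient (b : bool) (l : polyline) : polyline := if b then l else rev l.

Definition mirror (m : bool) (l : polyline) : polyline :=
  if m then [seq (- p.1, p.2) | p : plane R <- l] else l.

Definition outer_disk : set (plane R) := [set p | `|p.1| < 3 /\ `|p.2| < 3].
Definition inner_disk : set (plane R) := [set p | `|p.1| <= 2 /\ `|p.2| <= 2].

(* The pictures in the outer disk are equal outside the inner disk.  Since D and
   D' are diagrams, only the choices of orientations giving Y-oriented vertices
   are relevant. *)
Definition replacement (M : seq polyline -> seq polyline -> Prop)
    (D D' : diagram) : Prop :=
  exists L L' h,
    [/\ M L L', isotopic_to_id h,
        (forall p, outer_disk p ->
          same_near h (picture L) D p /\ same_near h (picture L') D' p) &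
        (forall p, ~ inner_disk p -> same_near id D D' (h p))].

Inductive R1 : seq polyline -> seq polyline -> Prop :=
  R1_intro (b m o : bool) :
    let k1 := orient b (mirror m [:: (0, -3); (0, 1); (1, 1)]) in
    let k2 := orient b (mirror m
      [:: (1, 1); (1, 0); (-1, 0); (-1, 2); (0, 2); (0, 3)]) in
    R1 [:: orient b [:: (0, -3); (0, 3)]]
       (if o then [:: k1; k2] else [:: k2; k1]).

Inductive R2 : seq polyline -> seq polyline -> Prop :=
  R2_intro (b1 b2 o : bool) :
    let l := orient b1 [:: (-1, -3); (-1, 3)] in
    let l' := orient b1 [:: (-1, -3); (-1, -1); (2, 0); (-1, 1); (-1, 3)] in
    let k := orient b2 [:: (1, -3); (1, 3)] in
    R2 [:: l; k] (if o then [:: l'; k] else [:: k; l']).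

Inductive R3 : seq polyline -> seq polyline -> Prop :=
  R3_intro (b1 b2 b3 : bool) (s : seq nat) : perm_eq s (iota 0 3) ->
    let l1 := orient b1 [:: (-2, -3); (2, 3)] in
    let l2 := orient b2 [:: (2, -3); (-2, 3)] in
    let l3 := orient b3 [:: (-3, 0); (-2, 0); (0, 1); (2, 0); (3, 0)] in
    let l3' := orient b3 [:: (-3, 0); (-2, 0); (0, -1); (2, 0); (3, 0)] in
    R3 [seq nth [::] [:: l1; l2; l3] i | i <- s]
       [seq nth [::] [:: l1; l2; l3'] i | i <- s].

Inductive R4 : seq polyline -> seq polyline -> Prop :=
  R4_intro (b0 b1 b2 o : bool) :
    let e0 := orient b0 [:: (0, 0); (0, -3)] in
    let e1 := orient b1 [:: (0, 0); (-1, 1); (-1, 3)] in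
    let e2 := orient b2 [:: (0, 0); (1, 1); (1, 3)] in
    let e1' := orient b1 [:: (0, 0); (1, 1); (-1, 2); (-1, 3)] in
    let e2' := orient b2 [:: (0, 0); (-1, 1); (1, 2); (1, 3)] in
    R4 [:: e0; e1; e2] (if o then [:: e0; e1'; e2'] else [:: e0; e2'; e1']).

Inductive R5 : seq polyline -> seq polyline -> Prop :=
  R5_intro (b0 b1 b2 b o : bool) :
    let v := [:: orient b0 [:: (0, 0); (0, -3)];
                 orient b1 [:: (0, 0); (-1, 3)];
                 orient b2 [:: (0, 0); (1, 3)]] in
    let l := orient b
      [:: (-3, 0); (-2, 0); (-1, -1); (1, -1); (2, 0); (3, 0)] in
    let l' := orient b
      [:: (-3, 0); (-2, 0); (-1, 1); (1, 1); (2, 0); (3, 0)] in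
    R5 (if o then l :: v else rcons v l) (if o then l' :: v else rcons v l').

Inductive IH : seq polyline -> seq polyline -> Prop :=
  IH_intro (b1 b2 b3 b4 b b' : bool) :
    let arm c p q r := orient c [:: p; q; r] in
    IH [:: arm b1 (0, 1) (-2, 2) (-2, 3); arm b2 (0, 1) (2, 2) (2, 3);
           arm b3 (0, -1) (-2, -2) (-2, -3); arm b4 (0, -1) (2, -2) (2, -3);
           orient b [:: (0, -1); (0, 1)]]
       [:: arm b1 (-1, 0) (-2, 2) (-2, 3); arm b2 (1, 0) (2, 2) (2, 3);
           arm b3 (-1, 0) (-2, -2) (-2, -3); arm b4 (1, 0) (2, -2) (2, -3);
           orient b' [:: (-1, 0); (1, 0)]].

Definition reidemeister_step (D D' : diagram) : Prop :=
  [\/ planar_isotopic D D', replacement R1 D D', replacement R2 D D' |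
   [\/ replacement R3 D D', replacement R4 D D' | replacement R5 D D']].

Definition reidemeister_equivalent : diagram -> diagram -> Prop :=
  clos_refl_sym_trans diagram reidemeister_step.

Definition handlebody_equivalent : diagram -> diagram -> Prop :=
  clos_refl_sym_trans diagram
    (fun D D' : diagram => reidemeister_step D D' \/ replacement IH D D').

End Plane.
Arguments colorings {R} [X] N D.

(* Main.v *)
Require Import Defs.
From Stdlib Require Import ZArith.
From mathcomp Require Import all_boot all_order all_algebra.
From mathcomp Require Import all_classical all_reals all_analysis.
From mathcomp Require Import ring lra ssrZ.
Import Defs.

(** The colorings of a diagram D correspond to functions F from the plane to
    [option X] which are [None] exactly on the carrier of D, are locally constant
    elsewhere, and satisfy a condition at each crossing and each vertex (see
    [card_colorings]).  All these requirements are local, and this form of the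
    definition is suited to transport and gluing.

    Planar isotopy.  Near a point p the carrier is a star of finitely many rays,
    and a homeomorphism h which preserves the local structure of the diagrams
    matches the rays at p with those at h p.  The conditions refer to the left and
    the right sides of the strands, so one has to know that h respects them.  This
    follows from h being isotopic to the identity: the image of a small square
    around p winds once around h p, so it crosses each ray from right to left
    ([isotopy_turn]).  Winding numbers are counted as signed crossings of a
    polygon with a ray.  Hence corresponding sectors have the same color
    ([left_color]) and the same cyclic order ([adjacent_matched]), the conditions
    at p and at h p are equivalent, and F corresponds to its composition with h.

    Moves in a disk.  Two diagrams related by a move agree off the inner disk, up to
    an isotopy.  By gluing it is enough that each coloring of one picture in the
    outer disk restricts to the annulus like exactly one coloring of the other
    picture ([extends], [replacement_card]).

    To show this, each picture comes with a finite list of convex cells with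
    integer coefficients, each labelled with the region containing it.  That the
    cells cover the complement of the picture in the disk, that they are disjoint from it and
    from cells of other regions, which sector at a crossing belongs to which
    region, and which regions of the two pictures meet in the annulus are questions
    on systems of affine inequalities, decided by elimination of variables
    ([infeasibleP], [coveredP]).  Colorings of a picture then become the solutions of
    finitely many equations for the colors of the labels ([conditionsP]), and a
    move becomes a statement about the algebra X ([extends_of_check]).

    Algebra.  For R1 and R2 one equation is solved for the color of the new region.
    For R3 the eight combinations of sides of the three strands are the vertices
    of a cube, whose faces are the six crossings of the two pictures.  The axioms
    of tribrackets say that the cube built on a path of three edges is consistent,
    and three faces around a corner determine it ([cube_complete]).  For R4 a
    vertex and a half twist of two of its edges determine each other, in one case
    by [a, ab, b] = ab and otherwise by [twist].  For R5 the colors on both sides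
    of the strand form a prism, all relations of which follow from a vertex and two
    edges.  Finally if X is idempotent, then a product is defined only between
    equal colors, so that both sides of an IH-move have all regions in the disk of
    the same color. *)

Set Implicit Arguments.
Unset Strict Implicit.
Unset Printing Implicit Defensive.
Import Order.TTheory GRing.Theory Num.Theory.
Import numFieldNormedType.Exports.
Local Open Scope classical_set_scope.
Local Open Scope ring_scope.
Local Open Scope card_scope.

(** * Signed crossings of a ray by a polygon *)

Section PlaneVectors.
Variable R : realType.
Implicit Types (u v w z p q : plane R).

Definition dot u v : R := u.1 * v.1 + u.2 * v.2.

(** The vectors u, v, w satisfy a linear relation whose coefficients are the three
    determinants; taking its scalar product with u gives a sum of nonnegative
    terms, one of them positive.  So three directions which are pairwise less
    than a quarter turn apart cannot surround the origin. *)
Lemma no_winding_triple u v w :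
  0 < dot u v -> 0 < dot v w -> 0 < dot w u ->
  0 < det2 u v -> 0 <= det2 v w -> 0 <= det2 w u -> False.
Proof.
move=> duv dvw dwu euv evw ewu.
have : det2 v w * dot u u + det2 w u * dot v u + det2 u v * dot w u = 0.
  by rewrite /det2 /dot; ring.
have duu : 0 <= dot u u by rewrite /dot -!expr2 addr_ge0 ?sqr_ge0.
have h1 : 0 <= det2 v w * dot u u by exact: mulr_ge0.
have h2 : 0 <= det2 w u * dot v u.
  by apply: mulr_ge0 => //; rewrite /dot mulrC (mulrC v.2) ltW.
have h3 : 0 < det2 u v * dot w u by exact: mulr_gt0.
lra.
Qed.

Lemma det2C u v : det2 u v = - det2 v u.
Proof. by rewrite /det2; ring. Qed.

Lemma dotC u v : dot u v = dot v u.
Proof. by rewrite /dot; ring. Qed.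

Lemma det2_relation r u v w :
  det2 v w * det2 r u + det2 w u * det2 r v + det2 u v * det2 r w = 0.
Proof. by rewrite /det2; ring. Qed.

(** The winding number of a closed polygon around the origin is the number of its
    signed crossings with a ray.  The chord from u to v crosses the ray r
    counterclockwise when it goes from the open right side of the line of r to
    the closed left side with the origin on its left; the half-open convention
    counts a vertex lying on the ray exactly once. *)
Definition xing r u v : R :=
  ((det2 r u < 0) && (0 <= det2 r v) && (0 < det2 u v))%:R
  - ((det2 r v < 0) && (0 <= det2 r u) && (det2 u v < 0))%:R.

Lemma below_above r u v w :
  0 < dot u v -> 0 < dot v w -> 0 < dot w u ->
  det2 r u < 0 -> 0 <= det2 r v -> 0 <= det2 r w ->
  0 < det2 u v -> 0 < det2 u w.
Proof.
move=> duv dvw dwu ru rv rw uv; rewrite ltNge; apply/negP => uw.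
have wu : 0 <= det2 w u by rewrite det2C oppr_ge0.
apply: (no_winding_triple duv dvw dwu uv _ wu).
have := det2_relation r u v w.
have h1 := mulr_ge0 wu rv; have h2 := mulr_ge0 (ltW uv) rw.
move=> h3; rewrite leNgt; apply/negP => vw; have : 0 < det2 v w * det2 r u by rewrite nmulr_rgt0.
lra.
Qed.

Lemma above_below r u v w :
  0 < dot u v -> 0 < dot v w -> 0 < dot w u ->
  0 <= det2 r u -> det2 r v < 0 -> det2 r w < 0 ->
  det2 u v < 0 -> det2 u w < 0.
Proof.
move=> duv dvw dwu ru rv rw uv; rewrite ltNge; apply/negP => uw.
have vu : 0 < det2 v u by rewrite det2C oppr_gt0.
have dvu : 0 < dot v u by rewrite dotC.
have duw : 0 < dot u w by rewrite dotC.
have dwv : 0 < dot w v by rewrite dotC.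
apply: (no_winding_triple dvu duw dwv vu uw).
have := det2_relation r u v w.
have h2 : 0 < det2 u v * det2 r w by rewrite nmulr_rgt0.
rewrite (det2C w u) (det2C w v) => h3; rewrite oppr_ge0 leNgt; apply/negP => vw.
have h1 : 0 <= det2 u w * - det2 r v by apply: mulr_ge0 => //; lra.
have h4 : 0 <= det2 v w * det2 r u by apply: mulr_ge0 => //; lra.
lra.
Qed.

(** A triangle whose vertices are pairwise less than a quarter turn apart does not
    surround the origin, so its crossings cancel.  This is what makes the
    crossing number of a fine polygon a homotopy invariant. *)
Lemma xing_cocycle r u v w :
  0 < dot u v -> 0 < dot v w -> 0 < dot w u ->
  xing r u v + xing r v w = xing r u w.
Proof.
move=> duv dvw dwu.
have dvu : 0 < dot v u by rewrite dotC.
have dwv : 0 < dot w v by rewrite dotC.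
have duw : 0 < dot u w by rewrite dotC.
rewrite /xing.
have [ru|ru] := ltrP (det2 r u) 0; have [rv|rv] := ltrP (det2 r v) 0;
  have [rw|rw] := ltrP (det2 r w) 0; rewrite /= ?subr0 ?sub0r ?addr0 ?add0r //.
- have -> : (0 < det2 u w) = (0 < det2 v w); last by [].
  rewrite -[LHS]/((0 < det2 u w)) (det2C u w) (det2C v w) !oppr_gt0.
  by apply/idP/idP; [apply: (@above_below r w u v)|apply: (@above_below r w v u)].
- have -> : (0 < det2 u v) = (det2 v w < 0); last by rewrite subrr.
  rewrite (det2C u v) oppr_gt0.
  by apply/idP/idP; [apply: (@above_below r v u w)|apply: (@above_below r v w u)].
- have -> : (0 < det2 u v) = (0 < det2 u w); last by [].
  by apply/idP/idP; [apply: (@below_above r u v w)|apply: (@below_above r u w v)].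
- have -> : (det2 u v < 0) = (det2 u w < 0); last by [].
  by apply/idP/idP; [apply: (@above_below r u v w)|apply: (@above_below r u w v)].
- have -> : (det2 u v < 0) = (0 < det2 v w); last by rewrite addrC subrr.
  rewrite (det2C u v) oppr_lt0.
  by apply/idP/idP; [apply: (@below_above r v u w)|apply: (@below_above r v w u)].
- have -> : (det2 v w < 0) = (det2 u w < 0); last by [].
  rewrite (det2C v w) (det2C u w) !oppr_lt0.
  by apply/idP/idP; [apply: (@below_above r w v u)|apply: (@below_above r w u v)].
Qed.
End PlaneVectors.

(** * Isotopies and the two sides of a ray *)

Section Boxes.
Variable R : realType.
Implicit Types (u v w z p q : plane R) (e : R).

Definition box p e : set (plane R) :=
  [set q | `|q.1 - p.1| < e /\ `|q.2 - p.2| < e].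

Lemma near_boxP p (P : set (plane R)) :
  (\forall q \near p, P q) <-> exists2 e, 0 < e & box p e `<=` P.
Proof.
split=> [/nbhs_ballP[e e0 pe]|[e e0 pe]].
  by exists e => // q [h1 h2]; apply: pe; split; rewrite /ball /= distrC.
apply/nbhs_ballP; exists e => // q [h1 h2].
by apply: pe; split; rewrite distrC.
Qed.

Lemma box_center p e : 0 < e -> box p e p.
Proof. by move=> e0; split; rewrite subrr normr0. Qed.

(** By continuity a nonvanishing family of vectors can thus be subdivided so finely
    that neighbouring vectors are less than a quarter turn apart, which is the
    hypothesis of [xing_cocycle]. *)
Lemma dot_gt0_near z : z != 0 -> exists2 e, 0 < e &
  forall u v, box z e u -> box z e v -> 0 < dot u v.
Proof.
move=> z0; pose m := Num.max `|z.1| `|z.2|.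
have m0 : 0 < m.
  rewrite lt_max !normr_gt0 -negb_and; apply: contraNN z0 => /andP[/eqP z1 /eqP z2].
  by apply/eqP; rewrite [z]surjective_pairing z1 z2.
(* with deviations of at most m / 8 the scalar product is at least
   m^2 (1 - 4 / 8 - 2 / 64) *)
exists (m / 8%:R); first by rewrite divr_gt0.
move=> u v [u1 u2] [v1 v2].
have z1m : `|z.1| <= m by rewrite le_max lexx.
have z2m : `|z.2| <= m by rewrite le_max lexx orbT.
have zm : m * m <= z.1 * z.1 + z.2 * z.2.
  have [->|->] : m = `|z.1| \/ m = `|z.2| by rewrite /m; case: leP => _; [right|left].
    by rewrite -normrM ger0_norm -!expr2 ?sqr_ge0 // lerDl sqr_ge0.
  by rewrite -normrM ger0_norm -!expr2 ?sqr_ge0 // lerDr sqr_ge0.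
have bnd (a a' b b' : R) : `|a| <= a' -> `|b| <= b' -> - (a' * b') <= a * b.
  move=> h1 h2; apply: le_trans (lerNnormlW _); last by [].
  by rewrite lerN2 normrM ler_pM.
have -> : dot u v = z.1 * z.1 + z.2 * z.2 + z.1 * (v.1 - z.1) + z.2 * (v.2 - z.2)
  + (u.1 - z.1) * z.1 + (u.2 - z.2) * z.2
  + (u.1 - z.1) * (v.1 - z.1) + (u.2 - z.2) * (v.2 - z.2).
  by rewrite /dot; ring.
have h1 := bnd _ _ _ _ z1m (ltW v1).
have h2 := bnd _ _ _ _ z2m (ltW v2).
have h3 := bnd _ _ _ _ (ltW u1) z1m.
have h4 := bnd _ _ _ _ (ltW u2) z2m.
have h5 := bnd _ _ _ _ (ltW u1) (ltW v1).
have h6 := bnd _ _ _ _ (ltW u2) (ltW v2).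
have mm : 0 < m * m by rewrite mulr_gt0.
lra.
Qed.

End Boxes.

Section Winding.
Variable R : realType.
Implicit Types (r u v w z p q : plane R).

(** Pushing a polygon to a nearby one changes its crossing number by the crossings
    of the paths followed by its two ends: each quadrilateral of the strip
    between the two polygons is cut into two triangles. *)
Lemma grid_row r (z z' : nat -> plane R) n :
  (forall j k, (j <= n)%N -> (k <= n)%N -> (j <= k.+1)%N -> (k <= j.+1)%N ->
    [/\ 0 < dot (z j) (z k), 0 < dot (z j) (z' k) & 0 < dot (z' j) (z' k)]) ->
  \sum_(j < n) xing r (z j) (z j.+1) + xing r (z n) (z' n)
  = xing r (z 0) (z' 0) + \sum_(j < n) xing r (z' j) (z' j.+1).
Proof.
elim: n => [|n IH] h; first by rewrite !big_ord0 add0r addr0.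
have {}IH : _ := IH (fun j k jn kn => h j k (leqW jn) (leqW kn)).
rewrite !big_ord_recr /=.
have [h1 h2 h3] := h n n.+1 (leqnSn n) (leqnn _) (leqW (leqnSn n)) (leqnn _).
have [_ h4 _] := h n n (leqnSn n) (leqnSn n) (leqnSn n) (leqnSn n).
have [_ h5 _] := h n.+1 n.+1 (leqnn _) (leqnn _) (leqnSn _) (leqnSn _).
have e1 : xing r (z n) (z n.+1) + xing r (z n.+1) (z' n.+1) = xing r (z n) (z' n.+1).
  by apply: xing_cocycle => //; rewrite dotC.
have e2 : xing r (z n) (z' n) + xing r (z' n) (z' n.+1) = xing r (z n) (z' n.+1).
  by apply: xing_cocycle => //; rewrite dotC.
lra.
Qed.

(** A discrete homotopy, as a stack of strips: the crossings along the boundary of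
    the grid add up to 0. *)
Lemma grid_sum r (z : nat -> nat -> plane R) n m :
  (forall i i' j k, (i <= m)%N -> (i' <= m)%N -> (i <= i'.+1)%N -> (i' <= i.+1)%N ->
     (j <= n)%N -> (k <= n)%N -> (j <= k.+1)%N -> (k <= j.+1)%N ->
    0 < dot (z i j) (z i' k)) ->
  \sum_(j < n) xing r (z 0%N j) (z 0%N j.+1) + \sum_(i < m) xing r (z i n) (z i.+1 n)
  = \sum_(i < m) xing r (z i 0%N) (z i.+1 0%N) + \sum_(j < n) xing r (z m j) (z m j.+1).
Proof.
elim: m => [|m IH] h; first by rewrite !big_ord0 addr0 add0r.
rewrite [X in _ + X = _]big_ord_recr [X in _ = X + _]big_ord_recr /=.
have {}IH : _ := IH (fun i i' j k im im' => h i i' j k (leqW im) (leqW im')).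
have : \sum_(j < n) xing r (z m j) (z m j.+1) + xing r (z m n) (z m.+1 n)
  = xing r (z m 0%N) (z m.+1 0%N) + \sum_(j < n) xing r (z m.+1 j) (z m.+1 j.+1).
  by apply: (@grid_row r (z m) (z m.+1)) => j k jn kn jk kj; split; apply: h => //; do ?apply: leqW.
lra.
Qed.

Lemma xingxx r u : xing r u u = 0.
Proof. by rewrite /xing; case: ltrP => //=; rewrite ?subrr. Qed.

Lemma xing_collapse r (z : nat -> plane R) n :
  (forall j k, (j <= n)%N -> (k <= n)%N -> 0 < dot (z j) (z k)) ->
  \sum_(j < n) xing r (z j) (z j.+1) = xing r (z 0%N) (z n).
Proof.
elim: n => [|n IH] h; first by rewrite big_ord0 xingxx.
rewrite big_ord_recr /= IH => [|j k jn kn]; last by apply: h; apply: leqW.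
by rewrite xing_cocycle //; apply: h => //; apply: leqW.
Qed.

(** Avoiding r, the path may cross the line of r only behind the origin.  Its ends
    are close in direction to such a point, hence behind the origin as well, so
    that the chord does not cross r either. *)
Lemma xing_path r (z : R -> plane R) a b : a <= b ->
  {within `[a, b], continuous (fun s => det2 r (z s))} ->
  (forall s, a <= s <= b -> 0 < dot (z a) (z s) /\ 0 < dot (z b) (z s)) ->
  (forall s, a <= s <= b -> det2 r (z s) = 0 -> 0 < dot r (z s) -> False) ->
  xing r (z a) (z b) = 0.
Proof.
move=> ab cz acute off.
have aab : a <= a <= b by rewrite lexx.
have bab : a <= b <= b by rewrite ab lexx.
have crossed : (det2 r (z a) < 0 <= det2 r (z b)) || (det2 r (z b) < 0 <= det2 r (z a)) ->
   exists s, [/\ a <= s <= b, det2 r (z s) = 0 & dot r (z s) < 0].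
  move=> sg.
  have /(IVT ab cz) : Num.min (det2 r (z a)) (det2 r (z b)) <= 0 <= Num.max (det2 r (z a)) (det2 r (z b)).
    rewrite ge_min le_max.
    by case/orP: sg => /andP[h1 h2]; rewrite (ltW h1) h2 ?orbT.
  case=> s; rewrite in_itv /= => sab sz; exists s; split => //.
  rewrite ltNge; apply/negP; rewrite le_eqVlt => /orP[/eqP ds|]; last exact: off.
  have [da _] := acute s sab.
  suff zs0 : z s = 0 by move: da; rewrite zs0 /dot !mulr0 addr0 ltxx.
  have r0 : r.1 * r.1 + r.2 * r.2 != 0.
    apply/eqP => rr; have r1 : r.1 = 0 by nra.
    have r2 : r.2 = 0 by nra.
    by move: sg; rewrite /det2 r1 r2 !mul0r subrr ltxx.
  have e1 : (r.1 * r.1 + r.2 * r.2) * (z s).1 = 0.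
    transitivity (r.1 * dot r (z s) - r.2 * det2 r (z s)); first by rewrite /dot /det2; ring.
    by rewrite sz -ds !mulr0 subrr.
  have e2 : (r.1 * r.1 + r.2 * r.2) * (z s).2 = 0.
    transitivity (r.2 * dot r (z s) + r.1 * det2 r (z s)); first by rewrite /dot /det2; ring.
    by rewrite sz -ds !mulr0 addr0.
  move/eqP: e1; move/eqP: e2; rewrite !mulf_eq0 (negbTE r0) /= => /eqP e2 /eqP e1.
  by case: (z s) e1 e2 => ? ? /= -> ->.
(* z s is behind the origin, and u and v are within a quarter turn of it *)
have key u v s : det2 r (z s) = 0 -> dot r (z s) < 0 -> 0 < dot u (z s) ->
    0 < dot v (z s) -> det2 r u < 0 -> 0 <= det2 r v -> det2 u v <= 0.
  move=> h1 h2 h3 h4 h5 h6.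
  have rr : 0 < dot r r.
    rewrite lt_neqAle /dot -!expr2 addr_ge0 ?sqr_ge0 // andbT eq_sym; apply/eqP => r0.
    have r1 : r.1 = 0 by nra.
    have r2 : r.2 = 0 by nra.
    by move: h2; rewrite /dot r1 r2 !mul0r addr0 ltxx.
  have du : dot r u * dot r (z s) = dot r r * dot u (z s).
    have -> : dot r u * dot r (z s) = dot r r * dot u (z s) - det2 r u * det2 r (z s).
      by rewrite /dot /det2; ring.
    by rewrite h1; ring.
  have dv : dot r v * dot r (z s) = dot r r * dot v (z s).
    have -> : dot r v * dot r (z s) = dot r r * dot v (z s) - det2 r v * det2 r (z s).
      by rewrite /dot /det2; ring.
    by rewrite h1; ring.
  have ru : dot r u < 0.
    by rewrite -(nmulr_lgt0 _ h2) du mulr_gt0.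
  have rv : dot r v < 0.
    by rewrite -(nmulr_lgt0 _ h2) dv mulr_gt0.
  rewrite -(pmulr_rle0 _ rr).
  have -> : dot r r * det2 u v = dot r u * det2 r v - det2 r u * dot r v.
    by rewrite /dot /det2; ring.
  have : 0 < det2 r u * dot r v by rewrite nmulr_rgt0.
  have : dot r u * det2 r v <= 0 by rewrite nmulr_rle0.
  lra.
rewrite /xing.
have [za|za] := ltrP (det2 r (z a)) 0; have [zb|zb] := ltrP (det2 r (z b)) 0; rewrite /= ?subrr //.
- have [s [sab s1 s2]] : exists s, [/\ a <= s <= b, det2 r (z s) = 0 & dot r (z s) < 0].
    by apply: crossed; rewrite za zb.
  have [h1 h2] := acute s sab.
  by rewrite ltNge (key _ _ s) // subrr.
- have [s [sab s1 s2]] : exists s, [/\ a <= s <= b, det2 r (z s) = 0 & dot r (z s) < 0].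
    by apply: crossed; rewrite za zb orbT.
  have [h1 h2] := acute s sab.
  rewrite det2C oppr_lt0 ltNge (key _ _ s) // subrr //.
Qed.

Definition acute_below n (K : R -> R -> plane R) := forall t s t' s' : R,
  0 <= t <= 1 -> 0 <= s <= 1 -> 0 <= t' <= 1 -> 0 <= s' <= 1 ->
  `|t' - t| <= n.+1%:R^-1 -> `|s' - s| <= n.+1%:R^-1 -> 0 < dot (K t s) (K t' s').

(** Compactness of the square turns the local condition of [dot_gt0_near] into a
    uniform mesh, as for uniform continuity. *)
Lemma uniformly_acute (K : R -> R -> plane R) :
  (forall t s : R, 0 <= t <= 1 -> 0 <= s <= 1 -> forall e : R, 0 < e ->
    exists2 d : R, 0 < d & forall t' s' : R, 0 <= t' <= 1 -> 0 <= s' <= 1 ->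
      `|t' - t| < d -> `|s' - s| < d -> box (K t s) e (K t' s')) ->
  (forall t s : R, 0 <= t <= 1 -> 0 <= s <= 1 -> K t s != 0) ->
  \forall n \near \oo, acute_below n K.
Proof.
move=> cK K0.
have := @compact_near_coveringP _ (`[0, 1]%classic `*` `[0, 1]%classic : set (R * R)).
case=> /(_ (compact_setX (@segment_compact _ _ _) (@segment_compact _ _ _))) cov _.
pose A (x : R * R) := 0 <= x.1 <= 1 /\ 0 <= x.2 <= 1.
pose P n x := A x -> forall y, A y -> `|y.1 - x.1| <= n.+1%:R^-1 ->
  `|y.2 - x.2| <= n.+1%:R^-1 -> 0 < dot (K x.1 x.2) (K y.1 y.2).
have := cov nat \oo P _.
have H : forall x : R * R, (`[0, 1]%classic `*` `[0, 1]%classic) x ->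
    \forall x' \near x & i \near \oo, P i x'.
  move=> x [] /=; rewrite !in_itv /= => x1 x2.
  have [e e0 he] := dot_gt0_near (K0 _ _ x1 x2).
  have [d d0 hd] := cK _ _ x1 x2 _ e0.
  have d2 : 0 < d / 2 by rewrite divr_gt0.
  exists (box x (d / 2), [set n | n.+1%:R^-1 < d / 2]) => /=.
    split; first by apply/near_boxP; exists (d / 2).
    exact: (near_infty_natSinv_lt (PosNum d2)).
  move=> [x' n] /= [[b1 b2] nd] [a1 a2] y [y1 y2] yx1 yx2 /=.
  apply: he; apply: hd => //.
  - by apply: lt_trans b1 _; lra.
  - by apply: lt_trans b2 _; lra.
  - have -> : y.1 - x.1 = (y.1 - x'.1) + (x'.1 - x.1) by ring.
    by apply: le_lt_trans (ler_normD _ _) _; rewrite (splitr d) ltrD // (le_lt_trans yx1).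
  - have -> : y.2 - x.2 = (y.2 - x'.2) + (x'.2 - x.2) by ring.
    by apply: le_lt_trans (ler_normD _ _) _; rewrite (splitr d) ltrD // (le_lt_trans yx2).
move=> /(_ _ H); apply: filterS => n Pn t s t' s' t1 s1 t1' s1' h1 h2.
by apply: (Pn (t, s) _ _ (t', s')) => //=; rewrite !in_itv.
Qed.

Lemma isotopy_continuous (H : R -> plane R -> plane R) :
  {within `[0, 1]%classic `*` [set: plane R],
           continuous (fun x : R * plane R => H x.1 x.2)} ->
  forall (t : R) q, 0 <= t <= 1 -> forall e : R, 0 < e ->
  exists2 d : R, 0 < d & forall (t' : R) q', 0 <= t' <= 1 -> `|t' - t| < d ->
    box q d q' -> box (H t q) e (H t' q').
Proof.
move=> /subspace_continuousP cH t q t01 e e0.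
have At : (`[0, 1]%classic `*` [set: plane R]) (t, q) by split => //=; rewrite in_itv.
have nb : nbhs (H t q) (box (H t q) e) by apply/near_boxP; exists e.
have /nbhs_ballP[d d0 hd] := cH (t, q) At _ nb.
exists d => // t' q' t'01 t't [q1 q2].
apply: (hd (t', q')); last by split => //=; rewrite in_itv.
by split; [|split]; rewrite /ball /= distrC.
Qed.

Definition spin u (c : R * R) : plane R := (c.1 * u.1 - c.2 * u.2, c.1 * u.2 + c.2 * u.1).

(** Eight points on the boundary of the square of side 2 in coordinates relative to
    the basis made of u and of u turned by a right angle.  [spin] is the
    multiplication of complex numbers.  The ray of u is met at the initial
    corner, in the middle of a side of the square. *)
Definition corner k : R * R := nth (1, 0)
  [:: (1, 0); (1, 1); (0, 1); (-1, 1); (-1, 0); (-1, -1); (0, -1); (1, -1)] k.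

Definition side k (s : R) : R * R :=
  ((corner k).1 + s * ((corner k.+1).1 - (corner k).1),
   (corner k).2 + s * ((corner k.+1).2 - (corner k).2)).

Lemma side0 k : side k 0 = corner k.
Proof. by rewrite /side !mul0r !addr0 -surjective_pairing. Qed.

Lemma side1 k : side k 1 = corner k.+1.
Proof. by rewrite /side !mul1r ![_ + (_ - _)]addrC !subrK -surjective_pairing. Qed.

Lemma side_acute k s s' : (k < 8)%N -> 0 <= s <= 1 -> 0 <= s' <= 1 ->
  0 < dot (side k s) (side k s').
Proof.
move=> k8 /andP[s0 s1] /andP[s0' s1'].
have h1 : 0 <= s * s' by exact: mulr_ge0.
have h2 : 0 <= (1 - s) * (1 - s') by apply: mulr_ge0; lra.
by case: k k8 => [|[|[|[|[|[|[|[|k]]]]]]]] // _; rewrite /dot /side /corner /=; lra.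
Qed.

Lemma side_bounds k s : (k < 8)%N -> 0 <= s <= 1 ->
  [/\ `|(side k s).1| <= 1, `|(side k s).2| <= 1 & side k s != 0].
Proof.
move=> k8 s01.
have := side_acute k8 s01 s01.
case/andP: s01 => s0 s1 d; split.
- by rewrite ler_norml; case: k k8 {d} => [|[|[|[|[|[|[|[|k]]]]]]]] // _;
    rewrite /side /corner /=; lra.
- by rewrite ler_norml; case: k k8 {d} => [|[|[|[|[|[|[|[|k]]]]]]]] // _;
    rewrite /side /corner /=; lra.
- by apply: contraTN d => /eqP->; rewrite /dot /= !mul0r addr0 ltxx.
Qed.

Lemma side_on_ray k s : (k < 8)%N -> 0 <= s <= 1 ->
  (side k s).2 = 0 -> 0 < (side k s).1 ->
  (k = 0%N /\ s = 0) \/ (k = 7%N /\ s = 1).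
Proof.
move=> k8 /andP[s0 s1]; case: k k8 => [|[|[|[|[|[|[|[|k]]]]]]]] // _;
  rewrite /side /corner /= => h1 h2; try (exfalso; lra).
- by left; split => //; lra.
- by right; split => //; lra.
Qed.

Lemma dot_spin u c c' : dot (spin u c) (spin u c') = dot u u * dot c c'.
Proof. by rewrite /dot /spin /=; ring. Qed.

Lemma det2_spin r u c : det2 r (spin u c) = c.1 * det2 r u + c.2 * dot r u.
Proof. by rewrite /dot /det2 /spin /=; ring. Qed.

Lemma det2_spin2 u c c' : det2 (spin u c) (spin u c') = dot u u * det2 c c'.
Proof. by rewrite /dot /det2 /spin /=; ring. Qed.

Lemma dot_gt0 u : u != 0 -> 0 < dot u u.
Proof.
move=> u0; rewrite lt_neqAle /dot -!expr2 addr_ge0 ?sqr_ge0 // andbT eq_sym.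
apply: contraNN u0 => /eqP uu.
have u1 : u.1 = 0 by nra.
have u2 : u.2 = 0 by nra.
by apply/eqP; rewrite [u]surjective_pairing u1 u2.
Qed.

(** The eight corners lie in the eight directions which are multiples of an eighth
    of a turn, and their determinants with r are [b], [a + b], and so on for some
    [a] and [b] not both 0: exactly one of the eight chords leads from a negative
    value to a nonnegative one. *)
Lemma octant_signs (a b : R) : ~ (a = 0 /\ b = 0) ->
  ((a < 0) && (0 <= a + b))%:R + ((a + b < 0) && (0 <= b))%:R +
  ((b < 0) && (0 <= - a + b))%:R + ((- a + b < 0) && (0 <= - a))%:R +
  ((- a < 0) && (0 <= - a - b))%:R + ((- a - b < 0) && (0 <= - b))%:R +
  ((- b < 0) && (0 <= a - b))%:R + ((a - b < 0) && (0 <= a))%:R = 1 :> R.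
Proof.
move=> ab0; rewrite !leNgt.
have -> : - a - b = - (a + b) by ring.
have -> : - a + b = - (a - b) by ring.
have [s ds] : {s | s = a + b} by exists (a + b).
have [d dd] : {d | d = a - b} by exists (a - b).
rewrite -ds -dd !oppr_lt0.
have [a0|a0|a0] := ltrgt0P a; have [b0|b0|b0] := ltrgt0P b; last by case: ab0.
- have [s0|s0|s0] := ltrgt0P s; try lra.
  by have [d0|d0|d0] := ltrgt0P d; rewrite /= ?addr0 ?add0r.
- have [d0|d0|d0] := ltrgt0P d; try lra.
  by have [s0|s0|s0] := ltrgt0P s; rewrite /= ?addr0 ?add0r.
- have [s0|s0|s0] := ltrgt0P s; try lra; have [d0|d0|d0] := ltrgt0P d; try lra.
  by rewrite /= ?addr0 ?add0r.
- have [d0|d0|d0] := ltrgt0P d; try lra.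
  by have [s0|s0|s0] := ltrgt0P s; rewrite /= ?addr0 ?add0r.
- have [s0|s0|s0] := ltrgt0P s; try lra.
  by have [d0|d0|d0] := ltrgt0P d; rewrite /= ?addr0 ?add0r.
- have [s0|s0|s0] := ltrgt0P s; try lra; have [d0|d0|d0] := ltrgt0P d; try lra.
  by rewrite /= ?addr0 ?add0r.
- have [s0|s0|s0] := ltrgt0P s; try lra; have [d0|d0|d0] := ltrgt0P d; try lra.
  by rewrite /= ?addr0 ?add0r.
- have [s0|s0|s0] := ltrgt0P s; try lra; have [d0|d0|d0] := ltrgt0P d; try lra.
  by rewrite /= ?addr0 ?add0r.
Qed.

(** The square winds once around its center. *)
Lemma square_winding r u : r != 0 -> u != 0 ->
  \sum_(k < 8) xing r (spin u (corner k)) (spin u (corner k.+1)) = 1.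
Proof.
move=> r0 u0; have uu := dot_gt0 u0; have rr := dot_gt0 r0.
have ab0 : ~ (det2 r u = 0 /\ dot r u = 0).
  case=> h1 h2; have : dot r r * dot u u = 0.
    have -> : dot r r * dot u u = det2 r u * det2 r u + dot r u * dot r u.
      by rewrite /dot /det2; ring.
    by rewrite h1 h2; ring.
  by move=> h; have := mulr_gt0 rr uu; rewrite h ltxx.
have h k : (k < 8)%N -> (0 < det2 (spin u (corner k)) (spin u (corner k.+1))) /\
   (det2 (spin u (corner k)) (spin u (corner k.+1)) < 0) = false.
  move=> k8; suff h : 0 < det2 (spin u (corner k)) (spin u (corner k.+1)).
    by split=> //; apply/negbTE; rewrite -leNgt ltW.
  rewrite det2_spin2 mulr_gt0 //.
  by case: k k8 => [|[|[|[|[|[|[|[|k]]]]]]]] // _; rewrite /det2 /corner /=; lra.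
under eq_bigr => k _ do rewrite /xing (h _ (ltn_ord k)).1 (h _ (ltn_ord k)).2 !andbF andbT subr0.
do 8 rewrite big_ord_recr /=; rewrite big_ord0 !det2_spin /corner /=.
move: ab0; move: (det2 r u) (dot r u) => a b ab0.
rewrite !mul1r !mul0r !mulN1r !addr0 !add0r.
exact: octant_signs.
Qed.

Lemma continuous_turn (h : plane R -> plane R) p u r q k : continuous h ->
  continuous (fun s => det2 r (h (p + spin u (side k s)) - q)).
Proof.
move=> hc s.
have c1 : (fun s => p + spin u (side k s)) @ s --> p + spin u (side k s).
  apply: cvgD; first exact: cvg_cst.
  have lin (a b : R) : (fun s => a + s * b) @ s --> a + s * b.
    apply: cvgD; first exact: cvg_cst.
    by apply: cvgM; [exact: cvg_id|exact: cvg_cst].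
  have l1 : (fun s => (side k s).1 * u.1 - (side k s).2 * u.2) @ s -->
      (side k s).1 * u.1 - (side k s).2 * u.2.
    by apply: cvgB; apply: cvgM; try exact: cvg_cst; exact: lin.
  have l2 : (fun s => (side k s).1 * u.2 + (side k s).2 * u.1) @ s -->
      (side k s).1 * u.2 + (side k s).2 * u.1.
    by apply: cvgD; apply: cvgM; try exact: cvg_cst; exact: lin.
  exact: (cvg_pair l1 l2).
have c2 : (fun s => h (p + spin u (side k s))) @ s --> h (p + spin u (side k s)).
  exact: (cvg_comp _ _ c1 (hc _)).
apply: cvgB; apply: cvgM; try exact: cvg_cst.
  apply: cvgB; last exact: cvg_cst.
  exact: (cvg_comp _ _ c2 cvg_snd).
apply: cvgB; last exact: cvg_cst.
exact: (cvg_comp _ _ c2 cvg_fst).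
Qed.

Lemma grid_point n i : (i <= n.+1)%N -> 0 <= (i%:R / n.+1%:R : R) <= 1.
Proof. by move=> i1; rewrite divr_ge0 //= ler_pdivrMr ?ltr0n // mul1r ler_nat. Qed.

Lemma grid_step n i j : (i <= j.+1)%N -> (j <= i.+1)%N ->
  `|i%:R / n.+1%:R - j%:R / n.+1%:R| <= n.+1%:R^-1 :> R.
Proof.
move=> ij ji; rewrite -mulrBl normrM (ger0_norm (x := n.+1%:R^-1)) ?invr_ge0 //.
have : (i%:R : R) <= j%:R + 1 by rewrite natr1 ler_nat.
have : (j%:R : R) <= i%:R + 1 by rewrite natr1 ler_nat.
by move=> h1 h2; rewrite ler_piMl ?invr_ge0 // ler_norml; lra.
Qed.

Section Isotopy.
Variable H : R -> plane R -> plane R.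
Hypothesis cH : {within `[0, 1]%classic `*` [set: plane R],
                 continuous (fun x : R * plane R => H x.1 x.2)}.
Hypothesis homH : forall t, 0 <= t <= 1 -> homeomorphism (H t).
Hypotheses (H0 : H 0 = id).
Variables (p u r : plane R).
Hypotheses (u0 : u != 0) (r0 : r != 0).

(** The image at time t of the boundary of the square around p, as seen from the
    image of p. *)
Definition turn k t s := H t (p + spin u (side k s)) - H t p.

Lemma turn_neq0 k t s : (k < 8)%N -> 0 <= t <= 1 -> 0 <= s <= 1 -> turn k t s != 0.
Proof.
move=> k8 t01 s01; rewrite /turn subr_eq0.
have [_ [g [_ gK _]]] := homH t01.
rewrite (can_eq gK) -subr_eq0 addrAC subrr add0r.
have [_ _ sd0] := side_bounds k8 s01.
have : 0 < dot (spin u (side k s)) (spin u (side k s)).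
  by rewrite dot_spin mulr_gt0 // dot_gt0.
by apply: contraTN => /eqP ->; rewrite /dot !mul0r addr0 ltxx.
Qed.

Lemma turn_continuous k (t s : R) : 0 <= t <= 1 -> 0 <= s <= 1 -> forall e : R, 0 < e ->
  exists2 d : R, 0 < d & forall t' s' : R, 0 <= t' <= 1 -> 0 <= s' <= 1 ->
    `|t' - t| < d -> `|s' - s| < d -> box (turn k t s) e (turn k t' s').
Proof.
move=> t01 s01 e1 e10.
have e2 : 0 < e1 / 2 by rewrite divr_gt0.
have [d1 d10 hd1] := isotopy_continuous cH (p + spin u (side k s)) t01 e2.
have [d2 d20 hd2] := isotopy_continuous cH p t01 e2.
pose w := (corner k.+1).1 - (corner k).1; pose w' := (corner k.+1).2 - (corner k).2.
pose c := (`|w * u.1| + `|w' * u.2|) + (`|w * u.2| + `|w' * u.1|) + 1.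
have c0 : 0 < c by rewrite ltr_wpDl // !addr_ge0.
exists (Num.min (Num.min d1 d2) (d1 / c)); first by rewrite !lt_min d10 d20 divr_gt0.
move=> t' s' t01' s01'; rewrite !lt_min => /andP[/andP[td1 td2] _] /andP[_ sd].
have [h1 h2] := hd2 t' p t01' td2 (box_center _ d20).
have sc x : `|x| <= c -> `|(s' - s) * x| < d1.
  move=> xc; rewrite normrM (le_lt_trans (ler_wpM2l _ xc)) //.
  by rewrite -ltr_pdivlMr.
have [h3 h4] : box (H t (p + spin u (side k s))) (e1 / 2) (H t' (p + spin u (side k s'))).
  apply: hd1 => //; split; rewrite /spin /side /= -/w -/w'.
    have -> : p.1 + (((corner k).1 + s' * w) * u.1 - ((corner k).2 + s' * w') * u.2) -
       (p.1 + (((corner k).1 + s * w) * u.1 - ((corner k).2 + s * w') * u.2)) =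
       (s' - s) * (w * u.1 - w' * u.2) by ring.
    apply: sc; apply: le_trans (ler_normB _ _) _.
    by rewrite /c -addrA lerDl !addr_ge0.
  have -> : p.2 + (((corner k).1 + s' * w) * u.2 + ((corner k).2 + s' * w') * u.1) -
       (p.2 + (((corner k).1 + s * w) * u.2 + ((corner k).2 + s * w') * u.1)) =
       (s' - s) * (w * u.2 + w' * u.1) by ring.
  apply: sc; apply: le_trans (ler_normD _ _) _.
  by rewrite /c addrAC lerDr !addr_ge0.
rewrite /turn; split => /=.
  have -> : (H t' (p + spin u (side k s'))).1 - (H t' p).1 - ((H t (p + spin u (side k s))).1 - (H t p).1) =
   ((H t' (p + spin u (side k s'))).1 - (H t (p + spin u (side k s))).1) - ((H t' p).1 - (H t p).1) by ring.
  by rewrite (splitr e1) (le_lt_trans (ler_normB _ _)) // ltrD.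
have -> : (H t' (p + spin u (side k s'))).2 - (H t' p).2 - ((H t (p + spin u (side k s))).2 - (H t p).2) =
   ((H t' (p + spin u (side k s'))).2 - (H t (p + spin u (side k s))).2) - ((H t' p).2 - (H t p).2) by ring.
by rewrite (splitr e1) (le_lt_trans (ler_normB _ _)) // ltrD.
Qed.

(** The vectors [turn k t s] never vanish because an isotopy is injective at all
    times. *)
Lemma turn_fine : \forall n \near \oo, forall k : 'I_8, acute_below n (turn k).
Proof.
apply: filter_forall => k; apply: uniformly_acute => t s t01 s01.
  exact: turn_continuous.
exact: turn_neq0.
Qed.

(** At time 0 the polygon cut on the square winds once around the origin.  The
    crossing number with the ray r of a closed polygon does not change when all
    its vertices move a little, so it is still 1 at time 1. *)
Lemma turn_winding n : (forall k : 'I_8, acute_below n (turn k)) ->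
  \sum_(k < 8) \sum_(j < n.+1)
    xing r (turn k 1 (j%:R / n.+1%:R)) (turn k 1 (j.+1%:R / n.+1%:R)) = 1.
Proof.
move=> ac'.
pose V c := \sum_(i < n.+1) xing r (H (i%:R / n.+1%:R) (p + spin u c) - H (i%:R / n.+1%:R) p)
 (H (i.+1%:R / n.+1%:R) (p + spin u c) - H (i.+1%:R / n.+1%:R) p).
pose T t k := \sum_(j < n.+1) xing r (turn k t (j%:R / n.+1%:R)) (turn k t (j.+1%:R / n.+1%:R)).
have n0 : (0 : R) < n.+1%:R by rewrite ltr0n.
have f0 : 0%:R / n.+1%:R = 0 :> R by rewrite mul0r.
have f1 : n.+1%:R / n.+1%:R = 1 :> R by rewrite divff ?gt_eqF.
have rect k : (k < 8)%N -> T 0 k + V (corner k.+1) = V (corner k) + T 1 k.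
  move=> k8; have := @grid_sum r (fun i j => turn k (i%:R / n.+1%:R) (j%:R / n.+1%:R)) n.+1 n.+1.
  rewrite /= f0 f1 => grid.
  have E0 : V (corner k) =
    \sum_(i < n.+1) xing r (turn k (i%:R / n.+1%:R) 0) (turn k (i.+1%:R / n.+1%:R) 0).
    by apply: eq_bigr => i _; rewrite /turn side0.
  have E1 : V (corner k.+1) =
    \sum_(i < n.+1) xing r (turn k (i%:R / n.+1%:R) 1) (turn k (i.+1%:R / n.+1%:R) 1).
    by apply: eq_bigr => i _; rewrite /turn side1.
  rewrite E0 E1; apply: grid => i i' j j' im im' ii' i'i jn j'n jj' j'j.
  by apply: (ac' (Ordinal k8)); rewrite ?grid_point ?grid_step.
have T0 k : (k < 8)%N -> T 0 k = xing r (spin u (corner k)) (spin u (corner k.+1)).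
  move=> k8; rewrite -side0 -side1.
  have K0 s : turn k 0 s = spin u (side k s) by rewrite /turn H0 addrAC subrr add0r.
  have c := @xing_collapse r (fun j => turn k 0 (j%:R / n.+1%:R)) n.+1.
  rewrite /= f0 f1 in c; rewrite -!K0; apply: c => i j i1 j1.
  by rewrite !K0 dot_spin mulr_gt0 ?dot_gt0 ?side_acute ?grid_point.
rewrite (_ : \sum_(k < 8) _ = \sum_(k < 8) T 1 k) //.
transitivity (\sum_(k < 8) xing r (spin u (corner k)) (spin u (corner k.+1))); last first.
  exact: square_winding.
under [RHS]eq_bigr => k _ do rewrite -T0 //.
have := rect 0%N isT; have := rect 1%N isT; have := rect 2%N isT.
have := rect 3%N isT; have := rect 4%N isT; have := rect 5%N isT.
have := rect 6%N isT; have := rect 7%N isT.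
rewrite !big_ord_recr !big_ord0 /=; have -> : corner 8 = corner 0 by [].
lra.
Qed.

End Isotopy.

(** The image of a small square around p meets the ray r from h p only at the image
    of the point p + u.  As the image winds once around h p, it must cross r there
    counterclockwise: the points just after p + u on the square are sent to the
    left of r, and those just before to its right.  This is the only place where
    orientation enters: a reflection also preserves all the local incidences of a
    diagram, but it exchanges the two sides. *)
Lemma isotopy_turn (h : plane R -> plane R) p u r : isotopic_to_id h -> u != 0 ->
  det2 r (h (p + u) - h p) = 0 -> 0 < dot r (h (p + u) - h p) ->
  (forall c : R * R, `|c.1| <= 1 -> `|c.2| <= 1 ->
     det2 r (h (p + spin u c) - h p) = 0 -> 0 < dot r (h (p + spin u c) - h p) ->
     c.2 = 0 /\ 0 < c.1) ->
  forall e : R, 0 < e -> exists s : R, [/\ 0 < s, s < e,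
    0 < det2 r (h (p + spin u (1, s)) - h p) &
    det2 r (h (p + spin u (1, - s)) - h p) < 0].
Proof.
move=> iso u0 on1 on2 off e e0.
have r0 : r != 0.
  by apply: contraTN on2 => /eqP ->; rewrite /dot !mul0r addr0 ltxx.
case: iso => H [cH homH H0 H1].
have K1 k s : turn H p u k 1 s = h (p + spin u (side k s)) - h p by rewrite /turn H1.
have [n [ne ac']] : exists n, n.+1%:R^-1 < e /\ forall k : 'I_8, acute_below n (turn H p u k).
  have [n [h1 h2]] := filter_ex (filterI (near_infty_natSinv_lt (PosNum e0))
    (turn_fine cH homH p u0)).
  by exists n.
pose T k := \sum_(j < n.+1)
  xing r (turn H p u k 1 (j%:R / n.+1%:R)) (turn H p u k 1 (j.+1%:R / n.+1%:R)).
have T1 : \sum_(k < 8) T k = 1 by exact: turn_winding.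
have n0 : (0 : R) < n.+1%:R by rewrite ltr0n.
have f0 : 0%:R / n.+1%:R = 0 :> R by rewrite mul0r.
have f1 : n.+1%:R / n.+1%:R = 1 :> R by rewrite divff ?gt_eqF.
have hc : continuous h.
  by rewrite -H1; case: (homH 1 _); rewrite ?ler01 ?lexx.
(* only the first and the last of the small chords come near the point on r *)
have step k j : (k < 8)%N -> (j < n.+1)%N -> ~~ ((k == 0) && (j == 0))%N ->
    ~~ ((k == 7) && (j == n))%N ->
    xing r (turn H p u k 1 (j%:R / n.+1%:R)) (turn H p u k 1 (j.+1%:R / n.+1%:R)) = 0.
  move=> k8 jn nst nen.
  have jj : j%:R / n.+1%:R <= j.+1%:R / n.+1%:R :> R.
    by rewrite ler_pM2r ?invr_gt0 // ler_nat.
  have [/andP[a0 a1] /andP[b0 b1]] := (grid_point (ltnW jn), grid_point jn).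
  have lenb : j.+1%:R / n.+1%:R - j%:R / n.+1%:R <= n.+1%:R^-1 :> R.
    by apply: le_trans (ler_norm _) _; apply: grid_step; [exact: leqnn|exact: leqW].
  have one : 0 <= (1 : R) <= 1 by apply/andP; split.
  have i0 : 0 <= n.+1%:R^-1 :> R by rewrite invr_ge0 ltW.
  have acs := ac' (Ordinal k8).
  move: jj a0 a1 b0 b1 lenb i0; rewrite /acute_below in acs; move: acs.
  set a := j%:R / n.+1%:R; set b := j.+1%:R / n.+1%:R; set i := n.+1%:R^-1.
  move=> acs jj a0 a1 b0 b1 lenb i0.
  apply: (@xing_path r (turn H p u k 1)) => //.
  - have cont : continuous (fun s => det2 r (turn H p u k 1 s)).
      have -> : (fun s => det2 r (turn H p u k 1 s)) =
        (fun s => det2 r (h (p + spin u (side k s)) - h p)).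
        by apply/funext => s'; rewrite K1.
      exact: continuous_turn.
    exact: continuous_subspaceT.
  - move=> s /andP[as_ sb].
    have s01 : 0 <= s <= 1 by rewrite (le_trans a0 as_) (le_trans sb b1).
    have a01 : 0 <= a <= 1 by rewrite a0 a1.
    have b01 : 0 <= b <= 1 by rewrite b0 b1.
    split; apply: acs => //; rewrite ?subrr ?normr0 //.
      by rewrite ger0_norm ?subr_ge0 // (le_trans _ lenb) // lerB.
    by rewrite ler0_norm ?subr_le0 // opprB (le_trans _ lenb) // lerB.
  - move=> s /andP[as_ sb]; rewrite K1 => h1 h2.
    have s01 : 0 <= s <= 1 by rewrite (le_trans a0 as_) (le_trans sb b1).
    have [c1 c2 _] := side_bounds k8 s01.
    have [e1 e2] := off _ c1 c2 h1 h2.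
    have [[k0 s0]|[k7 s1]] := side_on_ray k8 s01 e1 e2.
      rewrite k0 eqxx /= in nst; rewrite s0 in as_.
      by move: as_; rewrite /a leNgt divr_gt0 // ltr0n lt0n.
    rewrite k7 eqxx /= in nen; rewrite s1 in sb.
    move: sb; rewrite /b leNgt ltr_pdivrMr // mul1r ltr_nat ltnS ltn_neqAle nen.
    by rewrite -ltnS jn.
have z0E : turn H p u 0 1 0 = h (p + u) - h p.
  rewrite K1 side0; congr (h (p + _) - _).
  by rewrite /spin /corner /= !mul1r !mul0r subr0 addr0 -surjective_pairing.
have T10 : T 0%N = xing r (h (p + u) - h p) (turn H p u 0 1 n.+1%:R^-1).
  rewrite /T big_ord_recl big1 ?addr0 => [|i _]; last first.
    by apply: (step 0%N (lift ord0 i)) => //; exact: ltn_ord.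
  by rewrite f0 z0E mul1r.
have T17 : T 7%N = xing r (turn H p u 7 1 (1 - n.+1%:R^-1)) (h (p + u) - h p).
  rewrite /T big_ord_recr /= big1 ?add0r => [|i _]; last first.
    by apply: (step 7 i) => //; [exact: leqW (ltn_ord i)|rewrite /= ltn_eqF].
  have -> : h (p + u) - h p = turn H p u 7 1 1 by rewrite -z0E !K1 side1 side0.
  have -> : n%:R / n.+1%:R = 1 - n.+1%:R^-1 :> R.
    have nE : n%:R / n.+1%:R + n.+1%:R^-1 = 1 :> R.
      by rewrite -[X in _ + X]mul1r -mulrDl natr1 divff ?gt_eqF.
    by apply/eqP; rewrite eq_sym subr_eq nE.
  by rewrite f1.
have T1k k : (0 < k < 7)%N -> T k = 0.
  move=> k7; rewrite /T big1 // => i _.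
  by apply: step => //; case: k k7 => [|[|[|[|[|[|[|k]]]]]]].
move: T1; rewrite !big_ord_recr !big_ord0 /= T10 T17 !T1k // !addr0 add0r.
have e01 : turn H p u 0 1 n.+1%:R^-1 = h (p + spin u (1, n.+1%:R^-1)) - h p.
  rewrite K1; have -> // : side 0 n.+1%:R^-1 = (1, n.+1%:R^-1) :> R * R.
  by rewrite /side /corner /= subrr mulr0 addr0 subr0 mulr1 add0r.
have e71 : turn H p u 7 1 (1 - n.+1%:R^-1) = h (p + spin u (1, - n.+1%:R^-1)) - h p.
  rewrite K1; have -> // : side 7 (1 - n.+1%:R^-1) = (1, - n.+1%:R^-1) :> R * R.
  by rewrite /side /corner /= subrr mulr0 addr0 sub0r opprK mulr1 addKr.
have acz : 0 < dot (turn H p u 0 1 0) (turn H p u 0 1 n.+1%:R^-1).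
  have h1 : 0 <= (n.+1%:R^-1 : R) <= 1.
    by rewrite invr_ge0 ltW //= invf_le1 // ler1n.
  have [h0 h2] := andP h1; have one : 0 <= (1 : R) <= 1 by apply/andP; split.
  have zero : 0 <= (0 : R) <= 1 by apply/andP; split.
  by apply: (ac' ord0) => //; rewrite ?subrr ?normr0 // subr0 ger0_norm.
(* the two remaining crossings add up to 1; since the common point of the two
   chords is on r, this determines the sides of their other end points *)
move: acz; rewrite z0E e01 e71; set z0 := h (p + u) - h p.
set z1 := h (p + _) - h p; set zl := h (p + _) - h p => acz.
rewrite /xing on1 ltxx lexx /= !andbT subr0 sub0r => sum1.
exists n.+1%:R^-1; split; rewrite ?invr_gt0 //; last first.
  apply: contra_eqT sum1 => /negbTE nl; rewrite -/zl nl /= addr0.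
  by case: (_ && _); rewrite /= ?mulr1n ?mulr0n ?oppr0 lt_eqF // (lt_trans ltrN10 ltr01).
rewrite -/z1 ltNge le_eqVlt; apply/negP => /orP[/eqP b1|b1].
  have d1 : 0 < dot r z1.
    have : 0 < dot r z0 * dot r z1.
      have -> : dot r z0 * dot r z1 = dot r r * dot z0 z1 - det2 r z0 * det2 r z1.
        by rewrite /dot /det2; ring.
      by rewrite on1 mul0r subr0 mulr_gt0 ?dot_gt0.
    by rewrite pmulr_rgt0.
  have [||e1 _] := off (1, n.+1%:R^-1) _ _ b1 d1; rewrite /= ?normr1 //.
    by rewrite ger0_norm ?invr_ge0 ?(ltW n0) // invf_le1 // ler1n.
  by move: n0; rewrite -invr_gt0 [_^-1]e1 ltxx.
have : det2 z0 z1 < 0.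
  rewrite -(pmulr_rlt0 _ (dot_gt0 r0)).
  have -> : dot r r * det2 z0 z1 = dot r z0 * det2 r z1 - det2 r z0 * dot r z1.
    by rewrite /dot /det2; ring.
  by rewrite on1 mul0r subr0 pmulr_rlt0.
move=> dlt; move: sum1; rewrite b1 dlt /= mulr1n => /eqP.
by case: (_ && _); rewrite /= ?addNr ?addr0 lt_eqF // (lt_trans ltrN10).
Qed.

End Winding.

(** * Rays, sectors and their images *)

Section Rays.
Variable R : realType.
Implicit Types (u v w z p q : plane R) (e : R).

Definition on_ray u w : bool := (det2 u w == 0) && (0 < dot u w).

Lemma det2Nl u v : det2 (- u) v = - det2 u v.
Proof. by rewrite /det2 /=; ring. Qed.

Lemma det2Nr u v : det2 u (- v) = - det2 u v.
Proof. by rewrite /det2 /=; ring. Qed.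

Lemma on_ray_neq0 u w : on_ray u w -> (u != 0) * (w != 0).
Proof.
case/andP=> _ d; split; apply: contraTN d => /eqP->.
  by rewrite /dot !mul0r addr0 ltxx.
by rewrite /dot !mulr0 addr0 ltxx.
Qed.

Lemma on_ray_pos u w : on_ray u w -> exists2 s : R, 0 < s & w = (s * u.1, s * u.2).
Proof.
case/andP=> /eqP d1 d2.
have u0 : 0 < dot u u.
  by apply: dot_gt0; apply: contraTN d2 => /eqP->; rewrite /dot !mul0r addr0 ltxx.
exists (dot u w / dot u u); first exact: divr_gt0.
have e1 : dot u u * w.1 = dot u w * u.1.
  have -> : dot u u * w.1 = dot u w * u.1 - u.2 * det2 u w by rewrite /dot /det2; ring.
  by rewrite d1 mulr0 subr0.
have e2 : dot u u * w.2 = dot u w * u.2.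
  have -> : dot u u * w.2 = dot u w * u.2 + u.1 * det2 u w by rewrite /dot /det2; ring.
  by rewrite d1 mulr0 addr0.
rewrite [w]surjective_pairing; congr (_, _).
  by rewrite mulrAC -e1 mulrAC divff ?mul1r ?gt_eqF.
by rewrite mulrAC -e2 mulrAC divff ?mul1r ?gt_eqF.
Qed.

Lemma on_ray_scale u (s : R) : u != 0 -> 0 < s -> on_ray u (s * u.1, s * u.2).
Proof.
move=> u0 s0; apply/andP; split; first by rewrite /det2 /=; apply/eqP; ring.
have -> : dot u (s * u.1, s * u.2) = s * dot u u by rewrite /dot /=; ring.
by rewrite mulr_gt0 ?dot_gt0.
Qed.

Lemma on_ray_sym u w : on_ray u w -> on_ray w u.
Proof. by rewrite /on_ray det2C oppr_eq0 dotC. Qed.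

Lemma on_ray_trans v u w : on_ray u v -> on_ray v w -> on_ray u w.
Proof.
move=> uv vw; have [u0 _] := on_ray_neq0 uv.
have [s s0 ->] := on_ray_pos vw; have [t t0 ->] := on_ray_pos uv.
by rewrite /= !mulrA; apply: on_ray_scale => //; exact: mulr_gt0.
Qed.

Lemma det2_ray u w v : on_ray u w -> exists2 s : R, 0 < s & det2 w v = s * det2 u v.
Proof.
by move=> /on_ray_pos[s s0 ->]; exists s => //; rewrite /det2 /=; ring.
Qed.

Lemma det2_rayr u w v : on_ray u w -> exists2 s : R, 0 < s & det2 v w = s * det2 v u.
Proof.
by move=> /on_ray_pos[s s0 ->]; exists s => //; rewrite /det2 /=; ring.
Qed.

Lemma ccw_ray u w v w' : on_ray w w' -> ccw u w' v = ccw u w v.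
Proof.
move=> h; rewrite /ccw.
have [s s0 ->] := det2_rayr u h; have [t t0 ->] := det2_ray v h.
by rewrite !pmulr_rgt0.
Qed.

Lemma ccw0 u v : ccw u 0 v = false.
Proof. by rewrite /ccw /det2 /= !mulr0 !mul0r subrr ltxx !andbF. Qed.

Lemma ccw_rot u v w : ccw u v w = ccw v w u.
Proof. by rewrite /ccw; case: (_ < _); case: (_ < _); case: (_ < _). Qed.

Lemma ccw_asym u v w : ccw u v w -> ccw u w v = false.
Proof.
rewrite /ccw (det2C u w) (det2C w v) (det2C v u) !oppr_gt0.
have [] := ltrgt0P (det2 u v); have [] := ltrgt0P (det2 v w); have [] := ltrgt0P (det2 w u) => //=.
Qed.

Lemma det2_eq0_ray u v : u != 0 -> v != 0 -> det2 u v = 0 -> ~~ on_ray u v ->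
  on_ray u (- v).
Proof.
move=> u0 v0 d; rewrite /on_ray d eqxx /= -leNgt => h.
have -> : det2 u (- v) = - det2 u v by rewrite /det2 /=; ring.
rewrite d oppr0 eqxx /=.
have -> : dot u (- v) = - dot u v by rewrite /dot /=; ring.
rewrite oppr_gt0 lt_neqAle h andbT; apply/negP => /eqP duv.
have := mulr_gt0 (dot_gt0 u0) (dot_gt0 v0).
have -> : dot u u * dot v v = dot u v * dot u v + det2 u v * det2 u v.
  by rewrite /dot /det2; ring.
by rewrite duv d !mulr0 addr0 ltxx.
Qed.

Lemma det2_opposite u v : u != 0 -> v != 0 -> det2 u v = 0 -> ~~ on_ray u v ->
  exists2 k : R, 0 < k & forall w, det2 v w = k * det2 w u.
Proof.
move=> u0 v0 d uv; have [k k0 e] := on_ray_pos (det2_eq0_ray u0 v0 d uv).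
exists k => // w; have e1 : v.1 = - (k * u.1) by rewrite -[v]opprK e.
have e2 : v.2 = - (k * u.2) by rewrite -[v]opprK e.
by rewrite /det2 e1 e2; ring.
Qed.

(** As [ccw] consists of products of signs of determinants, the case of two opposite
    rays is separate and relies on [det2_opposite]. *)
Lemma ccw_total u v w : u != 0 -> v != 0 -> w != 0 ->
  ~~ on_ray u v -> ~~ on_ray v w -> ~~ on_ray w u -> ccw u v w || ccw u w v.
Proof.
move=> u0 v0 w0 uv vw wu.
have two0 a b c : a != 0 -> b != 0 -> c != 0 -> ~~ on_ray a b -> ~~ on_ray b c ->
    ~~ on_ray c a -> det2 a b = 0 -> det2 b c = 0 -> False.
  move=> a0 b0 c0 ab bc ca d1 d2.
  have h1 := det2_eq0_ray a0 b0 d1 ab.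
  have h2 : on_ray (- b) c.
    have := det2_eq0_ray b0 c0 d2 bc; rewrite /on_ray.
    have -> : det2 b (- c) = det2 (- b) c by rewrite /det2 /=; ring.
    by have -> : dot b (- c) = dot (- b) c by rewrite /dot /=; ring.
  by case/negP: ca; apply: on_ray_sym; exact: on_ray_trans h1 h2.
have one0 a b c : a != 0 -> b != 0 -> c != 0 -> ~~ on_ray a b -> ~~ on_ray b c ->
    ~~ on_ray c a -> det2 a b = 0 -> ccw a b c || ccw a c b.
  move=> a0 b0 c0 ab bc ca d.
  have [k k0 e] := det2_opposite a0 b0 d ab.
  rewrite /ccw (det2C a c) (det2C c b) (det2C b a) d !oppr_gt0 ltxx !andbF /= !orbF e.
  rewrite pmulr_rgt0 // pmulr_rlt0 // !andbb orbC -neq_lt; apply/negP => /eqP ca0.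
  by apply: (two0 c a b) => //; rewrite -?ca0.
have [d|a] := eqVneq (det2 u v) 0; first exact: one0.
have [d|b] := eqVneq (det2 v w) 0.
  by have := one0 v w u v0 w0 u0 vw wu uv d; rewrite -ccw_rot [ccw v u w]ccw_rot [ccw u w v]ccw_rot.
have [d|c] := eqVneq (det2 w u) 0.
  by have := one0 w u v w0 u0 v0 wu uv vw d; rewrite ccw_rot [ccw w v u]ccw_rot [ccw v u w]ccw_rot.
rewrite /ccw (det2C u w) (det2C w v) (det2C v u) !oppr_gt0.
by have [//|//|/eqP] := ltrgt0P (det2 u v); rewrite ?(negbTE a) //;
  have [//|//|/eqP] := ltrgt0P (det2 v w); rewrite ?(negbTE b) //;
  have [//|//|/eqP] := ltrgt0P (det2 w u); rewrite ?(negbTE c).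
Qed.

Lemma near_det2_gt0 u z : 0 < det2 u z -> \forall z' \near z, 0 < det2 u z'.
Proof.
move=> d; have c : (fun z' : plane R => det2 u z') @ z --> det2 u z.
  by apply: cvgB; apply: cvgM; try exact: cvg_cst; [exact: cvg_snd|exact: cvg_fst].
exact: (c _ (lt_nbhsr d)).
Qed.

Lemma near_dot_gt0 u z : 0 < dot u z -> \forall z' \near z, 0 < dot u z'.
Proof.
move=> d; have c : (fun z' : plane R => dot u z') @ z --> dot u z.
  by apply: cvgD; apply: cvgM; try exact: cvg_cst; [exact: cvg_fst|exact: cvg_snd].
exact: (c _ (lt_nbhsr d)).
Qed.

Lemma near_ccw u v z : ccw u z v -> \forall z' \near z, ccw u z' v.
Proof.
have sw : det2 z v = det2 (- v) z by rewrite /det2 /=; ring.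
have sw' z' : det2 z' v = det2 (- v) z' by rewrite /det2 /=; ring.
rewrite /ccw !sw => /or3P[/andP[h1 h2]|/andP[h1 h2]|/andP[h1 h2]].
- by near=> z'; rewrite sw' (near (near_det2_gt0 h1) z') ?(near (near_det2_gt0 h2) z').
- by near=> z'; rewrite sw' h2 (near (near_det2_gt0 h1) z') ?orbT.
- by near=> z'; rewrite sw' h1 (near (near_det2_gt0 h2) z') ?orbT.
Unshelve. all: by end_near.
Qed.

Lemma near_off_ray u z : z != 0 -> ~~ on_ray u z -> \forall z' \near z, ~~ on_ray u z'.
Proof.
move=> z0; have [->|u0] := eqVneq u 0.
  by move=> _; near=> z'; apply/negP => /andP[_]; rewrite /dot !mul0r addr0 ltxx.
have [d|d|/esym d] := ltrgt0P (det2 u z) => h.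
- by near=> z'; rewrite /on_ray negb_and gt_eqF // (near (near_det2_gt0 d) z').
- have d' : 0 < det2 (- u) z.
    by rewrite det2Nl oppr_gt0.
  near=> z'; rewrite /on_ray negb_and lt_eqF //.
  have : 0 < det2 (- u) z' by rewrite (near (near_det2_gt0 d') z').
  by rewrite det2Nl oppr_gt0.
- have /andP[_ d'] := det2_eq0_ray u0 z0 (esym d) h.
  have d2 : 0 < dot (- u) z by rewrite (_ : dot (- u) z = dot u (- z)) // /dot /=; ring.
  near=> z'; rewrite /on_ray negb_and -leNgt; apply/orP; right.
  have : 0 < dot (- u) z' by rewrite (near (near_dot_gt0 d2) z').
  have -> : dot (- u) z' = - dot u z' by rewrite /dot /=; ring.
  by rewrite oppr_gt0 => /ltW.
Unshelve. all: by end_near.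
Qed.

(** Just on the left of the ray u one is in the sector which starts at u, wherever
    it ends. *)
Lemma near_ccw_left u v z : v != 0 -> ~~ on_ray u v -> on_ray u z ->
  \forall z' \near z, 0 < det2 u z' -> ccw u z' v.
Proof.
move=> v0 uv uz; have [u0 z0] := on_ray_neq0 uz.
have [d|d|d] := ltrgt0P (det2 u v).
- have dz : 0 < det2 (- v) z.
    have [s s0 e] := det2_ray v uz.
    by rewrite det2Nl -det2C e mulr_gt0.
  near=> z' => h; have : 0 < det2 (- v) z' by rewrite (near (near_det2_gt0 dz) z').
  by rewrite det2Nl -det2C /ccw h => ->.
- by near=> z' => h; rewrite /ccw h (det2C v u) oppr_gt0 d !orbT.
- have [k k0 e] := det2_opposite u0 v0 d uv.
  near=> z' => h; rewrite /ccw h (det2C z' v) (e z') (det2C z' u).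
  by rewrite mulrN opprK mulr_gt0.
Unshelve. all: by end_near.
Qed.

Lemma near_ccw_right u v z : v != 0 -> ~~ on_ray u v -> on_ray u z ->
  \forall z' \near z, det2 u z' < 0 -> ccw v z' u.
Proof.
move=> v0 uv uz; have [u0 z0] := on_ray_neq0 uz.
have sw z' : det2 z' u = - det2 u z' by rewrite det2C.
have [d|d|d] := ltrgt0P (det2 u v).
- by near=> z' => h; rewrite /ccw sw oppr_gt0 h d /= orbT.
- have dz : 0 < det2 v z.
    have [s s0 e] := det2_rayr v uz.
    by rewrite e mulr_gt0 // det2C oppr_gt0.
  near=> z' => h; have : 0 < det2 v z' by rewrite (near (near_det2_gt0 dz) z').
  by rewrite /ccw sw oppr_gt0 h => ->.
- have [k k0 e] := det2_opposite u0 v0 d uv.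
  near=> z' => h; rewrite /ccw sw oppr_gt0 h (e z') (det2C z' u).
  by rewrite pmulr_rgt0 // oppr_gt0 h.
Unshelve. all: by end_near.
Qed.

Lemma det2_shift u w c (t k : R) :
  det2 u (w.1 + t * (k * c.1 - w.1), w.2 + t * (k * c.2 - w.2)) =
  (1 - t) * det2 u w + t * (k * det2 u c).
Proof. by rewrite /det2 /=; ring. Qed.

(** A sector may be larger than a half plane, hence not convex, but it is always
    star-shaped with respect to the points of a middle direction. *)
Lemma sector_center u v : u != 0 -> v != 0 -> ~~ on_ray u v ->
  exists c, forall k : R, 0 < k -> ccw u (k * c.1, k * c.2) v /\
    forall w (t : R), ccw u w v -> 0 <= t <= 1 ->
      ccw u (w.1 + t * (k * c.1 - w.1), w.2 + t * (k * c.2 - w.2)) v.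
Proof.
move=> u0 v0 uv.
have comb (t x y : R) : 0 <= t <= 1 -> 0 < x -> 0 < y -> 0 < (1 - t) * x + t * y.
  move=> /andP[t0 t1] x0 y0; have [->|tn] := eqVneq t 0; first by rewrite subr0 mul1r mul0r addr0.
  rewrite ltr_wpDl ?mulr_gt0 ?mulr_ge0 ?subr_ge0 ?(ltW x0) //.
  by rewrite lt_neqAle eq_sym tn.
have scl x (c : plane R) (k : R) : det2 x (k * c.1, k * c.2) = k * det2 x c.
  by rewrite /det2 /=; ring.
have ccwE w : ccw u w v = [|| (0 < det2 u w) && (0 < det2 (- v) w),
    (0 < det2 (- v) w) && (det2 u v < 0) | (det2 u v < 0) && (0 < det2 u w)].
  by rewrite /ccw det2Nl -det2C (det2C v u) oppr_gt0.
(* the center is u + v if the angle is less than pi, - u - v if it is larger,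
   and u turned by a right angle for a half plane *)
have [d|d|d] := ltrgt0P (det2 u v).
- exists (u + v).
  have d1 : 0 < det2 u (u + v) by rewrite (_ : det2 _ _ = det2 u v) // /det2 /=; ring.
  have d2 : 0 < det2 (- v) (u + v) by rewrite (_ : det2 _ _ = det2 u v) // /det2 /=; ring.
  move: (u + v) d1 d2 => c d1 d2 k k0.
  rewrite ccwE !scl !mulr_gt0 //; split => // w t.
  rewrite !ccwE (ltNge (det2 u v)) (ltW d) /= andbF !orbF => /andP[h1 h2] t01.
  by rewrite !det2_shift !comb ?mulr_gt0.
- exists (- u - v).
  have d1 : 0 < det2 u (- u - v).
    by rewrite (_ : det2 _ _ = - det2 u v) ?oppr_gt0 // /det2 /=; ring.
  have d2 : 0 < det2 (- v) (- u - v).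
    by rewrite (_ : det2 _ _ = - det2 u v) ?oppr_gt0 // /det2 /=; ring.
  move: (- u - v) d1 d2 => c d1 d2 k k0.
  rewrite ccwE !scl !mulr_gt0 //; split => // w t.
  rewrite !ccwE d /= andbT => h t01; rewrite !det2_shift.
  case/or3P: h => [/andP[h1 h2]|h2|h1].
  + by rewrite !comb ?mulr_gt0.
  + by rewrite (comb _ _ _ _ h2) ?mulr_gt0 ?orbT.
  + by rewrite (comb _ _ _ _ h1) ?mulr_gt0 ?orbT.
- have [m m0 e] := det2_opposite u0 v0 d uv.
  have ccwE2 w : ccw u w v = (0 < det2 u w).
    rewrite ccwE d ltxx /= andbF !orbF det2Nl e (det2C w u) mulrN opprK.
    by rewrite pmulr_rgt0 // andbb.
  exists (- u.2, u.1).
  have d1 : 0 < det2 u (- u.2, u.1).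
    by rewrite (_ : det2 _ _ = dot u u) ?dot_gt0 // /det2 /dot /=; ring.
  move: (- u.2, u.1) d1 => c d1 k k0.
  rewrite ccwE2 scl mulr_gt0 //; split=> // w t; rewrite !ccwE2 => h t01.
  by rewrite det2_shift comb ?mulr_gt0.
Qed.

(** Continuous induction on a segment: the indicator function of P would be
    continuous, against the intermediate value theorem. *)
Lemma locally_constant_itv (P : R -> Prop) (a b : R) : a <= b ->
  (forall t, a <= t <= b -> \forall s \near t, a <= s <= b -> (P s <-> P t)) ->
  P a -> P b.
Proof.
move=> ab loc Pa; apply: contrapT => Pb.
pose f (s : R) : R := if `[< P s >] then 1 else 0.
have cf : {within `[a, b], continuous f}.
  apply/subspace_continuousP => x /=; rewrite in_itv /= => xab U /nbhs_singleton Ux.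
  apply: filterS (loc x xab) => s h; rewrite /= in_itv /= => /h Psx.
  suff e : f s = f x by have : U (f x) := Ux; rewrite -e.
  by rewrite /f; congr (if _ then _ else _); apply/asboolP/asboolP; rewrite Psx.
have [|s _] := IVT ab cf (v := 2^-1).
  rewrite /f (asboolT Pa) (asboolF Pb) ge_min le_max.
  by rewrite invr_ge0 ler0n invf_le1 ?ltr0n // ler1n !orbT.
by rewrite /f; case: asboolP => _; lra.
Qed.

End Rays.

Section Stars.
Variable R : realType.
Implicit Types (u v w z p q : plane R) (C : set (plane R)) (rs : seq (plane R)).

Lemma near_translate p z (P : plane R -> Prop) : (\forall w \near z, P w) ->
  \forall q \near p + z, P (q - p).
Proof.
move=> /near_boxP[e e0 h]; apply/near_boxP; exists e => // q [h1 h2]; apply: h.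
by split; [move: h1|move: h2]; rewrite /= opprD addrA.
Qed.

(** Near p the set C is the union of finitely many segments from p, with directions
    rs.  Near each of its points, the carrier of a diagram has this form. *)
Definition star C p rs : Prop :=
  [/\ forall u, u \in rs -> u != 0,
      forall u v, u \in rs -> v \in rs -> on_ray u v -> u = v &
      \forall q \near p, C q <-> (q = p \/ exists2 u, u \in rs & on_ray u (q - p))].

Definition adjacent_rays rs u v : Prop :=
  [/\ u \in rs, v \in rs, u != v & forall w, w \in rs -> ~~ ccw u w v].

(** A coloring is seen as a function on the plane with the value [None] on the
    carrier, and which is locally constant elsewhere.  In contrast to maps from
    the set of regions, such functions can be restricted to a disk, glued, and
    carried along by a homeomorphism. *)
Definition colored_off X C (F : plane R -> option X) q : Prop :=
  (F q = None <-> C q) /\ (~ C q -> \forall q' \near q, F q' = F q).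

Lemma norm_mix_lt (e a b s : R) : `|a| < e -> `|b| < e -> 0 <= s <= 1 ->
  `|a + s * (b - a)| < e.
Proof.
move=> ae be /andP[s0 s1].
have -> : a + s * (b - a) = (1 - s) * a + s * b by ring.
have [->|sn] := eqVneq s 0; first by rewrite subr0 mul1r mul0r addr0.
apply: le_lt_trans (ler_normD _ _) _.
rewrite !normrM (ger0_norm s0) (@ger0_norm _ (1 - s)) ?subr_ge0 //.
have -> : e = (1 - s) * e + s * e by ring.
rewrite ler_ltD ?ler_wpM2l ?subr_ge0 ?(ltW ae) //.
by rewrite ltr_pM2l // lt_neqAle eq_sym sn.
Qed.

(** A sector between two adjacent rays does not meet C, and it is star-shaped: F is
    constant along the segment from any point to a fixed center. *)
Lemma sector_color X C (F : plane R -> option X) p rs u v :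
  star C p rs -> (\forall q \near p, colored_off C F q) -> adjacent_rays rs u v ->
  exists x, \forall q \near p, ccw u (q - p) v -> F q = Some x.
Proof.
move=> [rs0 rs1 st] cF [urs vrs uv nb].
have u0 := rs0 u urs; have v0 := rs0 v vrs.
have nuv : ~~ on_ray u v by apply: contra uv => h; apply/eqP; exact: rs1.
have [e e0 he] := (near_boxP p _).1 (filterI st cF).
have offC q : box p e q -> ccw u (q - p) v -> ~ C q.
  move=> bq cq /(he q bq).1[qp|[w wrs wq]].
    by move: cq; rewrite qp subrr ccw0.
  by move: (nb w wrs); rewrite -(ccw_ray _ _ wq) cq.
have [c hc] := sector_center u0 v0 nuv.
pose m := `|c.1| + `|c.2| + 1.
have m0 : 0 < m by rewrite ltr_wpDl // addr_ge0.
pose k := e / m.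
have k0 : 0 < k by rewrite divr_gt0.
have [cc cs] := hc k k0.
pose q0 := p + (k * c.1, k * c.2).
have kc x : `|x| < m -> `|k * x| < e.
  move=> xm; rewrite /k mulrAC -mulrA normrM (gtr0_norm e0) gtr_pMr //.
  by rewrite normrM [X in _ * X]ger0_norm ?invr_ge0 ?(ltW m0) // ltr_pdivrMr // mul1r.
have b0 : box p e q0.
  split; rewrite /q0 /= addrAC subrr add0r kc // /m.
    by rewrite -addrA ltrDl ltr_wpDl.
  by rewrite addrAC ltrDr ltr_wpDl.
have c0 : ccw u (q0 - p) v by rewrite /q0 addrAC subrr add0r.
have : F q0 <> None by move/(he q0 b0).2.1; exact: offC.
case E0 : (F q0) => [x|//] _; exists x.
apply/near_boxP; exists e => // q bq cq; rewrite -E0.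
pose g (t : R) : plane R := (q.1 + t * (q0.1 - q.1), q.2 + t * (q0.2 - q.2)).
have gE t : g t - p = ((q - p).1 + t * (k * c.1 - (q - p).1),
                       (q - p).2 + t * (k * c.2 - (q - p).2)).
  by rewrite /g /q0 /=; congr (_, _) => /=; ring.
have cg t : 0 <= t <= 1 -> ccw u (g t - p) v by move=> t01; rewrite gE; exact: cs.
have bg t : 0 <= t <= 1 -> box p e (g t).
  case: bq b0 => [q1 q2] [q01 q02] t01; split.
    have -> : (g t).1 - p.1 = (q.1 - p.1) + t * ((q0.1 - p.1) - (q.1 - p.1)) by rewrite /g /=; ring.
    exact: norm_mix_lt.
  have -> : (g t).2 - p.2 = (q.2 - p.2) + t * ((q0.2 - p.2) - (q.2 - p.2)) by rewrite /g /=; ring.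
  exact: norm_mix_lt.
have cg' : continuous g.
  move=> t; have lin (a b : R) : (fun s => a + s * b) @ t --> a + t * b.
    apply: cvgD; first exact: cvg_cst.
    by apply: cvgM; [exact: cvg_id|exact: cvg_cst].
  exact: (cvg_pair (lin _ _) (lin _ _)).
have g0 : g 0 = q by rewrite /g !mul0r !addr0 -surjective_pairing.
have g1 : g 1 = q0 by rewrite /g !mul1r [q.1 + _]addrC [q.2 + _]addrC !subrK -surjective_pairing.
apply/esym; rewrite -g1; apply: (@locally_constant_itv R (fun t => F (g t) = F q) 0 1) => //.
  move=> t t01; have [] := (he (g t) (bg t t01)).2.
  move=> _ /(_ (offC _ (bg t t01) (cg t t01))) lc.
  have lc' : \forall s \near t, F (g s) = F (g t) := cg' t _ lc.
  by apply: filterS lc' => s -> _.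
by rewrite g0.
Qed.

Definition ray_point p u (t : R) : plane R := p + (t * u.1, t * u.2).

Lemma ray_pointK p u t : ray_point p u t - p = (t * u.1, t * u.2).
Proof. by rewrite /ray_point addrAC subrr add0r. Qed.

Lemma near_ray_point p u (P : plane R -> Prop) : (\forall q \near p, P q) ->
  exists2 e : R, 0 < e & forall t, `|t| < e -> P (ray_point p u t).
Proof.
move=> /near_boxP[e e0 he].
pose m := `|u.1| + `|u.2| + 1.
have m0 : 0 < m by rewrite ltr_wpDl // addr_ge0.
exists (e / m); first by rewrite divr_gt0.
move=> t te; apply: he.
have kc x : `|x| < m -> `|t * x| < e.
  move=> xm; rewrite normrM; have [->|t0] := eqVneq t 0; first by rewrite normr0 mul0r.
  rewrite (lt_trans (y := `|t| * m)) //; first by rewrite ltr_pM2l ?normr_gt0.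
  by rewrite -ltr_pdivlMr.
split; rewrite /ray_point /= addrAC subrr add0r kc // /m.
  by rewrite -addrA ltrDl ltr_wpDl.
by rewrite addrAC ltrDr ltr_wpDl.
Qed.

Lemma continuous_ray_point p u : continuous (ray_point p u).
Proof.
move=> t; apply: cvgD; first exact: cvg_cst.
have lin (a : R) : (fun s => s * a) @ t --> t * a.
  by apply: cvgM; [exact: cvg_id|exact: cvg_cst].
exact: (cvg_pair (lin _) (lin _)).
Qed.

Definition follows (h : plane R -> plane R) p u u' :=
  exists2 e : R, 0 < e & forall t, 0 < t < e -> on_ray u' (h (ray_point p u t) - h p).

Lemma near_all_in (T : Type) (I : eqType) (s : seq I) (G : set_system T) (Q : I -> T -> Prop) :
  Filter G -> (forall i, i \in s -> \forall x \near G, Q i x) ->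
  \forall x \near G, forall i, i \in s -> Q i x.
Proof.
move=> FG; elim: s => [|i s IH] Qs; first by near=> x.
have h1 : \forall x \near G, Q i x by apply: Qs; rewrite inE eqxx.
have h2 : \forall x \near G, forall i, i \in s -> Q i x.
  by apply: IH => j js; apply: Qs; rewrite inE js orbT.
apply: filterS (filterI h1 h2) => x [q1 q2] j; rewrite inE => /orP[/eqP->//|]; exact: q2.
Unshelve. all: by end_near.
Qed.

(** The image under h of a short piece of ray lies in the star at h p, off its
    center.  As the rays of a star are separated from each other, the ray on
    which the image point lies cannot change. *)
Lemma follows_exists (h g : plane R -> plane R) C C' p rs rs' u :
  continuous h -> cancel h g -> star C p rs -> star C' (h p) rs' ->
  (\forall q \near p, C q <-> C' (h q)) -> u \in rs ->
  exists2 u', u' \in rs' & follows h p u u'.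
Proof.
move=> hc hK [rs0 _ st] [rs0' rs1' st'] CC urs.
have u0 := rs0 u urs.
have [e e0 he] := near_ray_point u (filterI (filterI st CC) (hc p _ st')).
have some t : 0 < t < e -> exists2 w, w \in rs' & on_ray w (h (ray_point p u t) - h p).
  move=> /andP[t0 te].
  move: (he t); rewrite gtr0_norm // => /(_ te)[[/= s1 s2] s3].
  have Cq : C (ray_point p u t).
    by apply/s1; right; exists u => //; rewrite ray_pointK on_ray_scale.
  have /s3[/(can_inj hK) eq|//] := s2.1 Cq.
  have : on_ray u (ray_point p u t - p) by rewrite ray_pointK on_ray_scale.
  by rewrite eq subrr => /on_ray_neq0[_]; rewrite eqxx.
have e2 : 0 < e / 2 < e by rewrite divr_gt0 //= ltr_pdivrMr // ltr_pMr // ltr1n.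
have [u' u'rs' hu'] := some _ e2.
exists u' => //; exists e => // t te.
(* continuous induction between two parameters in either order *)
have P0 (P : R -> Prop) (a b : R) :
    (forall s, Num.min a b <= s <= Num.max a b ->
      \forall s' \near s, Num.min a b <= s' <= Num.max a b -> (P s' <-> P s)) ->
   P a -> P b.
  move=> loc Pa; have [ab|ba] := leP a b.
    by apply: (locally_constant_itv ab _ Pa) => s; move: (loc s); rewrite (min_l ab) (max_r ab).
  apply: contrapT => Pb.
  have := @locally_constant_itv R (fun s => ~ P s) b a (ltW ba) _ Pb; apply => // s sab.
  move: (loc s); rewrite (min_r (ltW ba)) (max_l (ltW ba)) => /(_ sab).
  by apply: filterS => s' h1 /h1 ->.
apply: (P0 (fun t => on_ray u' (h (ray_point p u t) - h p)) _ t _ hu') => s sab.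
have se r : Num.min (e / 2) t <= r <= Num.max (e / 2) t -> 0 < r < e.
  case/andP: te => t0 t1; case/andP: e2 => a0 a1 /andP[r1 r2].
  rewrite (lt_le_trans _ r1) ?lt_min ?a0 ?t0 //= (le_lt_trans r2) // gt_max a1 t1 //.
have sE := se s sab.
have z0 : h (ray_point p u s) - h p != 0.
  by have [w _ /on_ray_neq0[]] := some s sE.
have cz : (fun s => h (ray_point p u s) - h p) @ s --> h (ray_point p u s) - h p.
  apply: cvgB; last exact: cvg_cst.
  exact: (cvg_comp _ _ (@continuous_ray_point p u s) (hc _)).
have nr : \forall s' \near s, forall w, w \in rs' ->
    ~~ on_ray w (h (ray_point p u s) - h p) -> ~~ on_ray w (h (ray_point p u s') - h p).
  apply: (@near_all_in R (plane R) rs' (nbhs s) (fun w s' =>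
    ~~ on_ray w (h (ray_point p u s) - h p) -> ~~ on_ray w (h (ray_point p u s') - h p))) => w wrs.
  have [on|/negP off] := pselect (is_true (on_ray w (h (ray_point p u s) - h p))).
    by apply: filterE => s'; rewrite on.
  have n1 : \forall s' \near s, ~~ on_ray w (h (ray_point p u s') - h p).
    exact: (cz _ (near_off_ray z0 off)).
  by apply: filterS n1 => s' h1 _.
apply: filterS nr => s' nr s'ab.
have [w wrs' hw] := some s' (se s' s'ab).
split=> [Ps|Ps].
  by apply: contraT => n; move: (nr u' u'rs' n); rewrite Ps.
have /negP/negPn hws : ~ ~~ on_ray w (h (ray_point p u s) - h p).
  by move=> n; move: (nr w wrs' n); rewrite hw.
have /rs1' -> // : on_ray u' w.
by apply: on_ray_trans Ps (on_ray_sym hws).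
Unshelve. all: by end_near.
Qed.

(** Near h p all the points of the ray u' come from the ray u, as the inverse of h
    sends a short piece of u' into u. *)
Lemma follows_pullback (h g : plane R -> plane R) p u u' :
  continuous h -> cancel h g -> follows g (h p) u' u ->
  \forall q \near p, on_ray u' (h q - h p) -> on_ray u (q - p).
Proof.
move=> hc hK [e2 e20 f2].
have [->|u'0] := eqVneq u' 0.
  by apply: filterE => q /on_ray_neq0[]; rewrite eqxx.
have uu' := dot_gt0 u'0.
have small : \forall q \near p, dot u' (h q - h p) < e2 * dot u' u'.
  have c : (fun q => dot u' (h q - h p)) @ p --> dot u' (h p - h p).
    have c1 : (fun q => h q - h p) @ p --> h p - h p.
      by apply: cvgB; [exact: hc|exact: cvg_cst].
    apply: cvgD; apply: cvgM; try exact: cvg_cst.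
      exact: (cvg_comp _ _ c1 cvg_fst).
    exact: (cvg_comp _ _ c1 cvg_snd).
  apply: (c _ (lt_nbhsl _)).
  by rewrite subrr {1}/dot !mulr0 addr0 mulr_gt0.
apply: filterS small => q sq onq.
have [s s0 es] := on_ray_pos onq.
have se : s < e2.
  move: sq; rewrite es.
  have -> : dot u' (s * u'.1, s * u'.2) = s * dot u' u' by rewrite /dot /=; ring.
  by rewrite ltr_pM2r.
have := f2 s; rewrite s0 se => /(_ isT).
have -> : ray_point (h p) u' s = h q by rewrite /ray_point -es addrC subrK.
by rewrite !hK.
Qed.

(** [isotopy_turn] applied to the square around p with the point at distance d along
    the ray u: any property which holds near this point holds at two points on
    either side of u whose images are on the same sides of u'. *)
Lemma ray_turn (h g : plane R -> plane R) p u u' :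
  isotopic_to_id h -> continuous h -> cancel h g -> u != 0 -> u' != 0 ->
  follows h p u u' -> follows g (h p) u' u ->
  exists2 e : R, 0 < e & forall d, 0 < d < e ->
    on_ray u' (h (ray_point p u d) - h p) /\
    forall P : plane R -> Prop, (\forall q \near ray_point p u d, P q) ->
    exists ql qr, [/\ P ql, P qr,
      0 < det2 u (ql - p) /\ 0 < det2 u' (h ql - h p) &
      det2 u (qr - p) < 0 /\ det2 u' (h qr - h p) < 0].
Proof.
move=> iso hc hK u0 u'0 [e1 e10 f1] f2.
have uu := dot_gt0 u0; have uu' := dot_gt0 u'0.
have [e3 e30 h3] := (near_boxP p _).1 (follows_pullback hc hK f2).
pose m := `|u.1| + `|u.2| + 1.
have m0 : 0 < m by rewrite ltr_wpDl // addr_ge0.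
have um : `|u.1| + `|u.2| < m by rewrite /m ltrDl.
exists (Num.min e1 (e3 / m)); first by rewrite lt_min e10 divr_gt0.
move=> d /andP[d0]; rewrite lt_min => /andP[d1 d3].
have on_d : on_ray u' (h (ray_point p u d) - h p) by apply: f1; rewrite d0 d1.
split => // P /near_boxP[e4 e40 h4].
pose ud : plane R := (d * u.1, d * u.2).
have ud0 : ud != 0 by case/on_ray_neq0: (on_ray_scale u0 d0).
have [/eqP on1 on2] := andP on_d.
have off c : `|c.1| <= 1 -> `|c.2| <= 1 ->
     det2 u' (h (p + spin ud c) - h p) = 0 -> 0 < dot u' (h (p + spin ud c) - h p) ->
     c.2 = 0 /\ 0 < c.1.
  move=> c1 c2 z1 z2.
  have near_p : box p e3 (p + spin ud c).
    have bnd a b : `|c.1 * (d * a)| <= d * `|a| /\ `|c.2 * (d * b)| <= d * `|b|.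
      by rewrite !normrM (gtr0_norm d0); split; rewrite ler_piMl // mulr_ge0 // ltW.
    have dm : d * (`|u.1| + `|u.2|) < e3.
      by rewrite (lt_trans (y := d * m)) ?ltr_pM2l // -ltr_pdivlMr.
    split; rewrite /spin /= addrAC subrr add0r (le_lt_trans _ dm) // mulrDr.
      by rewrite (le_trans (ler_normB _ _)) // lerD //; [exact: (bnd _ 0).1|exact: (bnd 0 _).2].
    rewrite (le_trans (ler_normD _ _)) // addrC lerD //; [exact: (bnd 0 _).2|exact: (bnd _ 0).1].
  have on_z : on_ray u' (h (p + spin ud c) - h p) by rewrite /on_ray z1 eqxx.
  have := h3 _ near_p on_z; rewrite addrAC subrr add0r => /andP[/eqP].
  rewrite det2_spin.
  have -> : det2 u ud = 0 by rewrite /det2 /=; ring.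
  have -> : dot u ud = d * dot u u by rewrite /dot /=; ring.
  rewrite mulr0 add0r => /eqP; rewrite !mulf_eq0 (gt_eqF d0) (gt_eqF uu) !orbF => /eqP c20.
  rewrite /spin c20 !mul0r subr0 addr0.
  have -> : dot u (c.1 * ud.1, c.1 * ud.2) = c.1 * (d * dot u u) by rewrite /dot /=; ring.
  by rewrite pmulr_lgt0 ?mulr_gt0.
have dm0 : 0 < d * m by rewrite mulr_gt0.
have e5 : 0 < e4 / (d * m) by rewrite divr_gt0.
have [s [s0 se t1 t2]] := isotopy_turn iso ud0 on1 on2 off e5.
have Pn (s' : R) : `|s'| = s -> P (p + spin ud (1, s')).
  move=> s's; apply: h4.
  have bnd a : `|a| <= `|u.1| + `|u.2| -> `|s' * (d * a)| < e4.
    move=> am; rewrite !normrM s's (gtr0_norm d0).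
    rewrite (le_lt_trans (y := s * (d * m))) //; last by rewrite -ltr_pdivlMr.
    by rewrite !ler_wpM2l ?(ltW s0) ?(ltW d0) // (le_trans am) // ltW.
  split; rewrite /spin /ray_point /= !mul1r.
    have -> : p.1 + (d * u.1 - s' * (d * u.2)) - (p.1 + d * u.1) = - (s' * (d * u.2)) by ring.
    by rewrite normrN bnd // lerDr.
  have -> : p.2 + (d * u.2 + s' * (d * u.1)) - (p.2 + d * u.2) = s' * (d * u.1) by ring.
  by rewrite bnd // lerDl.
have dE (s' : R) : det2 u (p + spin ud (1, s') - p) = s' * (d * dot u u).
  rewrite addrAC subrr add0r det2_spin /=.
  have -> : det2 u ud = 0 by rewrite /det2 /=; ring.
  have -> : dot u ud = d * dot u u by rewrite /dot /=; ring.
  by rewrite mulr0 add0r.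
exists (p + spin ud (1, s)), (p + spin ud (1, - s)); split.
- by apply: Pn; rewrite gtr0_norm.
- by apply: Pn; rewrite normrN gtr0_norm.
- by rewrite dE !mulr_gt0.
- by rewrite dE mulNr oppr_lt0 !mulr_gt0.
Qed.

Lemma near_near p (P : plane R -> Prop) : (\forall q \near p, P q) ->
  \forall q \near p, \forall q' \near q, P q'.
Proof. exact: nbhs_interior. Qed.

Section Matching.
Variables (h g : plane R -> plane R) (C C' : set (plane R)) (p : plane R).
Variables (rs rs' : seq (plane R)).
Hypotheses (iso : isotopic_to_id h) (hc : continuous h) (gc : continuous g).
Hypotheses (hK : cancel h g) (gK : cancel g h).
Hypotheses (st : star C p rs) (st' : star C' (h p) rs').
Hypothesis CC : \forall q \near p, C q <-> C' (h q).

Lemma near_pullback (P : plane R -> Prop) : (\forall q \near p, P q) ->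
  \forall q \near h p, P (g q).
Proof. by move=> nP; apply: (gc (x := h p)); rewrite /= hK. Qed.

Lemma star_inv : \forall q \near h p, C' q <-> C (g q).
Proof. by apply: filterS (near_pullback CC) => q ->; rewrite gK. Qed.

(** Both directions are required so that the relation is symmetric in h and g and
    defines a bijection between the rays of the two stars. *)
Definition matched u u' := follows h p u u' /\ follows g (h p) u' u.

Lemma follows_inj u v u' : u \in rs -> v \in rs ->
  follows h p u u' -> follows g (h p) u' v -> u = v.
Proof.
case: st => rs0 rs1 _ urs vrs [e e0 f1] f2.
have [e1 e10 f3] := near_ray_point u (follows_pullback hc hK f2).
pose t := Num.min e e1 / 2.
have m0 : 0 < Num.min e e1 by rewrite lt_min e0 e10.
have t0 : 0 < t by rewrite divr_gt0.
have tm : t < Num.min e e1 by rewrite /t ltr_pdivrMr // ltr_pMr // ltr1n.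
move: tm; rewrite lt_min => /andP[te te1].
have := f3 t; rewrite gtr0_norm // => /(_ te1).
rewrite f1 ?t0 ?te // => /(_ isT); rewrite ray_pointK => on.
apply: rs1 => //; apply: on_ray_trans (on_ray_sym on).
by apply: on_ray_scale => //; apply: rs0.
Qed.

Lemma matched_exists u : u \in rs -> exists2 u', u' \in rs' & matched u u'.
Proof.
move=> urs; have [u' u'rs' f1] := follows_exists hc hK st st' CC urs.
have st2 : star C (g (h p)) rs by rewrite hK.
have [v vrs f2] := follows_exists gc gK st' st2 star_inv u'rs'.
exists u' => //; split=> //.
by rewrite [X in follows _ _ _ X](follows_inj urs vrs f1 f2).
Qed.

Lemma matched_fun u u' v' : u' \in rs' -> v' \in rs' ->
  matched u u' -> matched u v' -> u' = v'.
Proof.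
case: st' => _ rs1 _ u'rs v'rs [[e e0 f1] _] [[e1 e10 f2] _].
pose t := Num.min e e1 / 2.
have m0 : 0 < Num.min e e1 by rewrite lt_min e0 e10.
have t0 : 0 < t by rewrite divr_gt0.
have tm : t < Num.min e e1 by rewrite /t ltr_pdivrMr // ltr_pMr // ltr1n.
move: tm; rewrite lt_min => /andP[te te1].
apply: rs1 => //; apply: on_ray_trans (f1 t _) (on_ray_sym (f2 t _)); exact/andP.
Qed.

Lemma matched_inj u v u' : u \in rs -> v \in rs ->
  matched u u' -> matched v u' -> u = v.
Proof. by move=> urs vrs [f1 _] [_ f2]; exact: follows_inj f1 f2. Qed.

Lemma near_sector_off u v : adjacent_rays rs u v ->
  \forall q \near p, ccw u (q - p) v -> ~ C q.
Proof.
case: st => rs0 rs1 stp [urs vrs uv nb]; apply: filterS stp => q sq cq /sq[qp|[w wrs wq]].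
  by move: cq; rewrite qp subrr ccw0.
by move: (nb w wrs); rewrite -(ccw_ray _ _ wq) cq.
Qed.

(** The form in which [ray_turn] is applied: P is a property of all points near p,
    and Q one of the points near the ray u, which may depend on the position of
    the image on the ray u'. *)
Lemma near_side u u' (P : plane R -> Prop) (Q : plane R -> Prop) :
  u != 0 -> u' != 0 -> matched u u' ->
  (\forall q \near p, P q) ->
  (forall z z', on_ray u z -> on_ray u' z' ->
     \forall q \near p + z, h (p + z) - h p = z' -> Q q) ->
  exists ql qr, [/\ P ql /\ Q ql, P qr /\ Q qr,
      0 < det2 u (ql - p) /\ 0 < det2 u' (h ql - h p) &
      det2 u (qr - p) < 0 /\ det2 u' (h qr - h p) < 0].
Proof.
move=> u0 u'0 [f1 f2] nP nQ.
have [e e0 he] := ray_turn iso hc hK u0 u'0 f1 f2.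
have [e1 e10 h1] := near_ray_point u (near_near nP).
pose t := Num.min e e1 / 2.
have m0 : 0 < Num.min e e1 by rewrite lt_min e0 e10.
have t0 : 0 < t by rewrite divr_gt0.
have tm : t < Num.min e e1 by rewrite /t ltr_pdivrMr // ltr_pMr // ltr1n.
move: tm; rewrite lt_min => /andP[te te1].
have [on turn] := he t (introT andP (conj t0 te)).
have nP' := h1 t; rewrite gtr0_norm // in nP'.
have nQ' := nQ _ _ (on_ray_scale u0 t0) on.
have [ql [qr [[l1 l2] [r1 r2] l r]]] := turn _ (filterI (nP' te1) nQ').
by exists ql, qr; split => //; split => //; [exact: l2|exact: r2].
Qed.

(** The color on the left of a ray is carried to the left of the image ray: evaluate
    both germs at a point just on the left of u whose image is just on the left
    of u'. *)
Lemma left_color (X : Type) (F F' : plane R -> option X) u u' v v' x x' :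
  adjacent_rays rs u v -> adjacent_rays rs' u' v' -> matched u u' ->
  (\forall q \near p, F' (h q) = F q) ->
  (\forall q \near p, ccw u (q - p) v -> F q = Some x) ->
  (\forall q \near h p, ccw u' (q - h p) v' -> F' q = Some x') -> x = x'.
Proof.
move=> [urs vrs uv _] [urs' vrs' uv' _] m FF cx cx'.
case: st => rs0 rs1 _; case: st' => rs0' rs1' _.
have nuv : ~~ on_ray u v by apply: contra uv => /rs1->.
have nuv' : ~~ on_ray u' v' by apply: contra uv' => /rs1'->.
have nP : \forall q \near p, (F' (h q) = F q /\ (ccw u (q - p) v -> F q = Some x)) /\
    (ccw u' (h q - h p) v' -> F' (h q) = Some x').
  exact: filterI (filterI FF cx) (hc cx').
pose Q q := (0 < det2 u (q - p) -> ccw u (q - p) v) /\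
            (0 < det2 u' (h q - h p) -> ccw u' (h q - h p) v').
have nQ z z' : on_ray u z -> on_ray u' z' ->
    \forall q \near p + z, h (p + z) - h p = z' -> Q q.
  move=> uz uz'; have [e|ne] := pselect (h (p + z) - h p = z'); last first.
    by apply: filterE => q /ne.
  have n1 := near_translate p (near_ccw_left (rs0 v vrs) nuv uz).
  have n2 := near_translate (h p) (near_ccw_left (rs0' v' vrs') nuv' uz').
  rewrite -e addrC subrK in n2.
  by apply: filterS (filterI n1 (hc n2)) => q [q1 q2] _.
have [ql [_ [[[[e1 e2] e3] [q1 q2]] _ [l1 l2] _]]] :=
  near_side (rs0 u urs) (rs0' u' urs') m nP nQ.
have := e3 (q2 l2); rewrite e1 (e2 (q1 l1)) => -[].
by [].
Qed.

(** The cyclic order of the rays is preserved.  The function F colors the sector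
    from u to v by [true] and the rest of the complement of C by [false]; by
    [left_color] its transport F' is [true] on the sector from u' to z'.  If z
    were not v then F would be [false] on the right of z, whereas F' is [true] on
    the right of z'. *)
Lemma adjacent_matched u v z u' z' : adjacent_rays rs u v -> z \in rs ->
  adjacent_rays rs' u' z' -> matched u u' -> matched z z' -> z = v.
Proof.
move=> uva zrs uza mu mz; have [urs vrs uv nb] := uva; have [urs' zrs' uz' _] := uza.
case: (st) => rs0 rs1 stp; case: (st') => rs0' rs1' _.
have nuv : ~~ on_ray u v by apply: contra uv => /rs1->.
have nuz' : ~~ on_ray z' u' by apply: contra uz' => /rs1'->.
apply/eqP/negPn/negP => zv.
pose F q := if `[< C q >] then None else Some (ccw u (q - p) v).
pose F' q := F (g q).
have cF : \forall q \near p, colored_off C F q.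
  apply: filterS (near_near stp) => q nq; split.
    by rewrite /F; case: asboolP.
  move=> nC; have sq := nbhs_singleton nq.
  have z0 : q - p != 0 by rewrite subr_eq0; apply/eqP => qp; apply/nC/sq; left.
  have off w : w \in rs -> ~~ on_ray w (q - p).
    by move=> wrs; apply/negP => wq; apply/nC/sq; right; exists w.
  have n1 : \forall q' \near q, forall w, w \in rs -> ~~ on_ray w (q' - p).
    apply: (@near_all_in (plane R) (plane R) rs (nbhs q) (fun w q' => ~~ on_ray w (q' - p))) => w wrs.
    have := near_translate p (near_off_ray z0 (off w wrs)).
    by rewrite addrC subrK.
  have n2 : \forall q' \near q, q' != p.
    have := near_translate p (near_dot_gt0 (dot_gt0 z0)).
    rewrite addrC subrK; apply: filterS => q'; apply: contraTneq => ->.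
    by rewrite subrr /dot !mulr0 addr0 ltxx.
  have n3 : \forall q' \near q, ccw u (q' - p) v = ccw u (q - p) v.
    have [c|c] := boolP (ccw u (q - p) v).
      by have := near_translate p (near_ccw c); rewrite addrC subrK.
    have nvz : ~~ on_ray (q - p) v by apply: contra (off v vrs) => /on_ray_sym.
    have nvu : ~~ on_ray v u by apply: contra nuv => /on_ray_sym.
    have := ccw_total (rs0 u urs) z0 (rs0 v vrs) (off u urs) nvz nvu.
    rewrite (negbTE c) /= ccw_rot => c'.
    have := near_translate p (near_ccw c'); rewrite addrC subrK.
    by apply: filterS => q'; rewrite -ccw_rot => /ccw_asym.
  apply: filterS (filterI (filterI nq n1) (filterI n2 n3)) => q' [[sq' k1] [k2 k3]].
  rewrite /F k3 (asboolF nC) asboolF // => /sq'[/eqP|[w wrs wq]].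
    by rewrite (negbTE k2).
  by move: (k1 w wrs); rewrite wq.
have FF : \forall q \near p, F' (h q) = F q by apply: filterE => q; rewrite /F' hK.
have cF' : \forall q \near h p, colored_off C' F' q.
  apply: filterS (filterI (near_pullback cF) star_inv) => q [[f1 f2] cc]; split.
    by rewrite /F' f1 cc.
  by rewrite cc => /f2 f3; exact: (gc f3).
have cT : \forall q \near p, ccw u (q - p) v -> F q = Some true.
  by apply: filterS (near_sector_off uva) => q nC c; rewrite /F c asboolF //; exact: nC.
have [x cx] := sector_color st' cF' uza.
have := left_color uva uza mu FF cT cx; move=> xT; rewrite -xT in cx.
pose Q q := (det2 z' (h q - h p) < 0 -> ccw u' (h q - h p) z') /\
            (det2 z (q - p) < 0 -> ccw v (q - p) u).
have nQ y y' : on_ray z y -> on_ray z' y' ->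
    \forall q \near p + y, h (p + y) - h p = y' -> Q q.
  move=> zy zy'; have [e|ne] := pselect (h (p + y) - h p = y'); last first.
    by apply: filterE => q /ne.
  have n1 : \forall w \near y, det2 z w < 0 -> ccw v w u.
    have [zu|zu] := eqVneq z u.
      by rewrite zu in zy *; apply: near_ccw_right => //; apply: rs0.
    have nzu : ~~ on_ray u z by apply: contra zu => /rs1->.
    have nzv : ~~ on_ray z v by apply: contra zv => /rs1->.
    have nvu : ~~ on_ray v u by apply: contra nuv => /on_ray_sym.
    have := ccw_total (rs0 u urs) (rs0 z zrs) (rs0 v vrs) nzu nzv nvu.
    rewrite (negbTE (nb z zrs)) /= ccw_rot -(ccw_ray _ _ zy) => c.
    by apply: filterS (near_ccw c) => w.
  have n2 := near_translate (h p) (near_ccw_right (rs0' u' urs') nuz' zy').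
  rewrite -e addrC subrK in n2.
  by apply: filterS (filterI (near_translate p n1) (hc n2)) => q [q1 q2] _.
have nP : \forall q \near p, F' (h q) = F q /\
    (ccw u' (h q - h p) z' -> F' (h q) = Some true).
  exact: filterI FF (hc cx).
have [_ [qr [_ [[P1 P2] [Q1 Q2]] _ [r1 r2]]]] :=
  near_side (rs0 z zrs) (rs0' z' zrs') mz nP nQ.
have := P2 (Q1 r2); rewrite P1 /F; case: asboolP => // _ [] ct.
by have := Q2 r1; rewrite ccw_rot ccw_rot => /ccw_asym; rewrite ct.
Qed.

End Matching.

End Stars.

(** * Diagrams near a point *)

Section Segments.
Variable R : realType.
Implicit Types (u v w z p q : plane R) (e f : segment R).

Lemma paramE e t : param e t - e.1 = (t * (dir e).1, t * (dir e).2).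
Proof. by rewrite /param /shift /=; congr (_, _); rewrite /=; ring. Qed.

Lemma dir_neq0 e : e.1 != e.2 -> dir e != 0.
Proof. by rewrite /dir subr_eq0 eq_sym. Qed.

Lemma param0 e : param e 0 = e.1.
Proof. by rewrite /param /shift [RHS]surjective_pairing; congr (_, _); ring. Qed.

Lemma param1 e : param e 1 = e.2.
Proof. by rewrite /param /shift /dir [RHS]surjective_pairing; congr (_, _) => /=; ring. Qed.

Lemma param_sub e s t : param e t - param e s = ((t - s) * (dir e).1, (t - s) * (dir e).2).
Proof. by rewrite /param /shift; congr (_, _); rewrite /=; ring. Qed.

Lemma param_inj e s t : e.1 != e.2 -> param e s = param e t -> s = t.
Proof.
move=> /dir_neq0 /dot_gt0 d0 /eqP; rewrite eq_sym -subr_eq0 param_sub => /eqP [h1 h2].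
have : (t - s) * dot (dir e) (dir e) = 0.
  by rewrite /dot mulrDr !mulrA h1 h2 !mul0r addr0.
by move/eqP; rewrite mulf_eq0 (gt_eqF d0) orbF subr_eq0 => /eqP.
Qed.

Lemma on_segmentP e q : e.1 != e.2 -> on_segment e q <->
  [/\ det2 (dir e) (q - e.1) = 0, 0 <= dot (dir e) (q - e.1) &
      dot (dir e) (q - e.1) <= dot (dir e) (dir e)].
Proof.
move=> ne; have d0 := dot_gt0 (dir_neq0 ne).
have dE t : dot (dir e) (t * (dir e).1, t * (dir e).2) = t * dot (dir e) (dir e).
  by rewrite /dot /=; ring.
split=> [[t [/andP[t0 t1] ->]]|[h1 h2 h3]].
  rewrite paramE dE mulr_ge0 ?(ltW d0) // ler_piMl ?(ltW d0) //.
  by split => //; rewrite /det2 /=; ring.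
exists (dot (dir e) (q - e.1) / dot (dir e) (dir e)); split.
  by rewrite divr_ge0 ?(ltW d0) //= ler_pdivrMr // mul1r.
have [qe|qe] := eqVneq q e.1.
  by rewrite qe subrr /dot !mulr0 addr0 mul0r param0.
have z : on_ray (dir e) (q - e.1).
  rewrite /on_ray h1 eqxx lt_neqAle h2 andbT eq_sym; apply/eqP => z.
  have nr : ~~ on_ray (dir e) (q - e.1) by rewrite /on_ray z ltxx andbF.
  have := det2_eq0_ray (dir_neq0 ne) _ h1 nr; rewrite subr_eq0 => /(_ qe) /andP[_].
  by rewrite /dot /= !mulrN -opprD -[_ + _]/(dot (dir e) (q - e.1)) z oppr0 ltxx.
have [t t0 et] := on_ray_pos z.
rewrite et dE mulfK ?gt_eqF //; apply/eqP; rewrite -subr_eq0; apply/eqP.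
have -> : q - param e t = (q - e.1) - (param e t - e.1) by rewrite opprB addrA subrK.
by rewrite et paramE subrr.
Qed.

Definition ebefore e p q : Prop := exists s t : R,
  [/\ 0 <= s, s < t, t <= 1 & p = param e s /\ q = param e t].

Lemma beforeP D p q : before D p q <-> exists2 e, e \in segs D & ebefore e p q.
Proof.
split=> [[e [s [t [eD s0 st t1 pq]]]]|[e eD [s [t [s0 st t1 pq]]]]].
  by exists e => //; exists s, t.
by exists e, s, t.
Qed.

Lemma on_segment_before e p q : on_segment e p ->
  on_segment e q <-> [\/ q = p, ebefore e p q | ebefore e q p].
Proof.
move=> [s [/andP[s0 s1] ps]]; split=> [[t [/andP[t0 t1] qt]]|].
  have [st|ts|e1] := ltgtP s t.
  - by constructor 2; exists s, t.
  - by constructor 3; exists t, s.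
  - by constructor 1; rewrite ps qt e1.
case=> [->|[a [b [a0 ab b1 [_ ->]]]]|[a [b [a0 ab b1 [-> _]]]]].
- by exists s; rewrite s0 s1.
- by exists b; rewrite b1 (le_trans a0 (ltW ab)).
- by exists a; rewrite a0 (le_trans (ltW ab) b1).
Qed.

Lemma near_dot_lt u p (r : R) : 0 < r -> \forall q \near p, dot u (q - p) < r.
Proof.
move=> r0; have c : (fun q => dot u (q - p)) @ p --> dot u (p - p).
  have c1 : (fun q => q - p) @ p --> p - p by apply: cvgB; [exact: cvg_id|exact: cvg_cst].
  apply: cvgD; apply: cvgM; try exact: cvg_cst.
    exact: (cvg_comp _ _ c1 cvg_fst).
  exact: (cvg_comp _ _ c1 cvg_snd).
apply: (c _ (lt_nbhsl _)).
by rewrite subrr {1}/dot !mulr0 addr0.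
Qed.

Lemma near_ebefore e p : e.1 != e.2 -> on_segment e p ->
  \forall q \near p, (ebefore e p q <-> p != e.2 /\ on_ray (dir e) (q - p)) /\
                     (ebefore e q p <-> p != e.1 /\ on_ray (- dir e) (q - p)).
Proof.
move=> ne [s [/andP[s0 s1] ps]].
have d0 := dir_neq0 ne; have dd := dot_gt0 d0.
have n1 : \forall q \near p, s < 1 -> dot (dir e) (q - p) < (1 - s) * dot (dir e) (dir e).
  have [s1'|] := pselect (s < 1); last by move=> ns; apply: filterE.
  have r0 : 0 < (1 - s) * dot (dir e) (dir e) by rewrite mulr_gt0 // subr_gt0.
  by apply: filterS (near_dot_lt (dir e) p r0) => q.
have n2 : \forall q \near p, 0 < s -> dot (- dir e) (q - p) < s * dot (dir e) (dir e).
  have [s0'|] := pselect (0 < s); last by move=> ns; apply: filterE.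
  have r0 : 0 < s * dot (dir e) (dir e) by rewrite mulr_gt0.
  by apply: filterS (near_dot_lt (- dir e) p r0) => q.
have dE t : dot (dir e) (t * (dir e).1, t * (dir e).2) = t * dot (dir e) (dir e).
  by rewrite /dot /=; ring.
apply: filterS (filterI n1 n2) => q [q1 q2]; split; split.
- move=> [a [b [a0 ab b1 [pa qb]]]].
  have sa : s = a by apply: (param_inj ne); rewrite -ps -pa.
  split.
    apply/eqP => pe2; have : a = 1 by apply: (param_inj ne); rewrite -pa param1.
    by move=> a1; move: ab; rewrite a1 ltNge b1.
  by rewrite pa qb param_sub on_ray_scale ?subr_gt0.
- move=> [pe2 on].
  have s1' : s < 1 by rewrite lt_neqAle s1 andbT; apply: contra_neq pe2 => s1'; rewrite ps s1' param1.
  have [t t0 qt] := on_ray_pos on.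
  exists s, (s + t); split => //; first by rewrite ltrDl.
    by move: (q1 s1'); rewrite qt dE ltr_pM2r // => /ltW; rewrite lerBrDl.
  split => //; apply/eqP; rewrite -subr_eq0; apply/eqP.
  have -> : q - param e (s + t) = (q - p) - (param e (s + t) - param e s).
    by rewrite -ps opprB addrA subrK.
  by rewrite qt param_sub addrAC subrr add0r subrr.
- move=> [a [b [a0 ab b1 [qa pb]]]].
  have sa : s = b by apply: (param_inj ne); rewrite -ps -pb.
  split.
    apply/eqP => pe2; have : b = 0 by apply: (param_inj ne); rewrite -pb param0.
    by move=> b0; move: ab; rewrite b0 ltNge a0.
  rewrite pb qa param_sub.
  have -> : ((a - b) * (dir e).1, (a - b) * (dir e).2) =
            ((b - a) * (- dir e).1, (b - a) * (- dir e).2) :> plane R.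
    by congr (_, _); rewrite /=; ring.
  by rewrite on_ray_scale ?subr_gt0 // oppr_eq0.
- move=> [pe1 on].
  have s0' : 0 < s by rewrite lt_neqAle s0 andbT eq_sym; apply: contra_neq pe1 => s1'; rewrite ps s1' param0.
  have [t t0 qt] := on_ray_pos on.
  exists (s - t), s; split => //; last 1 first.
  + split => //; apply/eqP; rewrite -subr_eq0; apply/eqP.
    have -> : q - param e (s - t) = (q - p) - (param e (s - t) - param e s).
      by rewrite -ps opprB addrA subrK.
    rewrite qt param_sub addrAC subrr add0r.
    by apply/eqP; rewrite subr_eq0; apply/eqP; congr (_, _); rewrite /=; ring.
  + move: (q2 s0'); rewrite qt.
    have -> : dot (- dir e) (t * (- dir e).1, t * (- dir e).2) = t * dot (dir e) (dir e).
      by rewrite /dot /=; ring.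
    by rewrite ltr_pM2r // => /ltW; rewrite subr_ge0.
  + by rewrite ltrBlDr ltrDl.
Qed.

Lemma near_off_segment e p : e.1 != e.2 -> ~ on_segment e p ->
  \forall q \near p, ~ on_segment e q.
Proof.
move=> ne off; set d := dir e.
have tr (P : plane R -> Prop) : (\forall w \near p - e.1, P w) -> \forall q \near p, P (q - e.1).
  by move/(near_translate e.1); rewrite addrC subrK.
have [h1|h1] := eqVneq (det2 d (p - e.1)) 0; last first.
  have [h|h] : 0 < det2 d (p - e.1) \/ 0 < det2 (- d) (p - e.1).
    by rewrite det2Nl oppr_gt0; apply/orP; rewrite orbC -neq_lt.
    by apply: filterS (tr _ (near_det2_gt0 h)) => q hq /on_segmentP[//|z _ _]; rewrite z ltxx in hq.
  apply: filterS (tr _ (near_det2_gt0 h)) => q; rewrite det2Nl => hq /on_segmentP[//|z _ _].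
  by rewrite z oppr0 ltxx in hq.
have [h2|h2] := ltP (dot d (p - e.1)) 0.
  have h : 0 < dot (- d) (p - e.1) by rewrite (_ : dot _ _ = - dot d (p - e.1)) ?oppr_gt0 // /dot /=; ring.
  apply: filterS (tr _ (near_dot_gt0 h)) => q.
  have -> : dot (- d) (q - e.1) = - dot d (q - e.1) by rewrite /dot /=; ring.
  by rewrite oppr_gt0 => hq /on_segmentP[//|_ z _]; rewrite ltNge z in hq.
have [h3|h3] := ltP (dot d d) (dot d (p - e.1)); last first.
  by case: off; apply/on_segmentP.
have h : 0 < dot d (p - e.1 - d).
  by rewrite (_ : dot _ _ = dot d (p - e.1) - dot d d) ?subr_gt0 // /dot /=; ring.
have := near_translate (e.1 + d) (near_dot_gt0 h).
have -> : e.1 + d + (p - e.1 - d) = p by rewrite -[p - e.1 - d]addrA -opprD [LHS]addrC subrK.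
apply: filterS => q; rewrite (_ : dot _ _ = dot d (q - e.1) - dot d d); last first.
  by rewrite /dot /=; ring.
by rewrite subr_gt0 => hq /on_segmentP[//|_ _ z]; rewrite ltNge z in hq.
Qed.

End Segments.

Section Prediagrams.
Variable R : realType.
Implicit Types (u v w z p q : plane R) (e f : segment R) (D : prediagram R).

Definition outdir e p := if e.1 == p then dir e else - dir e.

(** What the local analysis at p needs of a prediagram.  It holds at all points of
    diagrams, and also of the pictures of the moves, which are not diagrams
    because their arcs have free ends.  Two segments with a common endpoint leave
    it in different directions, and exactly three segments end at a vertex. *)
Definition tame D p : Prop :=
  [/\ (forall e, e \in segs D -> e.1 != e.2),
      (forall e f, e \in segs D -> f \in segs D -> e != f ->
        on_segment e p -> on_segment f p ->
        [/\ endpoint e p, endpoint f p & ~~ on_ray (outdir e p) (outdir f p)] \/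
        [/\ inner e p, inner f p & det2 (dir e) (dir f) != 0]),
      (forall e f g, e \in segs D -> f \in segs D -> g \in segs D ->
        uniq [:: e; f; g] -> ~ [/\ inner e p, inner f p & inner g p]),
      (forall e f, e \in segs D -> f \in segs D -> e != f ->
        inner e p -> inner f p -> over D e f (+) over D f e) &
      (vertex D p -> exists e0 e1 e2 : segment R, uniq [:: e0; e1; e2] /\
        forall e, (e \in segs D) && endpoint e p = (e \in [:: e0; e1; e2]))].

Lemma endpoint_on e p : endpoint e p -> on_segment e p.
Proof.
case/orP => /eqP->; first by exists 0; rewrite lexx ler01 param0.
by exists 1; rewrite lexx ler01 param1.
Qed.

Lemma inner_on e p : inner e p -> on_segment e p.
Proof. by move=> [t [/andP[t0 t1] ->]]; exists t; rewrite !ltW. Qed.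

Lemma inner_endpoint e p : e.1 != e.2 -> inner e p -> ~~ endpoint e p.
Proof.
move=> ne [t [/andP[t0 t1] ->]]; apply/negP => /orP[] /eqP.
  move=> h; have t00 : t = 0 by apply: (param_inj ne); rewrite param0.
  by rewrite t00 ltxx in t0.
move=> h; have t11 : t = 1 by apply: (param_inj ne); rewrite param1.
by rewrite t11 ltxx in t1.
Qed.

Lemma inner_or_endpoint e p : on_segment e p -> inner e p \/ endpoint e p.
Proof.
move=> [t [/andP[t0 t1] ->]].
have [->|t0'] := eqVneq t 0; first by right; rewrite /endpoint param0 eqxx.
have [->|t1'] := eqVneq t 1; first by right; rewrite /endpoint param1 eqxx orbT.
by left; exists t; rewrite !lt_neqAle t0 t1 t1' eq_sym t0'.
Qed.

(** The directions of the half-branches of the carrier at p. *)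
Definition rays D p : seq (plane R) :=
  flatten [seq (if e.2 == p then [::] else [:: dir e]) ++
               (if e.1 == p then [::] else [:: - dir e]) |
           e <- segs D & `[< on_segment e p >]].

Definition out_ray D p u : Prop :=
  exists e, [/\ e \in segs D, on_segment e p, e.2 != p & u = dir e].

Definition in_ray D p u : Prop :=
  exists e, [/\ e \in segs D, on_segment e p, e.1 != p & u = - dir e].

Lemma raysP D p u : u \in rays D p <-> out_ray D p u \/ in_ray D p u.
Proof.
split=> [/flatten_mapP[e]|].
  rewrite mem_filter => /andP[/asboolP on eD]; rewrite mem_cat => /orP[].
    by case: eqVneq => // ne; rewrite inE => /eqP->; left; exists e.
  by case: eqVneq => // ne; rewrite inE => /eqP->; right; exists e.
case=> [] [e [eD on ne ->]]; apply/flatten_mapP; exists e.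
- by rewrite mem_filter eD andbT; apply/asboolP.
- by rewrite mem_cat (negbTE ne) inE eqxx.
- by rewrite mem_filter eD andbT; apply/asboolP.
- by rewrite mem_cat (negbTE ne) inE eqxx orbT.
Qed.

Lemma near_thru D p : (forall e, e \in segs D -> e.1 != e.2) ->
  \forall q \near p, forall e, e \in segs D -> on_segment e q -> on_segment e p.
Proof.
move=> nd; apply: (@near_all_in (plane R) (segment R) (segs D) (nbhs p)
  (fun e q => on_segment e q -> on_segment e p)) => e eD.
have [on|off] := pselect (on_segment e p); first by apply: filterE.
by apply: filterS (near_off_segment (nd e eD) off) => q.
Qed.

Lemma near_before D p : (forall e, e \in segs D -> e.1 != e.2) ->
  \forall q \near p,
   (before D p q <-> exists2 u, out_ray D p u & on_ray u (q - p)) /\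
   (before D q p <-> exists2 u, in_ray D p u & on_ray u (q - p)).
Proof.
move=> nd.
have : \forall q \near p, forall e, e \in segs D -> on_segment e p ->
   (ebefore e p q <-> p != e.2 /\ on_ray (dir e) (q - p)) /\
   (ebefore e q p <-> p != e.1 /\ on_ray (- dir e) (q - p)).
  apply: (@near_all_in (plane R) (segment R) (segs D) (nbhs p)
    (fun e q => on_segment e p ->
   (ebefore e p q <-> p != e.2 /\ on_ray (dir e) (q - p)) /\
   (ebefore e q p <-> p != e.1 /\ on_ray (- dir e) (q - p)))) => e eD.
  have [on|off] := pselect (on_segment e p); last by apply: filterE => q /off.
  by apply: filterS (near_ebefore (nd e eD) on) => q.
apply: filterS => q hq; split; split.
- move=> /beforeP[e eD b].
  have on : on_segment e p.
    case: b => [s [t [s0 st t1 [-> _]]]]; exists s.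
    by rewrite s0 (le_trans (ltW st) t1).
  have [[/(_ b)[n r] _] _] := hq e eD on.
  by exists (dir e) => //; exists e; split => //; rewrite eq_sym.
- move=> [u [e [eD on ne ->]] r]; apply/beforeP; exists e => //.
  by apply/(hq e eD on).1; rewrite eq_sym.
- move=> /beforeP[e eD b].
  have on : on_segment e p.
    case: b => [s [t [s0 st t1 [_ ->]]]]; exists t.
    by rewrite t1 (le_trans s0 (ltW st)).
  have [_ [/(_ b)[n r] _]] := hq e eD on.
  by exists (- dir e) => //; exists e; split => //; rewrite eq_sym.
- move=> [u [e [eD on ne ->]] r]; apply/beforeP; exists e => //.
  by apply/(hq e eD on).2; rewrite eq_sym.
Qed.

Lemma carrier_before D p q : carrier D p ->
  (forall e, e \in segs D -> on_segment e q -> on_segment e p) ->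
  carrier D q <-> [\/ q = p, before D p q | before D q p].
Proof.
move=> [e0 e0D on0] th; split=> [[e eD on]|].
  case: ((on_segment_before q (th e eD on)).1 on) => [->|b|b]; first by constructor 1.
    by constructor 2; apply/beforeP; exists e.
  by constructor 3; apply/beforeP; exists e.
case=> [->|/beforeP[e eD [s [t [s0 st t1 [_ ->]]]]]|/beforeP[e eD [s [t [s0 st t1 [-> _]]]]]].
- by exists e0.
- by exists e => //; exists t; rewrite t1 (le_trans s0 (ltW st)).
- by exists e => //; exists s; rewrite s0 (le_trans (ltW st) t1).
Qed.

Lemma rays_endpoint D p e : e.1 != e.2 -> endpoint e p ->
  (e.2 != p -> dir e = outdir e p) /\ (e.1 != p -> - dir e = outdir e p).
Proof.
move=> ne /orP[]/eqP->; rewrite /outdir ?eqxx ?(negbTE ne); split => //.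
Qed.

(** Two half-branches at p with the same direction belong to the same segment: this
    is excluded at a crossing by transversality and at an endpoint by
    [outdir]. *)
Lemma star_rays D p : tame D p -> carrier D p -> star (carrier D) p (rays D p).
Proof.
move=> [nd pair tri _ _] Cp; split.
- move=> u /raysP[] [e [/nd ne on _ ->]]; rewrite ?oppr_eq0; exact: dir_neq0.
- have same e x y : e \in segs D -> (x = dir e \/ x = - dir e) ->
    (y = dir e \/ y = - dir e) -> on_ray x y -> x = y.
    move=> /nd/dir_neq0 d0.
    have nop z : z != 0 -> on_ray z (- z) = false.
      move=> z0; rewrite /on_ray.
      have -> : dot z (- z) = - dot z z by rewrite /dot /=; ring.
      by rewrite oppr_gt0 ltNge (ltW (dot_gt0 z0)) andbF.
    have d0' : - dir e != 0 by rewrite oppr_eq0.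
    case=> -> [] -> //; first by rewrite nop.
    by rewrite -{2}[dir e]opprK nop.
  have hray x : x \in rays D p -> exists e, [/\ e \in segs D, on_segment e p,
      x = dir e \/ x = - dir e & endpoint e p -> x = outdir e p].
    move=> /raysP[] [e [eD on ne xe]]; exists e; split => //.
    + by left.
    + by move=> ep; rewrite xe; apply: (rays_endpoint D (nd e eD) ep).1.
    + by right.
    + by move=> ep; rewrite xe; apply: (rays_endpoint D (nd e eD) ep).2.
  move=> u v /hray[e [eD one ue oute]] /hray[f [fD onf vf outf]] r.
  have [ef|ef] := eqVneq e f; first by rewrite -ef in vf; exact: (same e).
  have [[ee fe nr]|[ie if_ d]] := pair e f eD fD ef one onf.
    by move: nr; rewrite -oute // -outf // r.
  have [/eqP dz _] := andP r; case/eqP: d; apply/eqP.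
  by case: ue vf dz => -> [] -> /eqP; rewrite ?det2Nl ?det2Nr ?oppr_eq0.
- apply: filterS (filterI (near_thru p nd) (near_before p nd)) => q [th [b1 b2]].
  rewrite (carrier_before Cp th); split.
    case=> [->|/b1[u o r]|/b2[u o r]]; [by left|right; exists u => //|right; exists u => //].
      by apply/raysP; left.
    by apply/raysP; right.
  case=> [->|[u /raysP[ou|iu] r]]; first by constructor 1.
    by constructor 2; apply/b1; exists u.
  by constructor 3; apply/b2; exists u.
Qed.

End Prediagrams.

(** * Local coloring conditions under an isotopy *)

Section Points.
Variable R : realType.
Implicit Types (u v w z p q : plane R) (e f : segment R) (D : prediagram R).

Lemma near_ray_exists p u (P : plane R -> Prop) (e1 : R) : 0 < e1 ->
  (\forall q \near p, P q) -> exists2 t, 0 < t < e1 & P (ray_point p u t).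
Proof.
move=> e10 /(near_ray_point u)[e e0 he]; pose t := Num.min e e1 / 2.
have m0 : 0 < Num.min e e1 by rewrite lt_min e0 e10.
have t0 : 0 < t by rewrite divr_gt0.
have tm : t < Num.min e e1 by rewrite /t ltr_pdivrMr // ltr_pMr // ltr1n.
move: tm; rewrite lt_min => /andP[te te1].
by exists t; rewrite ?t0 //; apply: he; rewrite gtr0_norm.
Qed.

Lemma same_near_carrier (h : plane R -> plane R) D D' p :
  (forall e, e \in segs D -> e.1 != e.2) -> same_near h D D' p ->
  carrier D p -> carrier D' (h p).
Proof.
move=> nd [_ sn] [e eD on]; have ne := nd e eD.
have d0 := dir_neq0 ne.
have bC p' q' : before D' p' q' -> carrier D' p' /\ carrier D' q'.
  move=> [e' [s [t [eD' s0 st t1 [-> ->]]]]]; split; exists e' => //.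
    by exists s; rewrite s0 (le_trans (ltW st)).
  by exists t; rewrite t1 (le_trans s0) // ltW.
have nb := near_ebefore ne on.
have [n1|n1] := eqVneq p e.2.
  have n2 : p != e.1 by rewrite n1 eq_sym.
  have [t /andP[t0 _] [[_ s2 _] [_ b2]]] := near_ray_exists (- dir e) ltr01 (filterI sn nb).
  have : before D (ray_point p (- dir e) t) p.
    apply/beforeP; exists e => //; apply/b2; split => //.
    by rewrite ray_pointK on_ray_scale ?oppr_eq0.
  by move/s2/bC => -[].
have [t /andP[t0 _] [[s1 _ _] [b1 _]]] := near_ray_exists (dir e) ltr01 (filterI sn nb).
have : before D p (ray_point p (dir e) t).
  by apply/beforeP; exists e => //; apply/b1; rewrite ray_pointK on_ray_scale.
by move/s1/bC => -[].
Qed.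

(** The condition [same_near h] is thus symmetric, so that each transport lemma need
    only be proved in one direction. *)
Lemma same_near_inv (h g : plane R -> plane R) D D' p :
  {for h p, continuous g} -> cancel h g -> cancel g h ->
  same_near h D D' p -> same_near g D' D (h p).
Proof.
move=> gc hK gK [v sn]; split; first by rewrite hK; split => /v.
have n1 : \forall q \near g (h p), [/\ before D p q <-> before D' (h p) (h q),
        before D q p <-> before D' (h q) (h p) &
        on_over_strand D p q <-> on_over_strand D' (h p) (h q)].
  by rewrite hK.
have n2 : \forall q \near h p, [/\ before D p (g q) <-> before D' (h p) (h (g q)),
        before D (g q) p <-> before D' (h (g q)) (h p) &
        on_over_strand D p (g q) <-> on_over_strand D' (h p) (h (g q))].
  exact: (gc _ n1).
by apply: filterS n2 => q []; rewrite gK hK => b1 b2 b3; split; apply: iff_sym.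
Qed.

(** These are the conditions [sector], [around], [crossing_ok] and [vertex_ok] for
    a function on the plane instead of a map on the regions, and at a single
    point. *)
Definition sectorF X (F : plane R -> option X) p u v x :=
  forall w, ccw u w v -> \forall t \near 0^'+, F (shift p w t) = Some x.

Definition aroundF X (F : plane R -> option X) p u v xW xS xE xN :=
  [/\ sectorF F p v (- u) xW, sectorF F p (- u) (- v) xS,
      sectorF F p (- v) u xE & sectorF F p u v xN].

Definition crossing_eqF X (N : niebrzydowski_algebra X) F p e f :=
  exists xW xS xE xN,
    if 0 < det2 (dir e) (dir f)
    then aroundF F p (dir e) (dir f) xW xS xE xN /\ xN = N xW xS xE
    else aroundF F p (dir f) (dir e) xW xS xE xN /\ xS = N xW xN xE.

Definition crossing_okF X (N : niebrzydowski_algebra X) D F p :=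
  forall e f, crossing D e f p -> crossing_eqF N F p e f.

Definition vertex_okF X (N : niebrzydowski_algebra X) D F p :=
  forall e0 e1 e2, e0 \in segs D -> e1 \in segs D -> e2 \in segs D ->
  (e0.2 = p -> e1.1 = p -> e2.1 = p ->
   ccw (- dir e0) (dir e1) (dir e2) ->
   exists xW xM xE,
     [/\ sectorF F p (- dir e0) (dir e1) xE, sectorF F p (dir e1) (dir e2) xM,
         sectorF F p (dir e2) (- dir e0) xW & nmul N xW xE = Some xM]) /\
  (e0.1 = p -> e1.2 = p -> e2.2 = p ->
   ccw (dir e0) (- dir e1) (- dir e2) ->
   exists xW xM xE,
     [/\ sectorF F p (dir e0) (- dir e1) xW, sectorF F p (- dir e1) (- dir e2) xM,
         sectorF F p (- dir e2) (dir e0) xE & nmul N xW xE = Some xM]).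

Lemma near_shift p w (P : plane R -> Prop) : (\forall q \near p, P q) ->
  \forall t \near 0^'+, P (shift p w t).
Proof.
move=> /(near_ray_point w)[e e0 he]; near=> t.
have -> : shift p w t = ray_point p w t by [].
have t0 : 0 < t by near: t; exact: nbhs_right_gt.
by apply: he; rewrite gtr0_norm //; near: t; exact: nbhs_right_lt.
Unshelve. all: by end_near.
Qed.

(** In a sector where F is constant, the color of the sector is this constant; the
    sector contains a point because it is open and nonempty. *)
Lemma sectorF_germ X (F : plane R -> option X) p u v x y :
  u != 0 -> v != 0 -> ~~ on_ray u v ->
  (\forall q \near p, ccw u (q - p) v -> F q = Some x) ->
  sectorF F p u v y <-> y = x.
Proof.
move=> u0 v0 uv germ.
have germ' w : ccw u w v -> \forall t \near 0^'+, F (shift p w t) = Some x.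
  move=> cw; near=> t.
  have t0 : 0 < t by near: t; exact: nbhs_right_gt.
  have : ccw u (shift p w t - p) v -> F (shift p w t) = Some x.
    by near: t; exact: near_shift germ.
  apply; rewrite (_ : _ - p = (t * w.1, t * w.2)); last exact: ray_pointK.
  rewrite (@ccw_ray _ u w v) // on_ray_scale //.
  by apply: contraTN cw => /eqP->; rewrite ccw0.
split=> [sy|-> //].
have [c /(_ 1 ltr01)[]] := sector_center u0 v0 uv.
rewrite !mul1r -surjective_pairing => cc _.
near (0 : R)^'+ => t.
have t1 : F (shift p c t) = Some y by near: t; exact: sy.
have t2 : F (shift p c t) = Some x by near: t; exact: germ'.
by move: t1; rewrite t2 => -[].
Unshelve. all: by end_near.
Qed.

(** The colors of corresponding sectors agree: combine [sector_color] on both sides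
    with [left_color]. *)
Lemma sector_transport X (F F' : plane R -> option X) (h g : plane R -> plane R)
    C C' p (rs rs' : seq (plane R)) u v u' v' :
  isotopic_to_id h -> continuous h -> continuous g -> cancel h g -> cancel g h ->
  star C p rs -> star C' (h p) rs' -> (\forall q \near p, C q <-> C' (h q)) ->
  (\forall q \near p, colored_off C F q) ->
  (\forall q \near h p, colored_off C' F' q) ->
  (\forall q \near p, F' (h q) = F q) ->
  adjacent_rays rs u v -> adjacent_rays rs' u' v' -> matched h g p u u' ->
  exists x, (forall y, sectorF F p u v y <-> y = x) /\
            (forall y, sectorF F' (h p) u' v' y <-> y = x).
Proof.
move=> iso hc gc hK gK st st' CC cF cF' FF uv uv' m.
have [x cx] := sector_color st cF uv; have [x' cx'] := sector_color st' cF' uv'.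
have e := left_color iso hc hK st st' uv uv' m FF cx cx'.
exists x; split=> y; last rewrite e.
  case: st uv => rs0 rs1 _ [urs vrs ne _]; apply: sectorF_germ cx; [exact: rs0|exact: rs0|].
  by apply: contra ne => /rs1->.
case: st' uv' => rs0 rs1 _ [urs vrs ne _]; apply: sectorF_germ cx'; [exact: rs0|exact: rs0|].
by apply: contra ne => /rs1->.
Qed.

Lemma ccw_uuv u v : ccw u u v = false.
Proof.
have uu : det2 u u = 0 by rewrite /det2; ring.
rewrite /ccw uu ltxx /= andbF orbF (det2C v u) oppr_gt0.
by apply/negP => /andP[h]; rewrite ltNge ltW.
Qed.

Lemma ccw_uvv u v : ccw u v v = false.
Proof. by rewrite ccw_rot ccw_uuv. Qed.

Lemma adjacent4 (rs : seq (plane R)) u v : 0 < det2 u v -> u \in rs -> v \in rs ->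
  (forall w, w \in rs -> [\/ w = u, w = v, w = - u | w = - v]) ->
  adjacent_rays rs u v.
Proof.
move=> d urs vrs rsE; have uu x : det2 x x = 0 :> R by rewrite /det2; ring.
split => //; first by apply: contraTneq d => ->; rewrite uu ltxx.
move=> w /rsE[] ->; rewrite ?ccw_uuv ?ccw_uvv //.
  rewrite /ccw !(det2Nl, det2Nr) uu oppr0 ltxx /= andbF orbF (det2C v u) !oppr_gt0.
  by rewrite ltNge (ltW d).
rewrite /ccw !(det2Nl, det2Nr) uu oppr0 ltxx /= andbF /= (det2C v u) !oppr_gt0.
by rewrite ltNge (ltW d).
Qed.

Section Transport.
Variables (h g : plane R -> plane R) (D D' : prediagram R) (p : plane R).
Hypotheses (iso : isotopic_to_id h) (hc : continuous h) (gc : continuous g).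
Hypotheses (hK : cancel h g) (gK : cancel g h).
Hypotheses (tD : tame D p) (tD' : tame D' (h p)) (sn : same_near h D D' p).
Hypothesis Cp : carrier D p.

Let nd : forall e, e \in segs D -> e.1 != e.2.
Proof. by case: tD. Qed.

Let nd' : forall e, e \in segs D' -> e.1 != e.2.
Proof. by case: tD'. Qed.

Let Cp' : carrier D' (h p).
Proof. exact: same_near_carrier sn Cp. Qed.

Let st : star (carrier D) p (rays D p).
Proof. exact: star_rays. Qed.

Let st' : star (carrier D') (h p) (rays D' (h p)).
Proof. exact: star_rays. Qed.

Lemma carrier_near : \forall q \near p, carrier D q <-> carrier D' (h q).
Proof.
apply: filterS (filterI (filterI (proj2 sn) (near_thru p nd)) (hc (near_thru (h p) nd'))).
move=> q [[[s1 s2 _] th] th'].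
rewrite (carrier_before Cp th) (carrier_before Cp' th').
split=> [[->|/s1|/s2]|[/(can_inj hK)->|/s1|/s2]]; by [constructor 1|constructor 2|constructor 3].
Qed.

(** [before] at p is preserved by [same_near], and it tells which rays are
    outgoing. *)
Lemma out_matched u u' : u' \in rays D' (h p) -> matched h g p u u' ->
  out_ray D p u -> out_ray D' (h p) u'.
Proof.
move=> u'rs [[e e0 f1] _] ou.
have u0 : u != 0 by case: st => rs0 _ _; apply: rs0; apply/raysP; left.
have [t te [[[s1 _ _] [b1 _]] [b1' _]]] := near_ray_exists u e0
  (filterI (filterI (proj2 sn) (near_before p nd)) (hc (near_before (h p) nd'))).
have t0 : 0 < t by case/andP: te.
have /s1/b1'[v ov rv] : before D p (ray_point p u t).
  by apply/b1; exists u => //; rewrite ray_pointK on_ray_scale.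
case: st' => _ rs1 _; have -> // : u' = v.
apply: rs1 => //; first by apply/raysP; left.
exact: on_ray_trans (f1 t te) (on_ray_sym rv).
Qed.

Lemma in_matched u u' : u' \in rays D' (h p) -> matched h g p u u' ->
  in_ray D p u -> in_ray D' (h p) u'.
Proof.
move=> u'rs [[e e0 f1] _] ou.
have u0 : u != 0 by case: st => rs0 _ _; apply: rs0; apply/raysP; right.
have [t te [[[_ s2 _] [_ b2]] [_ b2']]] := near_ray_exists u e0
  (filterI (filterI (proj2 sn) (near_before p nd)) (hc (near_before (h p) nd'))).
have t0 : 0 < t by case/andP: te.
have /s2/b2'[v ov rv] : before D (ray_point p u t) p.
  by apply/b2; exists u => //; rewrite ray_pointK on_ray_scale.
case: st' => _ rs1 _; have -> // : u' = v.
apply: rs1 => //; first by apply/raysP; right.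
exact: on_ray_trans (f1 t te) (on_ray_sym rv).
Qed.

Lemma inner_neq e q : e.1 != e.2 -> inner e q -> q != e.1 /\ q != e.2.
Proof.
move=> ne /(inner_endpoint ne); rewrite /endpoint negb_or => /andP[h1 h2]; split => //.
Qed.

(** The points near p on the over strand are sent to the over strand at h p, which
    contains only two of the four rays. *)
Lemma over_matched e f u u' : crossing D e f p -> u = dir e \/ u = - dir e ->
  u' \in rays D' (h p) -> matched h g p u u' ->
  exists e' f', crossing D' e' f' (h p) /\ (u' = dir e' \/ u' = - dir e').
Proof.
move=> cr ue u'rs [[a a0 f1] _]; have [eD fD ef [ie if_] _] := cr.
have ne := nd eD; have d0 := dir_neq0 ne; have [p1 p2] := inner_neq ne ie.
have on := inner_on ie.
have u0 : u != 0 by case: ue => ->; rewrite ?oppr_eq0.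
have [t te [[[_ _ s3] [b1 b2]] th']] := near_ray_exists u a0
  (filterI (filterI (proj2 sn) (near_ebefore ne on)) (hc (near_thru (h p) nd'))).
have t0 : 0 < t by case/andP: te.
have [e' [f' [cr' on']]] : on_over_strand D' (h p) (h (ray_point p u t)).
  apply/s3; exists e, f; split => //; apply/(on_segment_before _ on).
  case: ue te {f1} => ue te.
    by constructor 2; apply/b1; split => //; rewrite ray_pointK ue on_ray_scale.
  by constructor 3; apply/b2; split => //; rewrite ray_pointK ue on_ray_scale ?oppr_eq0.
exists e', f'; split => //; have [eD' fD' ef' [ie' if'] _] := cr'.
have ne' := nd' eD'; have [p1' p2'] := inner_neq ne' ie'.
case: st' => _ rs1 _; have hu := f1 t te.
have r1 : dir e' \in rays D' (h p).
  by apply/raysP; left; exists e'; split => //; [exact: inner_on|rewrite eq_sym].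
have r2 : - dir e' \in rays D' (h p).
  by apply/raysP; right; exists e'; split => //; [exact: inner_on|rewrite eq_sym].
have [z0] : h (ray_point p u t) - h p != 0 by case: (on_ray_neq0 hu).
have [s [_ ps]] := inner_on ie'; have [s' [_ qs]] := on'.
have zE : h (ray_point p u t) - h p = ((s' - s) * (dir e').1, (s' - s) * (dir e').2).
  by rewrite qs ps param_sub.
have [ss|ss|ss] := ltgtP s s'.
- left; apply: rs1 => //; apply: on_ray_trans hu _; apply: on_ray_sym.
  by rewrite zE on_ray_scale ?dir_neq0 ?subr_gt0.
- right; apply: rs1 => //; apply: on_ray_trans hu _; apply: on_ray_sym; rewrite zE.
  have -> : ((s' - s) * (dir e').1, (s' - s) * (dir e').2) =
            ((s - s') * (- dir e').1, (s - s') * (- dir e').2) :> plane R.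
    by congr (_, _); rewrite /=; ring.
  by rewrite on_ray_scale ?oppr_eq0 ?dir_neq0 ?subr_gt0.
- by move: z0; rewrite zE ss subrr !mul0r eqxx.
Qed.

Lemma crossing_exists : (exists e f, crossing D e f p) ->
  exists e' f', crossing D' e' f' (h p).
Proof.
case: sn => _ /nbhs_singleton[_ _ [s _]] [e [f cr]].
have [|e' [f' [cr' _]]] := s; last by exists e', f'.
by exists e, f; split => //; case: cr => _ _ _ [/inner_on].
Qed.

End Transport.

Lemma crossing_thru D p e f k : tame D p -> crossing D e f p -> k \in segs D ->
  on_segment k p -> k = e \/ k = f.
Proof.
move=> [nd pair tri _ _] [eD fD ef [ie if_] _] kD on.
have [->|ke] := eqVneq k e; first by left.
have [->|kf] := eqVneq k f; [by right|exfalso].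
have [[_ ee _]|[ik _ _]] := pair k e kD eD ke on (inner_on ie).
  by move: (inner_endpoint (nd e eD) ie); rewrite ee.
apply: (tri k e f kD eD fD) => //.
by rewrite /= !inE negb_or ke kf ef.
Qed.

Lemma crossing_det D p e f : tame D p -> crossing D e f p -> det2 (dir e) (dir f) != 0.
Proof.
move=> [nd pair tri _ _] [eD fD ef [ie if_] _].
have [[ee _ _]|[_ _ //]] := pair e f eD fD ef (inner_on ie) (inner_on if_).
by move: (inner_endpoint (nd e eD) ie); rewrite ee.
Qed.

Lemma crossing_uniq D p e f e' f' : tame D p -> crossing D e f p ->
  crossing D e' f' p -> e' = e /\ f' = f.
Proof.
move=> t cr cr'.
have [eD fD ef [ie if_] ov] := cr; have [eD' fD' ef' [ie' if'] ov'] := cr'.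
have h1 := crossing_thru t cr eD' (inner_on ie').
have h2 := crossing_thru t cr fD' (inner_on if').
case: t => nd _ _ xor _.
case: h1 h2 => e1 [] f1; rewrite ?e1 ?f1 ?eqxx // in ef' ov' *.
by have := xor e f eD fD ef ie if_; rewrite ov ov'.
Qed.

Ltac pick4 := first [by constructor 1|by constructor 2|by constructor 3|by constructor 4].

(** Only the two segments of the crossing go through p. *)
Lemma crossing_rays D p e f : tame D p -> crossing D e f p ->
  (forall u, out_ray D p u <-> u = dir e \/ u = dir f) /\
  (forall u, in_ray D p u <-> u = - dir e \/ u = - dir f).
Proof.
move=> t cr; have th := crossing_thru t cr.
have [eD fD ef [ie if_] _] := cr; case: t => nd _ _ _ _.
have ends k : k \in segs D -> inner k p -> k.1 != p /\ k.2 != p.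
  move=> /nd nk /(inner_endpoint nk); rewrite /endpoint negb_or eq_sym => /andP[-> h].
  by rewrite eq_sym h.
have [e1 e2] := ends e eD ie; have [f1 f2] := ends f fD if_.
split=> u; split.
- by move=> [k [kD on _ ->]]; case: (th k kD on) => ->; [left|right].
- by case=> ->; [exists e|exists f]; split => //; exact: inner_on.
- by move=> [k [kD on _ ->]]; case: (th k kD on) => ->; [left|right].
- by case=> ->; [exists e|exists f]; split => //; exact: inner_on.
Qed.

(** Writing o for the direction of the segment, outgoing if true, treats the two
    kinds of vertices of [vertex_ok] at the same time. *)
Definition labelled_ray D p (o : bool) u : Prop := exists2 e, e \in segs D &
  if o then e.1 = p /\ u = dir e else e.2 = p /\ u = - dir e.

Lemma vertex_okP X (N : niebrzydowski_algebra X) D F p : vertex_okF N D F p <->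
  forall o r0 r1 r2, labelled_ray D p (~~ o) r0 -> labelled_ray D p o r1 ->
    labelled_ray D p o r2 -> ccw r0 r1 r2 -> exists x0 xM x1,
    [/\ sectorF F p r0 r1 x0, sectorF F p r1 r2 xM, sectorF F p r2 r0 x1 &
        (if o then nmul N x1 x0 else nmul N x0 x1) = Some xM].
Proof.
split=> [ok [] r0 r1 r2 /=|ok e0 e1 e2 e0D e1D e2D].
- move=> [e0 e0D [p0 ->]] [e1 e1D [p1 ->]] [e2 e2D [p2 ->]] c.
  have [/(_ p0 p1 p2 c)[xW [xM [xE [s0 s1 s2 eM]]]] _] := ok e0 e1 e2 e0D e1D e2D.
  by exists xE, xM, xW.
- move=> [e0 e0D [p0 ->]] [e1 e1D [p1 ->]] [e2 e2D [p2 ->]] c.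
  have [_ /(_ p0 p1 p2 c)[xW [xM [xE [s0 s1 s2 eM]]]]] := ok e0 e1 e2 e0D e1D e2D.
  by exists xW, xM, xE.
- split=> p0 p1 p2 c.
    have [|||xE [xM [xW [s0 s1 s2 eM]]]] := ok true _ _ _ _ _ _ c; last by exists xW, xM, xE.
    + by exists e0.
    + by exists e1.
    + by exists e2.
  have [|||xW [xM [xE [s0 s1 s2 eM]]]] := ok false _ _ _ _ _ _ c; last by exists xW, xM, xE.
  + by exists e0.
  + by exists e1.
  + by exists e2.
Qed.

Lemma vertex_end D p e : tame D p -> vertex D p -> e \in segs D -> on_segment e p ->
  endpoint e p.
Proof.
move=> t v eD on; have [nd pair _ _ /(_ v)[e0 [e1 [e2 [_ eE]]]]] := t.
have e0D : (e0 \in segs D) && endpoint e0 p by rewrite eE !inE eqxx.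
case/andP: e0D => e0D ee0.
have [->//|ne] := eqVneq e e0.
have [[//]|[_ i _]] := pair e e0 eD e0D ne on (endpoint_on ee0).
by move: (inner_endpoint (nd _ e0D) i); rewrite ee0.
Qed.

Lemma labelled_rayP D p o u : tame D p -> vertex D p ->
  labelled_ray D p o u <-> if o then out_ray D p u else in_ray D p u.
Proof.
move=> t v; have [nd _ _ _ _] := t; case: o; split.
- move=> [e eD [ep ->]]; exists e; split => //.
    by apply: endpoint_on; rewrite /endpoint ep eqxx.
  by rewrite -ep eq_sym nd.
- move=> [e [eD on ne ->]]; exists e => //; split => //.
  by have := vertex_end t v eD on; rewrite /endpoint [p == e.2]eq_sym (negbTE ne) orbF => /eqP.
- move=> [e eD [ep ->]]; exists e; split => //.
    by apply: endpoint_on; rewrite /endpoint ep eqxx orbT.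
  by rewrite -ep nd.
- move=> [e [eD on ne ->]]; exists e => //; split => //.
  by have := vertex_end t v eD on; rewrite /endpoint [p == e.1]eq_sym (negbTE ne) => /eqP.
Qed.

(** Exactly three segments end at a vertex, each giving one ray. *)
Lemma vertex_three_rays D p r0 r1 r2 : tame D p -> vertex D p ->
  r0 \in rays D p -> r1 \in rays D p -> r2 \in rays D p -> uniq [:: r0; r1; r2] ->
  forall w, w \in rays D p -> w \in [:: r0; r1; r2].
Proof.
move=> t v h0 h1 h2 u w; have [nd _ _ _ /(_ v)[e0 [e1 [e2 [_ eE]]]]] := t.
have rE x : x \in rays D p -> x \in [seq outdir e p | e <- [:: e0; e1; e2]].
  move=> /raysP[] [e [eD on ne ->]]; have en := vertex_end t v eD on;
    apply/mapP; exists e; rewrite -?eE ?eD //.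
    exact: (rays_endpoint D (nd e eD) en).1.
  exact: (rays_endpoint D (nd e eD) en).2.
have sub : {subset [:: r0; r1; r2] <= [seq outdir e p | e <- [:: e0; e1; e2]]}.
  by move=> x x3; apply: rE; move: x3; rewrite !inE => /or3P[] /eqP->.
have [_ ->] := uniq_min_size u sub (leqnn 3).
exact: rE.
Qed.

Lemma adjacent3 (rs : seq (plane R)) r0 r1 r2 : r0 \in rs -> r1 \in rs ->
  (forall w, w \in rs -> w \in [:: r0; r1; r2]) -> ccw r0 r1 r2 -> adjacent_rays rs r0 r1.
Proof.
move=> h0 h1 rE c; split => //; first by apply: contraTneq c => ->; rewrite ccw_uuv.
move=> w /rE; rewrite !inE => /or3P[] /eqP->; rewrite ?ccw_uuv ?ccw_uvv //.
by rewrite (ccw_asym c).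
Qed.

Lemma neq_opp u : u != 0 -> u != - u.
Proof.
move=> /dot_gt0 d; apply: contraTneq d => e.
have : dot u u = - dot u u by rewrite {2}e /dot /=; ring.
by move=> e2; rewrite -leNgt; lra.
Qed.

Lemma adjacent_four (rs : seq (plane R)) a b : 0 < det2 a b ->
  (forall w, w \in rs <-> [\/ w = a, w = b, w = - a | w = - b]) ->
  [/\ adjacent_rays rs a b, adjacent_rays rs b (- a),
     adjacent_rays rs (- a) (- b) & adjacent_rays rs (- b) a].
Proof.
move=> d rE; split; apply: adjacent4; rewrite ?det2Nl ?det2Nr ?opprK // ?(det2C b a) ?opprK //;
  try (by apply/rE; pick4);
  by move=> w /rE[] ->; rewrite ?opprK; pick4.
Qed.

Lemma swap_four (a b c d w : plane R) : [\/ w = a, w = b, w = c | w = d] <->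
  [\/ w = b, w = a, w = d | w = c].
Proof. by split=> -[] ->; pick4. Qed.

Lemma rays_at_crossing D p e f : tame D p -> crossing D e f p -> forall w,
  w \in rays D p <-> [\/ w = dir e, w = dir f, w = - dir e | w = - dir f].
Proof.
move=> tD cr w; have [outE inE] := crossing_rays tD cr.
rewrite raysP outE inE; split=> [[] [] ->|[] ->]; try pick4;
  by [left; left|left; right|right; left|right; right].
Qed.

Lemma ccw_uniq (a b c : plane R) : ccw a b c -> uniq [:: a; b; c].
Proof.
move=> abc; rewrite /= !inE negb_or andbT.
apply/andP; split; [apply/andP; split|]; apply: contraTneq abc => ->;
  by rewrite ?ccw_uuv ?ccw_uvv // ccw_rot ccw_uvv.
Qed.

Lemma star_ccw_total (C : set (plane R)) q (rs : seq (plane R)) a b c : star C q rs ->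
  a \in rs -> b \in rs -> c \in rs -> uniq [:: a; b; c] -> ccw a b c || ccw a c b.
Proof.
move=> [rs0 rs1 _] ar br cr; rewrite /= !inE negb_or andbT => /andP[/andP[ab ac] bc].
by apply: ccw_total; rewrite ?rs0 //; apply/negP => /rs1 e; move: ab ac bc; rewrite e // ?eqxx.
Qed.

Lemma labelled_rays D q o u : tame D q -> vertex D q -> labelled_ray D q o u -> u \in rays D q.
Proof.
by move=> tE vE /(labelled_rayP o u tE vE) l; apply/raysP; case: o l => l; [left|right].
Qed.

Lemma labelled_vertex D q o r0 r1 r2 : labelled_ray D q o r1 -> labelled_ray D q o r2 ->
  ccw r0 r1 r2 -> vertex D q.
Proof.
move=> [e1 e1E h1] [e2 e2E h2] c; exists e1, e2.
case: o h1 h2 => -[h1 r1E] [h2 r2E]; split => //; try by [left|right].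
  by apply: contraTneq c => ee; rewrite r1E r2E ee ccw_uvv.
by apply: contraTneq c => ee; rewrite r1E r2E ee ccw_uvv.
Qed.

Section LocalConditions.
Variables (h g : plane R -> plane R) (D D' : prediagram R) (p : plane R).
Hypotheses (iso : isotopic_to_id h) (hc : continuous h) (gc : continuous g).
Hypotheses (hK : cancel h g) (gK : cancel g h).
Hypotheses (tD : tame D p) (tD' : tame D' (h p)) (sn : same_near h D D' p).
Variables (X : Type) (N : niebrzydowski_algebra X) (F F' : plane R -> option X).
Hypothesis cF : \forall q \near p, colored_off (carrier D) F q.
Hypothesis cF' : \forall q \near h p, colored_off (carrier D') F' q.
Hypothesis FF : \forall q \near p, F' (h q) = F q.

Section CrossingPair.
Variables (e f e' f' : segment R).
Hypotheses (cr : crossing D e f p) (cr' : crossing D' e' f' (h p)).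
Let Cp : carrier D p.
Proof. by case: cr => eD _ _ [ie _] _; exists e => //; exact: inner_on. Qed.
Let st : star (carrier D) p (rays D p).
Proof. exact: star_rays. Qed.
Let st' : star (carrier D') (h p) (rays D' (h p)).
Proof. by apply: star_rays => //; apply: same_near_carrier sn Cp; case: tD. Qed.
Let CC := carrier_near hc hK tD tD' sn Cp.
Let rsE := rays_at_crossing tD cr.
Let rsE' := rays_at_crossing tD' cr'.
Let d0 := crossing_det tD cr.
Let d0' := crossing_det tD' cr'.

(** The ray matched with the direction of the over strand is outgoing and belongs to
    the over strand, hence is the direction of the over strand; likewise for its
    opposite, and the two remaining rays are told apart by being outgoing or
    incoming. *)
Lemma crossing_matched :
  [/\ matched h g p (dir e) (dir e'), matched h g p (dir f) (dir f'),
      matched h g p (- dir e) (- dir e') & matched h g p (- dir f) (- dir f')].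
Proof.
have [outE inE] := crossing_rays tD cr; have [outE' inE'] := crossing_rays tD' cr'.
have ex := matched_exists hc gc hK gK st st' CC.
have inj := matched_inj hc hK st.
have ov := over_matched hc tD tD' sn Cp cr.
have me : matched h g p (dir e) (dir e').
  have urs : dir e \in rays D p by apply/rsE; constructor 1.
  have [u' u'rs m] := ex _ urs.
  have ou : out_ray D' (h p) u' by apply: (out_matched hc tD tD' sn Cp u'rs m); apply/outE; left.
  have [e1 [f1 [cr1 ue1]]] := ov _ _ _ (or_introl erefl) u'rs m.
  have [ee _] := crossing_uniq tD' cr' cr1; rewrite ee in ue1.
  case/outE': ou => ue; first by rewrite -ue.
  exfalso; case: ue1 => ue1; rewrite ue1 in ue.
    by move: d0'; rewrite -ue /det2 mulrC subrr eqxx.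
  by move: d0'; rewrite -ue det2Nr /det2 mulrC subrr oppr0 eqxx.
have mNe : matched h g p (- dir e) (- dir e').
  have urs : - dir e \in rays D p by apply/rsE; constructor 3.
  have [u' u'rs m] := ex _ urs.
  have ou : in_ray D' (h p) u' by apply: (in_matched hc tD tD' sn Cp u'rs m); apply/inE; left.
  have [e1 [f1 [cr1 ue1]]] := ov _ _ _ (or_intror erefl) u'rs m.
  have [ee _] := crossing_uniq tD' cr' cr1; rewrite ee in ue1.
  case/inE': ou => ue; first by rewrite -ue.
  exfalso; case: ue1 => ue1; rewrite ue1 in ue.
    by move: d0'; rewrite ue det2Nl /det2 mulrC subrr oppr0 eqxx.
  by move: d0'; rewrite -[dir f']opprK -ue opprK /det2 mulrC subrr eqxx.
have mf : matched h g p (dir f) (dir f').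
  have urs : dir f \in rays D p by apply/rsE; constructor 2.
  have [u' u'rs m] := ex _ urs.
  have ou : out_ray D' (h p) u' by apply: (out_matched hc tD tD' sn Cp u'rs m); apply/outE; right.
  case/outE': ou => ue; last by rewrite -ue.
  rewrite ue in m; have ers : dir e \in rays D p by apply/rsE; constructor 1.
  by move: d0; rewrite (inj _ _ _ urs ers m me) /det2 mulrC subrr eqxx.
have mNf : matched h g p (- dir f) (- dir f').
  have urs : - dir f \in rays D p by apply/rsE; constructor 4.
  have [u' u'rs m] := ex _ urs.
  have ou : in_ray D' (h p) u' by apply: (in_matched hc tD tD' sn Cp u'rs m); apply/inE; right.
  case/inE': ou => ue; last by rewrite -ue.
  rewrite ue in m; have ers : - dir e \in rays D p by apply/rsE; constructor 3.
  have := inj _ _ _ urs ers m mNe => /oppr_inj fe.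
  by move: d0; rewrite fe /det2 mulrC subrr eqxx.
by split.
Qed.

(** The sign of a crossing is the cyclic order of its four rays.  If dir f followed
    dir e in this order, but dir e' followed dir f', then [adjacent_matched] would
    identify dir f with its opposite. *)
Lemma crossing_sign : (0 < det2 (dir e) (dir f)) = (0 < det2 (dir e') (dir f')).
Proof.
have [me mf mNe mNf] := crossing_matched.
have am := adjacent_matched iso hc gc hK gK st st' CC.
have nf0 : dir f != 0.
  by apply: contra_neq d0 => ->; rewrite /det2 /= !mulr0 subrr.
have rswE w := iff_trans (rsE w) (swap_four _ _ _ _ w).
have rswE' w := iff_trans (rsE' w) (swap_four _ _ _ _ w).
have frs : dir f \in rays D p by apply/rsE; constructor 2.
have Nfrs : - dir f \in rays D p by apply/rsE; constructor 4.
have [d|d|/eqP] := ltrgt0P (det2 (dir e) (dir f)); last by rewrite (negbTE d0).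
  have [d'|d'|/eqP] := ltrgt0P (det2 (dir e') (dir f')); [by []| |by rewrite (negbTE d0')].
  have [a1 _ _ _] := adjacent_four d rsE.
  have dd : 0 < det2 (dir f') (dir e') by rewrite det2C oppr_gt0.
  have [_ a2 _ _] := adjacent_four dd rswE'.
  have /esym/eqP := am _ _ _ _ _ a1 Nfrs a2 me mNf.
  by rewrite (negbTE (neq_opp nf0)).
have [d'|d'|/eqP] := ltrgt0P (det2 (dir e') (dir f')); [|by []|by rewrite (negbTE d0')].
have [a1 _ _ _] := adjacent_four d' rsE'.
have dd : 0 < det2 (dir f) (dir e) by rewrite det2C oppr_gt0.
have [_ a2 _ _] := adjacent_four dd rswE.
have /eqP := am _ _ _ _ _ a2 frs a1 me mf.
by rewrite (negbTE (neq_opp nf0)).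
Qed.

(** The four sectors at a crossing, one after the other. *)
Lemma around_transport a b a' b' : 0 < det2 a b -> 0 < det2 a' b' ->
  (forall w, w \in rays D p <-> [\/ w = a, w = b, w = - a | w = - b]) ->
  (forall w, w \in rays D' (h p) <-> [\/ w = a', w = b', w = - a' | w = - b']) ->
  matched h g p a a' -> matched h g p b b' -> matched h g p (- a) (- a') ->
  matched h g p (- b) (- b') ->
  forall W S E O, aroundF F p a b W S E O <-> aroundF F' (h p) a' b' W S E O.
Proof.
move=> dab dab' r r' ma mb mNa mNb W S E O.
have [a1 a2 a3 a4] := adjacent_four dab r; have [b1 b2 b3 b4] := adjacent_four dab' r'.
have tr := sector_transport iso hc gc hK gK st st' CC cF cF' FF.
have [x1 [s1 t1]] := tr _ _ _ _ a1 b1 ma; have [x2 [s2 t2]] := tr _ _ _ _ a2 b2 mb.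
have [x3 [s3 t3]] := tr _ _ _ _ a3 b3 mNa; have [x4 [s4 t4]] := tr _ _ _ _ a4 b4 mNb.
split=> [[/s2 A /s3 B /s4 C /s1 G]|[/t2 A /t3 B /t4 C /t1 G]].
  by split; [apply/t2|apply/t3|apply/t4|apply/t1].
by split; [apply/s2|apply/s3|apply/s4|apply/s1].
Qed.

Lemma crossing_eq_transport : crossing_eqF N F p e f <-> crossing_eqF N F' (h p) e' f'.
Proof.
have [me mf mNe mNf] := crossing_matched; have sgn := crossing_sign.
rewrite /crossing_eqF -sgn; have [d|d] := ltP 0 (det2 (dir e) (dir f)).
  have d' : 0 < det2 (dir e') (dir f') by rewrite -sgn.
  have ar := around_transport d d' rsE rsE' me mf mNe mNf.
  by split=> -[W [S [E [T [A B]]]]]; exists W, S, E, T; split => //; apply/ar.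
have dd : 0 < det2 (dir f) (dir e).
  by rewrite det2C oppr_gt0 lt_neqAle d0.
have dd' : 0 < det2 (dir f') (dir e').
  by rewrite det2C oppr_gt0 lt_neqAle d0' leNgt -sgn -leNgt.
have ar := around_transport dd dd' (fun w => iff_trans (rsE w) (swap_four _ _ _ _ w))
   (fun w => iff_trans (rsE' w) (swap_four _ _ _ _ w)) mf me mNf mNe.
by split=> -[W [S [E [T [A B]]]]]; exists W, S, E, T; split => //; apply/ar.
Qed.

End CrossingPair.

Lemma crossing_ok_transport :
  crossing_okF N D F p <-> crossing_okF N D' F' (h p).
Proof.
have sn' : same_near g D' D (h p) := same_near_inv (@gc (h p)) hK gK sn.
split=> ok e f cr.
  have [|e' [f' cr']] := @crossing_exists g D' D (h p) sn'; first by exists e, f.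
  by rewrite hK in cr'; apply/(crossing_eq_transport cr' cr); exact: ok.
have [|e' [f' cr']] := @crossing_exists h D D' p sn; first by exists e, f.
by apply/(crossing_eq_transport cr cr'); exact: ok.
Qed.

(** At a vertex the three matched rays have the same orientations and the same
    cyclic order, so that the three sectors correspond. *)
Lemma vertex_ok_transport :
  vertex_okF N D F p <-> vertex_okF N D' F' (h p).
Proof.
have vP : vertex D p <-> vertex D' (h p) by case: sn.
rewrite !vertex_okP.
have [v|nv] := pselect (vertex D p); last first.
  have nv' : ~ vertex D' (h p) by move/vP.
  split=> _ o r0 r1 r2 _ l1 l2 c; first by case: nv'; exact: labelled_vertex l1 l2 c.
  by case: nv; exact: labelled_vertex l1 l2 c.
have v' := vP.1 v.
have Cp : carrier D p.
  case: (v) => e [f [eD _ _ ends]]; exists e => //.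
  by case: ends => -[<- _]; apply: endpoint_on; rewrite /endpoint eqxx ?orbT.
have st : star (carrier D) p (rays D p) by exact: star_rays.
have Cp' : carrier D' (h p) by apply: same_near_carrier sn Cp; case: tD.
have st' : star (carrier D') (h p) (rays D' (h p)) by exact: star_rays.
have CC := carrier_near hc hK tD tD' sn Cp.
have sn' : same_near g D' D (h p) := same_near_inv (@gc (h p)) hK gK sn.
pose M := matched h g p.
have ex u : u \in rays D p -> exists2 u', u' \in rays D' (h p) & M u u'.
  exact: (matched_exists hc gc hK gK st st' CC).
have st2 : star (carrier D) (g (h p)) (rays D p) by rewrite hK.
have ex' u' : u' \in rays D' (h p) -> exists2 u, u \in rays D p & M u u'.
  move=> u'rs; have [u urs [f1 f2]] :=
    matched_exists gc hc gK hK st' st2 (star_inv gc hK gK CC) u'rs.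
  by exists u => //; split; rewrite hK in f2.
have fn u u' w' : u' \in rays D' (h p) -> w' \in rays D' (h p) -> M u u' -> M u w' -> u' = w'.
  exact: (matched_fun st').
have inj u w u' : u \in rays D p -> w \in rays D p -> M u u' -> M w u' -> u = w.
  exact: (matched_inj hc hK st).
have lab o u u' : u \in rays D p -> u' \in rays D' (h p) -> M u u' ->
    labelled_ray D p o u <-> labelled_ray D' (h p) o u'.
  move=> urs u'rs m; rewrite !labelled_rayP //.
  have m' : matched g h (h p) u' u by case: m => f1 f2; split => //; rewrite hK.
  have tD2 : tame D (g (h p)) by rewrite hK.
  have urs2 : u \in rays D (g (h p)) by rewrite hK.
  case: o; split.
  - exact: (out_matched hc tD tD' sn Cp u'rs m).
  - by move=> ou; have := out_matched gc tD' tD2 sn' Cp' urs2 m' ou; rewrite hK.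
  - exact: (in_matched hc tD tD' sn Cp u'rs m).
  - by move=> ou; have := in_matched gc tD' tD2 sn' Cp' urs2 m' ou; rewrite hK.
have am := adjacent_matched iso hc gc hK gK st st' CC.
have three := @vertex_three_rays D p; have three' := @vertex_three_rays D' (h p).
(* otherwise the ray next to r0' is matched with r2, which must then be the ray r1
   next to r0 *)
have ccwF r0 r1 r2 r0' r1' r2' : r0 \in rays D p -> r1 \in rays D p -> r2 \in rays D p ->
    r0' \in rays D' (h p) -> r1' \in rays D' (h p) -> r2' \in rays D' (h p) ->
    M r0 r0' -> M r1 r1' -> M r2 r2' -> ccw r0 r1 r2 -> ccw r0' r1' r2'.
  move=> h0 h1 h2 h0' h1' h2' m0 m1 m2 c.
  have u' : uniq [:: r0'; r1'; r2'].
    have := ccw_uniq c; rewrite /= !inE !negb_or !andbT => /andP[/andP[ab ac] bc].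
    apply/andP; split; [apply/andP; split|].
    - by apply: contra_neq ab => e; apply: (inj _ _ r0') => //; rewrite e.
    - by apply: contra_neq ac => e; apply: (inj _ _ r0') => //; rewrite e.
    - by apply: contra_neq bc => e; apply: (inj _ _ r1') => //; rewrite e.
  case/orP: (star_ccw_total st' h0' h1' h2' u') => // c'.
  have t := three _ _ _ tD v h0 h1 h2 (ccw_uniq c).
  have t' := three' _ _ _ tD' v' h0' h2' h1' (ccw_uniq c').
  have e := am _ _ _ _ _ (adjacent3 h0 h1 t c) h2 (adjacent3 h0' h2' t' c') m0 m2.
  by move: c; rewrite e ccw_uvv.
have ccwM r0 r1 r2 r0' r1' r2' : r0 \in rays D p -> r1 \in rays D p -> r2 \in rays D p ->
    r0' \in rays D' (h p) -> r1' \in rays D' (h p) -> r2' \in rays D' (h p) ->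
    M r0 r0' -> M r1 r1' -> M r2 r2' -> ccw r0 r1 r2 <-> ccw r0' r1' r2'.
  move=> h0 h1 h2 h0' h1' h2' m0 m1 m2; split; first exact: ccwF.
  move=> c; have u : uniq [:: r0; r1; r2].
    have := ccw_uniq c; rewrite /= !inE !negb_or !andbT => /andP[/andP[ab ac] bc].
    apply/andP; split; [apply/andP; split|].
    - by apply: contra_neq ab => e; apply: (fn r0) => //; rewrite e.
    - by apply: contra_neq ac => e; apply: (fn r0) => //; rewrite e.
    - by apply: contra_neq bc => e; apply: (fn r1) => //; rewrite e.
  have /orP[//|c'] := star_ccw_total st h0 h1 h2 u.
  by rewrite (ccw_asym (ccwF _ _ _ _ _ _ h0 h2 h1 h0' h2' h1' m0 m2 m1 c')) in c.
have sec r0 r1 r2 r0' r1' r2' : r0 \in rays D p -> r1 \in rays D p -> r2 \in rays D p ->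
    r0' \in rays D' (h p) -> r1' \in rays D' (h p) -> r2' \in rays D' (h p) ->
    M r0 r0' -> ccw r0 r1 r2 -> ccw r0' r1' r2' ->
    exists x, (forall y, sectorF F p r0 r1 y <-> y = x) /\
              (forall y, sectorF F' (h p) r0' r1' y <-> y = x).
  move=> h0 h1 h2 h0' h1' h2' m0 c c'.
  have t := three _ _ _ tD v h0 h1 h2 (ccw_uniq c).
  have t' := three' _ _ _ tD' v' h0' h1' h2' (ccw_uniq c').
  exact: (sector_transport iso hc gc hK gK st st' CC cF cF' FF
    (adjacent3 h0 h1 t c) (adjacent3 h0' h1' t' c') m0).
split=> ok o r0 r1 r2 l0 l1 l2 c.
  have [h0' h1' h2'] := And3 (labelled_rays tD' v' l0) (labelled_rays tD' v' l1) (labelled_rays tD' v' l2).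
  have [s0 h0 m0] := ex' _ h0'; have [s1 h1 m1] := ex' _ h1'; have [s2 h2 m2] := ex' _ h2'.
  have c' : ccw s0 s1 s2 by apply/(ccwM s0 s1 s2 r0 r1 r2).
  have [x0 [xM [x1 [a0 aM a1 eM]]]] := ok o s0 s1 s2 ((lab _ _ _ h0 h0' m0).2 l0)
    ((lab _ _ _ h1 h1' m1).2 l1) ((lab _ _ _ h2 h2' m2).2 l2) c'.
  have [y0 [b0 d0]] := sec _ _ _ _ _ _ h0 h1 h2 h0' h1' h2' m0 c' c.
  have [y1 [b1 d1]] := sec s1 s2 s0 r1 r2 r0 h1 h2 h0 h1' h2' h0' m1 (etrans (esym (ccw_rot _ _ _)) c') (etrans (esym (ccw_rot _ _ _)) c).
  have [y2 [b2 d2]] := sec s2 s0 s1 r2 r0 r1 h2 h0 h1 h2' h0' h1' m2 (etrans (ccw_rot _ _ _) c') (etrans (ccw_rot _ _ _) c).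
  by exists x0, xM, x1; split => //; [apply/d0/b0|apply/d1/b1|apply/d2/b2].
have [h0 h1 h2] := And3 (labelled_rays tD v l0) (labelled_rays tD v l1) (labelled_rays tD v l2).
have [s0 h0' m0] := ex _ h0; have [s1 h1' m1] := ex _ h1; have [s2 h2' m2] := ex _ h2.
have c' : ccw s0 s1 s2 by apply/(ccwM r0 r1 r2 s0 s1 s2).
have [x0 [xM [x1 [a0 aM a1 eM]]]] := ok o s0 s1 s2 ((lab _ _ _ h0 h0' m0).1 l0)
  ((lab _ _ _ h1 h1' m1).1 l1) ((lab _ _ _ h2 h2' m2).1 l2) c'.
have [y0 [b0 d0]] := sec _ _ _ _ _ _ h0 h1 h2 h0' h1' h2' m0 c c'.
have [y1 [b1 d1]] := sec r1 r2 r0 s1 s2 s0 h1 h2 h0 h1' h2' h0' m1 (etrans (esym (ccw_rot _ _ _)) c) (etrans (esym (ccw_rot _ _ _)) c').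
have [y2 [b2 d2]] := sec r2 r0 r1 s2 s0 s1 h2 h0 h1 h2' h0' h1' m2 (etrans (ccw_rot _ _ _) c) (etrans (ccw_rot _ _ _) c').
by exists x0, xM, x1; split => //; [apply/b0/d0|apply/b1/d1|apply/b2/d2].
Qed.

End LocalConditions.
End Points.

(** * Colorings as functions on the plane *)

(** A bijective relation.  It avoids having to choose inverse functions when the
    colorings of the two diagrams are only related by a condition. *)
Lemma card_eq_rel (T U : Type) (A : set T) (B : set U) (r : T -> U -> Prop) :
  (forall x, A x -> exists2 y, B y & r x y) ->
  (forall y, B y -> exists2 x, A x & r x y) ->
  (forall x y y', r x y -> r x y' -> y = y') ->
  (forall x x' y, r x y -> r x' y -> x = x') -> A #= B.
Proof.
move=> tot sur fn inj.
have [[a Aa]|nA] := pselect (exists a, A a); last first.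
  have -> : A = set0 by apply/seteqP; split => // x Ax; case: nA; exists x.
  have -> : B = set0 by apply/seteqP; split => // y /sur[x Ax]; case: nA; exists x.
  exact: card_eq00.
have [b Bb _] := tot a Aa.
have fP x : exists y, A x -> B y /\ r x y.
  have [/tot[y By rxy]|nAx] := pselect (A x); first by exists y.
  by exists b.
pose f x := sval (cid (fP x)).
have fE x : A x -> B (f x) /\ r x (f x) by rewrite /f; case: (cid _).
have -> : B = f @` A.
  apply/seteqP; split=> [y By|_ [x /fE[Bx _] <-] //].
  by have [x Ax rxy] := sur y By; exists x => //; apply: fn rxy; apply: (fE x Ax).2.

rewrite card_eq_sym; apply: inj_card_eq => x y /set_mem/fE[_ rx] /set_mem/fE[_ ry] e.
by apply: inj rx _; rewrite e.
Qed.

Section Global.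
Variable R : realType.
Implicit Types (u v w z p q : plane R) (e f : segment R) (D : prediagram R).

Lemma inner_outdir e p (s : R) : endpoint e p -> 0 < s < 1 ->
  inner e (ray_point p (outdir e p) s).
Proof.
move=> ep /andP[s0 s1]; rewrite /outdir; case: eqP => [<-|n].
  by exists s; rewrite s0 s1.
case/orP: ep => /eqP; first by move=> pe; case: n.
move=> ->; exists (1 - s); rewrite subr_gt0 s1 ltrBlDr ltrDl s0; split => //.
by rewrite /ray_point /param /shift /dir; congr (_, _); rewrite /=; ring.
Qed.

Lemma outdirE e p : outdir e p = dir e \/ outdir e p = - dir e.
Proof. by rewrite /outdir; case: eqP; [left|right]. Qed.

(** Two segments leaving p in the same direction would overlap, so they would have a
    common inner point on parallel lines. *)
Lemma outdir_off D e f p : is_diagram D -> e \in segs D -> f \in segs D -> e != f ->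
  endpoint e p -> endpoint f p -> ~~ on_ray (outdir e p) (outdir f p).
Proof.
move=> [[_ nd] _ pair _ _] eD fD ef ep fp; apply/negP => r.
have d0 : det2 (dir e) (dir f) = 0.
  case/andP: r => /eqP d _; move: d.
  by case: (outdirE e p) => ->; case: (outdirE f p) => ->;
    rewrite ?det2Nl ?det2Nr ?opprK // => /eqP; rewrite oppr_eq0 => /eqP.
have [t t0 E] := on_ray_pos r.
have m0 : 0 < 1 + t by rewrite addr_gt0.
(* the point at parameter t / (1 + t) on e is the point at 1 / (1 + t) on f *)
have i1 : inner f (ray_point p (outdir f p) (1 + t)^-1).
  apply: inner_outdir => //; rewrite invr_gt0 m0 invf_lt1 //.
  by rewrite ltrDl.
have i2 : inner e (ray_point p (outdir e p) (t / (1 + t))).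
  apply: inner_outdir => //; rewrite divr_gt0 //= ltr_pdivrMr // mul1r.
  by rewrite ltrDr.
have E2 : ray_point p (outdir e p) (t / (1 + t)) = ray_point p (outdir f p) (1 + t)^-1.
  by rewrite /ray_point /shift E; congr (_, _) => /=; ring.
rewrite E2 in i2.
have [/andP[x _]|[_ _]] := pair e f _ eD fD ef (inner_on i2) (inner_on i1).
  by have := inner_endpoint (nd e eD) i2; rewrite x.
by rewrite d0 eqxx.
Qed.

Lemma count2 (T : eqType) (a : pred T) (s : seq T) x y : x \in s -> y \in s ->
  x != y -> a x -> a y -> (1 < count a s)%N.
Proof.
move=> xs ys xy ax ay; rewrite -size_filter.
have : {subset [:: x; y] <= [seq x <- s | a x]}.
  by move=> z; rewrite !inE => /orP[]/eqP->; rewrite mem_filter ?ax ?ay.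
by move/uniq_leq_size; rewrite /= inE xy; apply.
Qed.

(** At a vertex two segments start or two segments end, so that the pair of degrees
    is (1, 2) or (2, 1) and three segments meet. *)
Lemma diagram_tame D p : is_diagram D -> tame D p.
Proof.
move=> dD; have [[un nd] deg pair tri ov] := dD; split => //.
- move=> e f eD fD ef one onf.
  have [/andP[ep fp]|] := pair e f p eD fD ef one onf; last by right.
  by left; split => //; exact: outdir_off dD eD fD ef ep fp.
- by move=> e f g; exact: tri.
- by move=> e f; exact: ov.
- move=> [e [f [eD fD ef V]]].
  have ep : endpoint e p by case: V => -[<- _]; rewrite /endpoint eqxx ?orbT.
  have := deg e p eD ep; rewrite /indeg /outdeg.
  set i := count _ _; set o := count _ _ => io.
  have two : (1 < i)%N \/ (1 < o)%N.
    case: V => -[e1 e2]; [right|left]; apply: (count2 eD fD ef); by apply/eqP.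
  have three : (i + o = 3)%N.
    by move: io; rewrite !inE => /or3P[] /eqP[h1 h2]; case: two; rewrite h1 h2.
  pose s := [seq e <- segs D | endpoint e p].
  have sz : size s = 3%N.
    rewrite size_filter -three addnC -[LHS]addn0.
    rewrite -(count_predUI (fun e => e.1 == p)); congr addn; last first.
      by apply/esym/eqP; rewrite -leqn0 leqNgt -has_count; apply/hasPn => k /nd kn;
        apply/negP => /andP[/eqP<- /eqP k2]; rewrite k2 eqxx in kn.
    by apply: eq_count => k; rewrite /endpoint /= !(eq_sym p).
  have us : uniq s by rewrite filter_uniq.
  have h k : (k \in s) = endpoint k p && (k \in segs D) by rewrite mem_filter.
  clearbody s; case: s us sz h => [|a [|b [|c []]]] // us _ h.
  by exists a, b, c; split => // k; rewrite andbC h.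
Qed.

Lemma near_off_carrier D q : (forall e, e \in segs D -> e.1 != e.2) ->
  ~ carrier D q -> \forall q' \near q, ~ carrier D q'.
Proof.
move=> nd nC.
have : \forall q' \near q, forall e, e \in segs D -> ~ on_segment e q'.
  apply: (@near_all_in (plane R) (segment R) (segs D) (nbhs q)
    (fun e q' => ~ on_segment e q')) => e eD.
  by apply: near_off_segment (nd e eD) _ => on; apply: nC; exists e.
by apply: filterS => q' h [e eD on]; exact: h on.
Qed.

Definition valid_at D X (N : niebrzydowski_algebra X) F p :=
  [/\ colored_off (carrier D) F p, crossing_okF N D F p & vertex_okF N D F p].

(** Around a point off C there is a box that is disjoint from C, and whose points
    are joined to its center by segments. *)
Lemma near_component (C : set (plane R)) q : ~ C q -> (\forall q' \near q, ~ C q') ->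
  \forall q' \near q, connected_component (~` C) q q'.
Proof.
move=> nC /near_boxP[e e0 h]; apply/near_boxP; exists e => // q' [h1 h2].
pose f (t : R) := shift q (q' - q) t.
have fc : {within `[0, 1]%classic, continuous f}.
  by apply: continuous_subspaceT => t; exact: continuous_ray_point.
have c : connected (f @` `[0, 1]%classic).
  by apply: connected_continuous_connected fc; exact: segment_connected.
exists (f @` `[0, 1]%classic).
  split => //.
  - exists 0; first by rewrite /= in_itv /= lexx ler01.
    by rewrite /f /shift !mul0r !addr0 -surjective_pairing.
  - move=> z [t +]; rewrite /= in_itv /= => /andP[t0 t1] <-; apply: h.
    have aux (a : R) : `|a| < e -> `|t * a| < e.
      move=> ae; rewrite normrM (ger0_norm t0); apply: le_lt_trans ae.
      by rewrite ler_piMl.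
    by split; rewrite /= addrAC subrr add0r; apply: aux.
exists 1; first by rewrite /= in_itv /= lexx ler01.
by rewrite /f /shift !mul1r; rewrite [RHS]surjective_pairing; congr (_, _) => /=; ring.
Qed.

Lemma constant_on_connected X (C B : set (plane R)) (F : plane R -> option X) :
  (forall q, ~ C q -> \forall q' \near q, ~ C q') ->
  (forall q, ~ C q -> \forall q' \near q, F q' = F q) ->
  connected B -> B `<=` ~` C -> forall p q, B p -> B q -> F q = F p.
Proof.
move=> oC lc cB BC p q Bp Bq.
have : B `&` [set q | ~ C q /\ F q = F p] = B.
  apply: cB.
  - by exists p; split => //; split => //; exact: BC.
  - exists [set q | ~ C q /\ F q = F p] => //.
    rewrite openE => z [nCz Fz]; rewrite /interior.
    by apply: filterS (filterI (oC z nCz) (lc z nCz)) => z' [a b]; split; rewrite ?b.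
  - exists (~` [set q | ~ C q /\ F q <> F p]).
      apply: open_closedC; rewrite openE => z [nCz Fz]; rewrite /interior.
      by apply: filterS (filterI (oC z nCz) (lc z nCz)) => z' [a b]; split; rewrite ?b.
    apply/seteqP; split=> z [Bz h]; split => //; first by case: h => _ h [_].
    by split; [exact: BC|apply: contrapT => n; apply: h; split => //; exact: BC].
by move/seteqP => [_ /(_ q Bq)[_ []]].
Qed.

Section Colorings.
Variables (X : Type) (N : niebrzydowski_algebra X) (D : prediagram R).
Hypothesis nd : forall e, e \in segs D -> e.1 != e.2.

Definition region_of q (nC : ~ carrier D q) : regions D :=
  SigSub (mem_set (ex_intro2 _ _ q nC erefl)).

Definition colorF (c : regions D -> X) q : option X :=
  if pselect (carrier D q) is right nC then Some (c (region_of nC)) else None.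

Lemma region_eq (r : regions D) q (nC : ~ carrier D q) :
  set_val r q -> r = region_of nC.
Proof.
move=> rq; apply: val_inj => /=.
have /set_mem[p nCp rE] := valP r; rewrite -rE.
apply: same_connected_component; move: rq; rewrite set_valE.
by rewrite -rE.
Qed.

Lemma region_of_in q (nC : ~ carrier D q) : set_val (region_of nC) q.
Proof. by rewrite set_valE /=; exact: connected_component_refl. Qed.

Lemma coloredE c q x : colored c q x <-> colorF c q = Some x.
Proof.
rewrite /colorF; case: pselect => [C|nC]; split => //.
- move=> [r [rq _]]; have /set_mem[p nCp rE] := valP r.
  by move: rq; rewrite set_valE -rE => /connected_component_sub; rewrite /setC /=.
- by move=> [r [rq <-]]; rewrite (region_eq nC rq).
- by move=> [<-]; exists (region_of nC); split => //; exact: region_of_in.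
Qed.

Lemma sectorE c p u v x : sector c p u v x <-> sectorF (colorF c) p u v x.
Proof.
by split=> h w cw; apply: filterS (h w cw) => t /coloredE.
Qed.

Lemma colorF_off c q : colored_off (carrier D) (colorF c) q.
Proof.
split; first by rewrite /colorF; case: pselect.
move=> nC; apply: filterS (near_component nC (near_off_carrier nd nC)) => q' cq.
have -> : colorF c q = Some (c (region_of nC)).
  by apply/coloredE; exists (region_of nC); split => //; exact: region_of_in.
by apply/coloredE; exists (region_of nC); split.
Qed.

Lemma is_coloringE c : is_coloring N c <-> forall p, valid_at D N (colorF c) p.
Proof.
have aE p u v W S E T : around c p u v W S E T <-> aroundF (colorF c) p u v W S E T.
  by split=> -[] /sectorE h1 /sectorE h2 /sectorE h3 /sectorE h4.
split=> [[cr ve] p|h]; split.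
- exact: colorF_off.
- move=> e f /cr[W [S [E [T h]]]]; exists W, S, E, T.
  by move: h; case: ifP => _ [/aE].
- move=> e0 e1 e2 e0D e1D e2D; have [h1 h2] := ve e0 e1 e2 p e0D e1D e2D.
  split=> p0 p1 p2 cc.
    by have [W [M [E [/sectorE ? /sectorE ? /sectorE ? ?]]]] := h1 p0 p1 p2 cc; exists W, M, E.
  by have [W [M [E [/sectorE ? /sectorE ? /sectorE ? ?]]]] := h2 p0 p1 p2 cc; exists W, M, E.
- move=> e f p; have [_ cr _] := h p => /cr[W [S [E [T k]]]]; exists W, S, E, T.
  by move: k; case: ifP => _ [/aE].
- move=> e0 e1 e2 p e0D e1D e2D; have [_ _ ve] := h p.
  have [h1 h2] := ve e0 e1 e2 e0D e1D e2D.
  split=> p0 p1 p2 cc.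
    by have [W [M [E [/sectorE ? /sectorE ? /sectorE ? ?]]]] := h1 p0 p1 p2 cc; exists W, M, E.
  by have [W [M [E [/sectorE ? /sectorE ? /sectorE ? ?]]]] := h2 p0 p1 p2 cc; exists W, M, E.
Qed.

Lemma colorF_inj c c' : colorF c = colorF c' -> c = c'.
Proof.
move=> E; apply/funext => r; have /set_mem[p nC rE] := valP r.
have rp : set_val r p by rewrite set_valE -rE; exact: connected_component_refl.
have : colorF c p = Some (c r) by apply/coloredE; exists r.
rewrite E => /coloredE[r' [/(region_eq nC)-> <-]].
by rewrite (region_eq nC rp).
Qed.

(** A locally constant function on the complement of the carrier is constant on each
    of its connected components. *)
Lemma colorF_surj F : (forall p, valid_at D N F p) -> exists c, colorF c = F.
Proof.
move=> vF.
have oC q : ~ carrier D q -> \forall q' \near q, ~ carrier D q'.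
  exact: near_off_carrier.
have lc q : ~ carrier D q -> \forall q' \near q, F q' = F q.
  by case: (vF q) => -[].
have cr (r : regions D) : exists x, forall q, set_val r q -> F q = Some x.
  have /set_mem[p nC rE] := valP r.
  case Fp: (F p) => [x|]; last by case: nC; case: (vF p) => -[[/(_ Fp)]].
  exists x => q; rewrite set_valE -rE => cq; rewrite -Fp.
  apply: (constant_on_connected oC lc (@component_connected _ (~` carrier D) p)) => //.
    exact: connected_component_sub.
  exact: connected_component_refl.
exists (fun r => sval (cid (cr r))); apply/funext => q.
rewrite /colorF; case: pselect => [C|nC].
  by case: (vF q) => -[[_ /(_ C)]].
by case: cid => x /= h; rewrite (h q (region_of_in nC)).
Qed.

(** From here on colorings are functions on the plane. *)
Lemma card_colorings :
  colorings N D #= [set F | forall p, valid_at D N F p].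
Proof.
apply: (@card_eq_rel _ _ _ _ (fun c F => colorF c = F)).
- by move=> c /is_coloringE h; exists (colorF c).
- move=> F vF; have [c cF] := colorF_surj vF; exists c => //.
  by apply/is_coloringE; rewrite cF.
- by move=> c F F' <- <-.
- by move=> c c' F <- /esym /colorF_inj.
Qed.

End Colorings.

End Global.

(** * Replacing the contents of a disk *)

Section Gluing.
Variable R : realType.
Implicit Types (u v w z p q : plane R) (e f : segment R) (D : prediagram R).

Section TransportOn.
Variables (h g : plane R -> plane R) (D D' : prediagram R) (U : set (plane R)).
Hypotheses (iso : isotopic_to_id h) (hc : continuous h) (gc : continuous g).
Hypotheses (hK : cancel h g) (gK : cancel g h) (oU : open U).
Hypothesis tD : forall p, U p -> tame D p.
Hypothesis tD' : forall p, U p -> tame D' (h p).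
Hypothesis sn : forall p, U p -> same_near h D D' p.
Variables (X : Type) (N : niebrzydowski_algebra X) (F F' : plane R -> option X).
Hypothesis FF : forall p, U p -> F' (h p) = F p.

Let nearU p : U p -> \forall q \near p, U q.
Proof. by move: oU; rewrite openE => /(_ p). Qed.

Let nearU' p : U p -> \forall q \near h p, U (g q).
Proof.
move=> Up; have n : \forall q \near g (h p), U q by rewrite hK; exact: nearU.
exact: (@gc (h p) _ n).
Qed.

Lemma carrierE p : U p -> carrier D p <-> carrier D' (h p).
Proof.
move=> Up; have [nd _ _ _ _] := tD Up; have [nd' _ _ _ _] := tD' Up.
split; first exact: same_near_carrier nd (sn Up).
have sn' : same_near g D' D (h p) := same_near_inv (@gc (h p)) hK gK (sn Up).
by move/(same_near_carrier nd' sn'); rewrite hK.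
Qed.

Lemma offE p : U p -> colored_off (carrier D) F p <-> colored_off (carrier D') F' (h p).
Proof.
move=> Up; rewrite /colored_off (FF Up).
split=> -[N1 lc]; split=> [|nC].
- exact: iff_trans N1 (carrierE Up).
- have n : \forall q \near g (h p), F q = F p by rewrite hK; apply: lc => /(carrierE Up).
  have n2 : \forall q \near h p, F (g q) = F p := @gc (h p) _ n.
  by apply: filterS (filterI n2 (nearU' Up)) => q [e Uq]; rewrite -e -FF // gK.
- exact: iff_trans N1 (iff_sym (carrierE Up)).
- have n : \forall q \near p, F' (h q) = F p by apply: (@hc p _ (lc _)) => /(carrierE Up).
by apply: filterS (filterI n (nearU Up)) => q [e Uq]; rewrite -e -FF.
Qed.

(** All conditions are local, so they are carried by h from an open set U to its
    image. *)
Lemma valid_transport_on :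
  (forall p, U p -> valid_at D N F p) <-> (forall p, U p -> valid_at D' N F' (h p)).
Proof.
have offD : (forall p, U p -> colored_off (carrier D) F p) -> forall p, U p ->
    [/\ \forall q \near p, colored_off (carrier D) F q,
        \forall q \near h p, colored_off (carrier D') F' q &
        \forall q \near p, F' (h q) = F q].
  move=> off p Up; split.
  - by apply: filterS (nearU Up).
  - by apply: filterS (nearU' Up) => q Ugq; rewrite -[q]gK; apply/offE => //; exact: off.
  - by apply: filterS (nearU Up) => q /FF.
split=> va p Up.
  have [c1 c2 c3] := offD (fun q Uq => let: And3 x _ _ := va q Uq in x) p Up.
  have [of1 cr ve] := va p Up; split; first exact/offE.
    by apply/(crossing_ok_transport iso hc gc hK gK (tD Up) (tD' Up) (sn Up) N c1 c2 c3).
  by apply/(vertex_ok_transport iso hc gc hK gK (tD Up) (tD' Up) (sn Up) N c1 c2 c3).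
have off q : U q -> colored_off (carrier D) F q by move=> Uq; apply/offE => //; case: (va q Uq).
have [c1 c2 c3] := offD off p Up.
have [of1 cr ve] := va p Up; split; first exact: off.
  by apply/(crossing_ok_transport iso hc gc hK gK (tD Up) (tD' Up) (sn Up) N c1 c2 c3).
by apply/(vertex_ok_transport iso hc gc hK gK (tD Up) (tD' Up) (sn Up) N c1 c2 c3).
Qed.

End TransportOn.

Lemma homeo_of_isotopy (h : plane R -> plane R) : isotopic_to_id h -> homeomorphism h.
Proof. by move=> [H [_ hom _ <-]]; apply: hom; rewrite ler01 lexx. Qed.

Lemma isotopic_id : isotopic_to_id (id : plane R -> plane R).
Proof.
exists (fun _ => id); split => //.
  by apply: continuous_subspaceT => x; exact: cvg_snd.
move=> t _; split; first by move=> x; exact: cvg_id.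
by exists id; split => // x; exact: cvg_id.
Qed.

Section Invariance.
Variables (X : Type) (N : niebrzydowski_algebra X).

Definition valid D F := forall p, valid_at D N F p.

Lemma card_valid D D' : is_diagram D -> is_diagram D' ->
  [set F | valid D F] #= [set F | valid D' F] -> colorings N D #= colorings N D'.
Proof.
move=> [[_ nd] _ _ _ _] [[_ nd'] _ _ _ _] c.
apply: card_eq_trans (card_colorings N nd) _; apply: card_eq_trans c _.
by rewrite card_eq_sym; exact: card_colorings.
Qed.

Lemma planar_isotopic_card (D D' : diagram R) : planar_isotopic D D' ->
  colorings N D #= colorings N D'.
Proof.
move=> [h iso sn]; have [hc [g [gc hK gK]]] := homeo_of_isotopy iso.
apply: card_valid; [exact: diagramP|exact: diagramP|].
have tr F F' : (forall p, F' (h p) = F p) -> valid D F <-> valid D' F'.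
  move=> FF.
  have := @valid_transport_on h g D D' setT iso hc gc hK gK openT
    (fun p _ => diagram_tame p (diagramP D)) (fun p _ => diagram_tame _ (diagramP D'))
    (fun p _ => sn p) X N F F' (fun p _ => FF p).
  move=> tr; split=> v p; first by rewrite -[p]gK; apply: tr.1.
  by apply: tr.2 => // q _; exact: v.
apply: (@card_eq_rel _ _ _ _ (fun F F' => forall p, F' (h p) = F p)).
- move=> F vF; exists (F \o g); first by apply/(tr F) => // p /=; rewrite hK.
  by move=> p /=; rewrite hK.
- by move=> F' vF; exists (F' \o h) => //; exact/(tr (F' \o h)).
- by move=> F F' F'' e1 e2; apply/funext => q; rewrite -[q]gK e1 e2.
- by move=> F F1 F' e1 e2; apply/funext => q; rewrite -e1 -e2.
Qed.

Definition valid_on (U : set (plane R)) D F := forall p, U p -> valid_at D N F p.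

Definition agree (G G' : plane R -> option X) :=
  forall p, outer_disk p -> ~ inner_disk p -> G p = G' p.

(** The contribution of a move: whatever coloring of the picture P is given, its
    restriction to the annulus between the two disks, where the pictures agree,
    extends to P', and in at most one way. *)
Definition extends P P' :=
  (forall G, valid_on (@outer_disk R) P G ->
     exists2 G', valid_on (@outer_disk R) P' G' & agree G G') /\
  (forall G G', valid_on (@outer_disk R) P' G -> valid_on (@outer_disk R) P' G' ->
     agree G G' -> forall p, outer_disk p -> G p = G' p).

Lemma inner_outer p : @inner_disk R p -> outer_disk p.
Proof. by move=> [h1 h2]; split; lra. Qed.

Lemma open_outer : open (@outer_disk R).
Proof.
rewrite openE => p [h1 h2]; rewrite /interior; apply/near_boxP.
exists (Num.min (3 - `|p.1|) (3 - `|p.2|)); first by rewrite lt_min !subr_gt0 h1 h2.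
move=> q [/=]; rewrite !lt_min => /andP[a1 _] /andP[_ a2].
by split; [have := ler_normD (q.1 - p.1) p.1|have := ler_normD (q.2 - p.2) p.2];
  rewrite subrK; lra.
Qed.

Lemma open_not_inner : open (~` @inner_disk R).
Proof.
rewrite openE => p np; rewrite /interior; apply/near_boxP.
have [h|h] : 2 < `|p.1| \/ 2 < `|p.2|.
  by have [h1|] := lerP `|p.1| 2; [right; rewrite ltNge; apply/negP => h2; exact: np|left].
  exists (`|p.1| - 2); first by rewrite subr_gt0.
  move=> q [/= a1 a2] [b1 b2].
  by have := ler_normD (p.1 - q.1) q.1; rewrite subrK distrC; lra.
exists (`|p.2| - 2); first by rewrite subr_gt0.
move=> q [/= a1 a2] [b1 b2].
by have := ler_normD (p.2 - q.2) q.2; rewrite subrK distrC; lra.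
Qed.

Section Replacement.
Variables (D D' : diagram R) (P P' : prediagram R) (h g : plane R -> plane R).
Hypotheses (iso : isotopic_to_id h) (hc : continuous h) (gc : continuous g).
Hypotheses (hK : cancel h g) (gK : cancel g h).
Hypothesis sn : forall p, outer_disk p -> same_near h P D p /\ same_near h P' D' p.
Hypothesis out : forall p, ~ inner_disk p -> same_near id D D' (h p).
Hypothesis tP : forall p, outer_disk p -> tame P p.
Hypothesis tP' : forall p, outer_disk p -> tame P' p.
Hypothesis ext : extends P P'.

Let tD p : tame D p.
Proof. exact: diagram_tame (diagramP D). Qed.

Let tD' p : tame D' p.
Proof. exact: diagram_tame (diagramP D'). Qed.

Let same_off (F F' : plane R -> option X) :=
  forall p, ~ inner_disk p -> F' (h p) = F (h p).

(** Off the inner disk the two diagrams coincide, so that the identity, on the open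
    set of images of points off the disk, carries one coloring to the other. *)
Lemma valid_off F F' : same_off F F' ->
  (forall p, ~ inner_disk p -> valid_at D N F (h p)) <->
  (forall p, ~ inner_disk p -> valid_at D' N F' (h p)).
Proof.
move=> FF.
have idc : continuous (id : plane R -> plane R) by move=> x; exact: cvg_id.
pose U : set (plane R) := [set q | ~ inner_disk (g q)].
have oU : open U.
  have -> : U = g @^-1` (~` @inner_disk R) by [].
  by move/continuousP: gc; apply; exact: open_not_inner.
have FU q : U q -> F' (id q) = F q.
  by rewrite /U /= -{2 3}[q]gK; exact: FF.
have sU q : U q -> same_near id D D' q.
  by rewrite /U /= -{2}[q]gK; exact: out.
have := @valid_transport_on id id D D' U isotopic_id idc idc (fun=> erefl)
   (fun=> erefl) oU (fun q _ => tD q) (fun q _ => tD' _) sU X N F F' FU.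
move=> tr; split=> v p np.
  apply: tr.1; last by rewrite /U /= hK.
  by move=> q Uq; rewrite -[q]gK; exact: v.
apply: tr.2; last by rewrite /U /= hK.
by move=> q Uq; rewrite -[q]gK; exact: v.
Qed.

(** A coloring F of D is pulled back to the picture P, replaced there by a coloring
    G' of P', and glued to F along the annulus.  The conditions hold at each
    point because each point is either in the outer disk or off the inner one,
    and both are open. *)
Lemma replacement_extends :
  (forall F, valid D F -> exists2 F', valid D' F' & same_off F F') /\
  (forall F1 F2, valid D' F1 -> valid D' F2 -> same_off F1 F2 -> F1 = F2).
Proof.
have [ex un] := ext.
have pull' F G : (forall p, outer_disk p -> F (h p) = G p) ->
    valid_on (@outer_disk R) P' G <-> (forall p, outer_disk p -> valid_at D' N F (h p)).
  move=> FG; exact: (valid_transport_on iso hc gc hK gK open_outer tP' (fun p _ => tD' _)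
    (fun p Op => (sn Op).2) N FG).
split=> [F vF|F1 F2 v1 v2 FF].
  have vG : valid_on (@outer_disk R) P (F \o h).
    apply/(valid_transport_on iso hc gc hK gK open_outer tP (fun p _ => tD _)
      (fun p Op => (sn Op).1) N (F' := F)) => // p _; exact: vF.
  have [G' vG' ag] := ex _ vG.
  pose F' q := if pselect (inner_disk (g q)) then G' (g q) else F q.
  have F'o p : outer_disk p -> F' (h p) = G' p.
    by move=> Op; rewrite /F' hK; case: pselect => // ni; rewrite -ag.
  have F'n : same_off F F' by move=> p np; rewrite /F' hK; case: pselect.
  exists F' => // q; rewrite -[q]gK.
  have [i|n] := pselect (inner_disk (g q)).
    by apply/(pull' F' G' F'o).1 => //; exact: inner_outer.
  by apply: (valid_off F'n).1.
have un12 := un (F1 \o h) (F2 \o h).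
have {un12}e p : outer_disk p -> F1 (h p) = F2 (h p).
  apply: un12; first by apply/(pull' F1 (F1 \o h)) => // q _; exact: v1.
    by apply/(pull' F2 (F2 \o h)) => // q _; exact: v2.
  by move=> q _ nq /=; rewrite FF.
apply/funext => q; rewrite -[q]gK.
have [i|n] := pselect (inner_disk (g q)); first by apply: e; exact: inner_outer.
by rewrite FF.
Qed.

End Replacement.

Lemma same_near_id_sym D D' p : same_near id D D' p -> same_near id D' D p.
Proof.
move=> [v n]; split; first exact: iff_sym.
by apply: filterS n => q [a b c]; split; exact: iff_sym.
Qed.

(** The colorings of D and of D' which agree off the inner disk correspond
    bijectively, by [extends] in both directions. *)
Lemma replacement_card (M : seq (polyline R) -> seq (polyline R) -> Prop)
    (D D' : diagram R) :
  (forall L L', M L L' ->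
    [/\ forall p, outer_disk p -> tame (picture L) p /\ tame (picture L') p,
        extends (picture L) (picture L') & extends (picture L') (picture L)]) ->
  replacement M D D' -> colorings N D #= colorings N D'.
Proof.
move=> hM [L [L' [h [/hM[tm e1 e2] iso sn out]]]].
have [hc [g [gc hK gK]]] := homeo_of_isotopy iso.
have tP p : outer_disk p -> tame (picture L) p by move/tm=> [].
have tP' p : outer_disk p -> tame (picture L') p by move/tm=> [].
have [ex un] := replacement_extends iso hc gc hK gK sn out tP tP' e1.
have sn' p : outer_disk p -> same_near h (picture L') D' p /\ same_near h (picture L) D p.
  by move/sn=> [].
have out' p : ~ inner_disk p -> same_near id D' D (h p).
  by move/out/same_near_id_sym.
have [ex' un'] := replacement_extends iso hc gc hK gK sn' out' tP' tP e2.
apply: card_valid; [exact: diagramP|exact: diagramP|].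
apply: (@card_eq_rel _ _ _ _ (fun F F' => [/\ valid D F, valid D' F' &
  forall p, ~ inner_disk p -> F' (h p) = F (h p)])).
- by move=> F vF; have [F' vF' s] := ex F vF; exists F'.
- move=> F' vF'; have [F vF s] := ex' F' vF'; exists F => //; split => // p np.
  by rewrite s.
- move=> F F1 F2 [_ v1 s1] [_ v2 s2]; apply: un => // p np.
  by rewrite s1 // s2.
- move=> F1 F2 F' [v1 _ s1] [v2 _ s2]; apply: un' => // p np.
  by rewrite -s1 // -s2.
Qed.

End Invariance.

End Gluing.

(** * Orientations of the vertices in a disk *)

Section YOriented.
Variable R : realType.
Implicit Types (u v w z p q : plane R) (e f : segment R) (D : prediagram R).

Definition y_oriented D : Prop := forall p, outer_disk p -> vertex D p ->
  (exists2 e, e \in segs D & e.1 = p) /\ (exists2 e, e \in segs D & e.2 = p).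

Lemma vertex_degrees D p : is_diagram D -> vertex D p ->
  (exists2 e, e \in segs D & e.1 = p) /\ (exists2 e, e \in segs D & e.2 = p).
Proof.
move=> [_ deg _ _ _] [e [f [eD fD ef V]]].
have ep : endpoint e p by case: V => -[<- _]; rewrite /endpoint eqxx ?orbT.
have pos (b : pred (segment R)) : (0 < count b (segs D))%N -> exists2 k, k \in segs D & b k.
  by rewrite -has_count => /hasP.
have [i0 o0] : (0 < indeg D p)%N /\ (0 < outdeg D p)%N.
  by have := deg e p eD ep; rewrite !inE => /or3P[] /eqP[-> ->].
by split; [have [k kD /eqP kp] := pos _ o0|have [k kD /eqP kp] := pos _ i0]; exists k.
Qed.

(** A picture identified with part of a diagram inherits its orientations: a segment
    of D which starts at h p has points just after h p, which come from points
    just after p, and a segment of P containing these must start at p as p is a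
    vertex. *)
Lemma same_near_y_oriented (h : plane R -> plane R) P (D : diagram R) :
  isotopic_to_id h -> (forall p, outer_disk p -> tame P p) ->
  (forall p, outer_disk p -> same_near h P D p) -> y_oriented P.
Proof.
move=> iso tP sn p Op Vp; have [hc [g [gc hK gK]]] := homeo_of_isotopy iso.
have [vV n] := sn p Op; have tp := tP p Op; have nd := let: And5 x _ _ _ _ := tp in x.
have ndD e : e \in segs D -> e.1 != e.2 by case: (diagramP D) => -[_ nd0] _ _ _ _; exact: nd0.
have {n}n : \forall q \near h p, [/\ before P p (g q) <-> before D (h p) q,
    before P (g q) p <-> before D q (h p) & True].
  have n1 : \forall q \near g (h p), [/\ before P p q <-> before D (h p) (h q),
     before P q p <-> before D (h q) (h p) & True].
    by rewrite hK; apply: filterS n => q [].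
  have n2 : \forall q \near h p, [/\ before P p (g q) <-> before D (h p) (h (g q)),
     before P (g q) p <-> before D (h (g q)) (h p) & True] := @gc (h p) _ n1.
  by apply: filterS n2 => q; rewrite gK.
have [[e eD ep] [f fD fp]] := vertex_degrees (diagramP D) (vV.1 Vp).
split.
  have on : on_segment e (h p) by rewrite -ep; apply: endpoint_on; rewrite /endpoint eqxx.
  have ne : h p != e.2 by rewrite -ep; exact: ndD.
  have [t /andP[t0 _] [[b1 _ _] [b2 _]]] :=
    near_ray_exists (dir e) ltr01 (filterI n (near_ebefore (ndD e eD) on)).
  have : before P p (g (ray_point (h p) (dir e) t)).
    apply/b1/beforeP; exists e => //; apply/b2; split => //.
    by rewrite ray_pointK on_ray_scale // dir_neq0 // ndD.
  move=> [k [s [r [kP s0 sr r1 [pE _]]]]]; exists k => //.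
  have onk : on_segment k p by exists s; rewrite s0 (le_trans (ltW sr)).
  have /orP[/eqP//|/eqP p2] := vertex_end tp Vp kP onk.
  have s1 : s = 1 by apply: (param_inj (nd k kP)); rewrite -pE param1.
  by move: sr; rewrite s1 ltNge r1.
have on : on_segment f (h p) by rewrite -fp; apply: endpoint_on; rewrite /endpoint eqxx orbT.
have ne : h p != f.1 by rewrite -fp eq_sym; exact: ndD.
have [t /andP[t0 _] [[_ b1 _] [_ b2]]] :=
  near_ray_exists (- dir f) ltr01 (filterI n (near_ebefore (ndD f fD) on)).
have : before P (g (ray_point (h p) (- dir f) t)) p.
  apply/b1/beforeP; exists f => //; apply/b2; split => //.
  by rewrite ray_pointK on_ray_scale // oppr_eq0 dir_neq0 // ndD.
move=> [k [s [r [kP s0 sr r1 [_ pE]]]]]; exists k => //.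
have onk : on_segment k p by exists r; rewrite r1 (le_trans s0 (ltW sr)).
have /orP[/eqP p2|/eqP//] := vertex_end tp Vp kP onk.
have s1 : r = 0 by apply: (param_inj (nd k kP)); rewrite -pE param0.
by move: sr; rewrite s1 ltNge s0.
Qed.

(** So for the invariance under a move it suffices to consider the orientations of
    its pictures for which all vertices are Y-oriented. *)
Lemma move_card X (N : niebrzydowski_algebra X) (M : seq (polyline R) -> seq (polyline R) -> Prop)
    (D D' : diagram R) :
  (forall L L', M L L' ->
     (forall p, outer_disk p -> tame (picture L) p) /\
     (forall p, outer_disk p -> tame (picture L') p)) ->
  (forall L L', M L L' -> y_oriented (picture L) -> y_oriented (picture L') ->
     extends N (picture L) (picture L') /\ extends N (picture L') (picture L)) ->
  replacement M D D' -> colorings N D #= colorings N D'.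
Proof.
move=> tM eM rM; have [L [L' [h [ML iso sn out]]]] := rM.
have [t t'] := tM _ _ ML.
have y := same_near_y_oriented iso t (fun p Op => (sn p Op).1).
have y' := same_near_y_oriented iso t' (fun p Op => (sn p Op).2).
have [e1 e2] := eM _ _ ML y y'.
apply: (@replacement_card R X N (fun K K' => K = L /\ K' = L')).
  by move=> _ _ [-> ->]; split => // p Op; split; [exact: t|exact: t'].
by exists L, L', h.
Qed.

End YOriented.

(** * Systems of affine inequalities with integer coefficients *)

Notation zpt := (Z * Z)%type.
Notation zseg := (zpt * zpt)%type.

(** The affine form [k.1.1 * x + k.1.2 * y + k.2]. *)
Definition aff := (Z * Z * Z)%type.
(** The affine form is required to be positive if the boolean is true, and
    nonnegative otherwise. *)
Definition constraint := (aff * bool)%type.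

Definition aff_add (k l : aff) : aff := (k.1.1 + l.1.1, k.1.2 + l.1.2, k.2 + l.2).
Definition aff_scale (t : Z) (k : aff) : aff := (t * k.1.1, t * k.1.2, t * k.2).

(** One step of Fourier-Motzkin elimination: the combinations of each form with a
    positive coefficient and each form with a negative one in which the variable
    disappears. *)
Definition eliminate (co : aff -> Z) (ks : seq constraint) : seq constraint :=
  [seq k <- ks | co k.1 == 0] ++
  flatten [seq [seq (aff_add (aff_scale (- co n.1)%R p.1) (aff_scale (co p.1) n.1),
         p.2 || n.2) | n <- ks & co n.1 < 0] | p <- ks & 0 < co p.1].

Definition absurd_constraint (k : constraint) : bool :=
  [&& k.1.1.1 == 0, k.1.1.2 == 0 & if k.2 then k.1.2 <= 0 else k.1.2 < 0].

(** After both variables are eliminated, a contradiction is a constant constraint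
    that is violated.  Disjointness and coverings of polygons are reduced to such
    contradictions. *)
Definition infeasible (ks : seq constraint) : bool :=
  has absurd_constraint
    (eliminate (fun k => k.1.1) (eliminate (fun k => k.1.2) ks)).

Definition negate (k : constraint) : constraint := (aff_scale (- 1)%R k.1, ~~ k.2).

Definition strict (ks : seq aff) : seq constraint := [seq (k, true) | k <- ks].

(** The points satisfying ctx but not ks, sorted by the first constraint of ks that
    they violate; empty pieces are discarded. *)
Fixpoint branches (ctx ks : seq constraint) : seq (seq constraint) :=
  if ks is k :: ks' then
    if infeasible (negate k :: ctx) then branches ctx ks'
    else (negate k :: ctx) ::
         (if infeasible (k :: ctx) then [::] else branches (k :: ctx) ks')
  else [::].

(** The polygon ctx is the union of the pieces ps: remove the pieces one by one, the
    rest being a union of convex sets. *)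
Fixpoint covered (ctx : seq constraint) (ps : seq (seq constraint)) : bool :=
  infeasible ctx ||
  if ps is p :: ps' then all (fun c => covered c ps') (branches ctx p) else false.

Section Constraints.
Variable R : realType.
Implicit Types (u v w p q : plane R).

Definition zr (z : Z) : R := (int_of_Z z)%:~R.

Lemma zrD x y : zr (x + y)%R = zr x + zr y.
Proof. by rewrite /zr rmorphD rmorphD. Qed.
Lemma zrM x y : zr (x * y)%R = zr x * zr y.
Proof. by rewrite /zr rmorphM rmorphM. Qed.
Lemma zrN x : zr (- x)%R = - zr x.
Proof. by rewrite /zr rmorphN rmorphN. Qed.
Lemma zrB x y : zr (x - y)%R = zr x - zr y.
Proof. by rewrite zrD zrN. Qed.
Lemma zr0 : zr 0%R = 0. Proof. by []. Qed.
Lemma zr1 : zr 1%R = 1. Proof. by []. Qed.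
Lemma zr_gt0 x : (0 < zr x) = (0 < x).
Proof. by rewrite /zr ltr0z; case: x => [|p|p] //=; have := Pos2Nat.is_pos p; case: Pos.to_nat => // h; inversion h. Qed.
Lemma zr_inj : injective zr.
Proof. by move=> x y /mulrIz; rewrite /zr; move/(_ (oner_neq0 R))/(can_inj int_of_ZK). Qed.
Lemma zr_lt0 x : (zr x < 0) = (x < 0).
Proof. by rewrite -oppr_gt0 -zrN zr_gt0 oppr_gt0. Qed.
Lemma zr_ge0 x : (0 <= zr x) = (0 <= x).
Proof. by rewrite !leNgt zr_lt0. Qed.
Lemma zr_eq0 x : (zr x == 0) = (x == 0).
Proof. by rewrite -zr0 (inj_eq zr_inj). Qed.

Definition linear (k : aff) u : R := zr k.1.1 * u.1 + zr k.1.2 * u.2.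
Definition value (k : aff) q : R := linear k q + zr k.2.
Definition holds q (k : constraint) : bool :=
  if k.2 then 0 < value k.1 q else 0 <= value k.1 q.
Definition sat (ks : seq constraint) q : bool := all (holds q) ks.

Lemma value_add k l q : value (aff_add k l) q = value k q + value l q.
Proof. by rewrite /value /linear /aff_add /= !zrD; ring. Qed.

Lemma value_scale t k q : value (aff_scale t k) q = zr t * value k q.
Proof. by rewrite /value /linear /aff_scale /= !zrM; ring. Qed.

Lemma holds_ge0 q k : holds q k -> 0 <= value k.1 q.
Proof. by rewrite /holds; case: k.2 => // /ltW. Qed.

Lemma sat_eliminate co ks q : sat ks q -> sat (eliminate co ks) q.
Proof.
move=> /allP h; rewrite /sat all_cat; apply/andP; split.
  by apply/allP => k; rewrite mem_filter => /andP[_ /h].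
apply/allP => k /flatten_mapP[p].
rewrite mem_filter => /andP[p0 /h hp] /mapP[n]; rewrite mem_filter => /andP[n0 /h hn] ->.
rewrite /holds /= value_add !value_scale.
have a0 : 0 < zr (- co n.1)%R by rewrite zr_gt0 oppr_gt0.
have b0 : 0 < zr (co p.1) by rewrite zr_gt0.
have p1 := mulr_ge0 (ltW a0) (holds_ge0 hp); have n1 := mulr_ge0 (ltW b0) (holds_ge0 hn).
move: hp hn; rewrite /holds; case: p.2 => hp hn /=.
  by rewrite ltr_wpDr // mulr_gt0.
by move: hn; case: n.2 => hn; rewrite ?addr_ge0 // ltr_wpDl // mulr_gt0.
Qed.

Lemma infeasibleP q ks : infeasible ks -> ~~ sat ks q.
Proof.
move=> /hasP[[[[a b] c] s] kin] /and3P[/= /eqP a0 /eqP b0 kc]; apply/negP => h.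
move/allP: (sat_eliminate (fun k => k.1.1) (sat_eliminate (fun k => k.1.2) h)) => /(_ _ kin).
rewrite /holds /value /linear /= a0 b0 zr0 !mul0r !add0r.
case: s kc {kin} => kc; first by rewrite zr_gt0 ltNge kc.
by rewrite zr_ge0 leNgt kc.
Qed.

Lemma holds_negate q k : holds q (negate k) = ~~ holds q k.
Proof.
rewrite /holds /negate /= value_scale zrN zr1 mulN1r oppr_ge0 oppr_gt0.
by case: k.2 => /=; rewrite -?leNgt -?ltNge.
Qed.

Lemma branchesP ctx ks q : sat ctx q -> ~~ sat ks q ->
  exists2 c, c \in branches ctx ks & sat c q.
Proof.
elim: ks ctx => //= k ks IH ctx sc; rewrite negb_and => /orP[nk|nks].
  have sn : sat (negate k :: ctx) q by rewrite /= holds_negate nk.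
  case: ifP => [/(infeasibleP q)|_]; first by rewrite sn.
  by exists (negate k :: ctx) => //; rewrite inE eqxx.
have [hk|nk] := boolP (holds q k); last first.
  have sn : sat (negate k :: ctx) q by rewrite /= holds_negate nk.
  case: ifP => [/(infeasibleP q)|_]; first by rewrite sn.
  by exists (negate k :: ctx) => //; rewrite inE eqxx.
case: ifP => _; first exact: IH.
have sk : sat (k :: ctx) q by rewrite /= hk.
case: ifP => [/(infeasibleP q)|_]; first by rewrite sk.
by have [c cin sc'] := IH _ sk nks; exists c => //; rewrite inE cin orbT.
Qed.

Lemma coveredP ctx ps q : covered ctx ps -> sat ctx q -> exists2 p, p \in ps & sat p q.
Proof.
elim: ps ctx => [|p ps IH] ctx /= /orP[/(infeasibleP q)/negbTE->//|] //.
move=> /allP h sc; have [sp|np] := boolP (sat p q); first by exists p; rewrite ?inE ?eqxx.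
have [c /h cov scq] := branchesP sc np.
by have [p' p'in sp'] := IH c cov scq; exists p' => //; rewrite inE p'in orbT.
Qed.

Lemma value_shift k p w t : value k (shift p w t) = value k p + t * linear k w.
Proof. by rewrite /value /linear /=; ring. Qed.

Lemma near_value_gt0 k p : 0 < value k p -> \forall q \near p, 0 < value k q.
Proof.
move=> k0; pose a := zr k.1.1; pose b := zr k.1.2.
have M0 : 0 < `|a| + `|b| + 1 by rewrite ltr_wpDl // addr_ge0.
apply/near_boxP; exists (value k p / (`|a| + `|b| + 1)); first exact: divr_gt0.
move=> q []; rewrite !ltr_pdivlMr // => h1 h2.
have -> : value k q = value k p + (a * (q.1 - p.1) + b * (q.2 - p.2)).
  by rewrite /value /linear /a /b; ring.
have n1 : `|a * (q.1 - p.1)| <= `|a| * Num.max `|q.1 - p.1| `|q.2 - p.2|.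
  by rewrite normrM ler_wpM2l // le_max lexx.
have n2 : `|b * (q.2 - p.2)| <= `|b| * Num.max `|q.1 - p.1| `|q.2 - p.2|.
  by rewrite normrM ler_wpM2l // le_max lexx orbT.
have n3 : Num.max `|q.1 - p.1| `|q.2 - p.2| * (`|a| + `|b| + 1) < value k p.
  by rewrite maxElt; case: ifP.
have m0 : 0 <= Num.max `|q.1 - p.1| `|q.2 - p.2| by rewrite le_max normr_ge0.
move: n1 n2 n3 m0; set m := Num.max _ _; rewrite !ler_norml => /andP[n1 _] /andP[n2 _] n3 m0.
move: n3; rewrite mulrC mulrDl mul1r mulrDl => n3; lra.
Qed.

Lemma near_sat ks p : sat (strict ks) p -> \forall q \near p, sat (strict ks) q.
Proof.
elim: ks => [|k ks IH] /=; first by move=> _; apply: filterE.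
move=> /andP[h /IH n]; apply: filterS (filterI (near_value_gt0 h) n) => q [a b].
by rewrite /holds /= a.
Qed.

End Constraints.

(** * Pictures with integral vertices *)

Definition zopp (u : zpt) : zpt := (- u.1, - u.2).
Definition zsub (u v : zpt) : zpt := (u.1 - v.1, u.2 - v.2).
Definition zdet (u v : zpt) : Z := u.1 * v.2 - u.2 * v.1.
Definition zdot (u v : zpt) : Z := u.1 * v.1 + u.2 * v.2.
Definition zccw (u v w : zpt) : bool :=
  [|| (0 < zdet u v) && (0 < zdet v w),
      (0 < zdet v w) && (0 < zdet w u) |
      (0 < zdet w u) && (0 < zdet u v)].
Definition zdir (e : zseg) : zpt := zsub e.2 e.1.

Definition zchain (l : seq zpt) : seq zseg := zip l (behead l).
Definition zsegs (L : seq (seq zpt)) : seq zseg := flatten [seq zchain l | l <- L].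
Definition zlevel (L : seq (seq zpt)) (e : zseg) : nat := find (fun l => e \in zchain l) L.
Definition zendpoint (e : zseg) (p : zpt) : bool := (p == e.1) || (p == e.2).

(** The sign of [zside e x] is the side of the line of e on which x lies, and
    [zproj e x] is the position of x along e. *)
Definition zside (e : zseg) (x : zpt) : Z := zdet (zdir e) (zsub x e.1).
Definition zproj (e : zseg) (x : zpt) : Z := zdot (zdir e) (zsub x e.1).

Definition zbeyond (e f : zseg) : bool :=
  ((zproj e f.1 < 0) && (zproj e f.2 < 0)) ||
  ((zdot (zdir e) (zdir e) < zproj e f.1) && (zdot (zdir e) (zdir e) < zproj e f.2)).

(** Three ways to be disjoint which suffice for the pictures of the moves: one
    segment is on one side of the line of the other, or beyond one of its ends. *)
Definition zdisjoint (e f : zseg) : bool :=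
  [|| 0 < zside e f.1 * zside e f.2, 0 < zside f e.1 * zside f e.2 | zbeyond e f].

Definition zcross (e f : zseg) : bool :=
  (zside e f.1 * zside e f.2 < 0) && (zside f e.1 * zside f e.2 < 0).

Definition zshare (e f : zseg) : bool := zendpoint f e.1 || zendpoint f e.2.

Definition zmeet (e f : zseg) : bool :=
  zdisjoint e f || (zdet (zdir e) (zdir f) != 0) && (zshare e f || zcross e f).

(** The segment as a convex polygon: on its line, and between its ends. *)
Definition zon (e : zseg) : seq constraint :=
  let d := zdir e in
  let side : aff := (- d.2, d.1, d.2 * e.1.1 - d.1 * e.1.2) in
  let proj : aff := (d.1, d.2, - (d.1 * e.1.1 + d.2 * e.1.2)) in
  [:: (side, false); (aff_scale (- 1)%R side, false); (proj, false);
      (aff_add (0, 0, zdot d d) (aff_scale (- 1)%R proj), false)].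

(** A sufficient condition for [tame] at all points that can be computed. *)
Definition ztame (L : seq (seq zpt)) : bool :=
  let S := zsegs L in
  [&& uniq S, all (fun e => e.1 != e.2) S,
      all (fun e => all (fun f => (e == f) ||
        [&& zmeet e f, zcross e f ==> (zlevel L e != zlevel L f) &
            zcross e f ==> all (fun g => [|| g == e, g == f |
               infeasible (zon e ++ zon f ++ zon g)]) S]) S) S &
      all (fun e => all (fun f => [|| e == f |
        ((e.1 == f.1) ==> (count (zendpoint^~ e.1) S == 3%N)) &&
        ((e.2 == f.2) ==> (count (zendpoint^~ e.2) S == 3%N))]) S) S].

Section Embedding.
Variable R : realType.
Implicit Types (u v w : zpt) (e f : zseg) (p q : plane R).
Local Notation zr := (zr R).

Definition emb u : plane R := (zr u.1, zr u.2).
Definition embs e : segment R := (emb e.1, emb e.2).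
Definition embl (L : seq (seq zpt)) : seq (polyline R) := [seq [seq emb u | u <- l] | l <- L].

Lemma emb_inj : injective emb.
Proof. by move=> [a b] [c d] [/zr_inj-> /zr_inj->]. Qed.

Lemma embs_inj : injective embs.
Proof. by move=> [a b] [c d] [/zr_inj h1 /zr_inj h2 /zr_inj h3 /zr_inj h4]; rewrite [a]surjective_pairing h1 h2 -surjective_pairing [b]surjective_pairing h3 h4 -surjective_pairing. Qed.

Lemma emb_sub u v : emb u - emb v = emb (zsub u v).
Proof. by rewrite /emb !zrB. Qed.

Lemma emb_opp u : - emb u = emb (zopp u).
Proof. by rewrite /emb !zrN. Qed.

Lemma det2_emb u v : det2 (emb u) (emb v) = zr (zdet u v).
Proof. by rewrite /det2 /zdet zrB !zrM. Qed.

Lemma dot_emb u v : dot (emb u) (emb v) = zr (zdot u v).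
Proof. by rewrite /dot /zdot zrD !zrM. Qed.

Lemma ccw_emb u v w : ccw (emb u) (emb v) (emb w) = zccw u v w.
Proof. by rewrite /ccw !det2_emb !zr_gt0. Qed.

Lemma dir_embs e : dir (embs e) = emb (zdir e).
Proof. exact: emb_sub. Qed.

Lemma side_emb e u : det2 (dir (embs e)) (emb u - (embs e).1) = zr (zside e u).
Proof. by rewrite dir_embs emb_sub det2_emb. Qed.

Lemma proj_emb e u : dot (dir (embs e)) (emb u - (embs e).1) = zr (zproj e u).
Proof. by rewrite dir_embs emb_sub dot_emb. Qed.

Lemma embs_neq e : ((embs e).1 != (embs e).2) = (e.1 != e.2).
Proof. by rewrite (inj_eq emb_inj). Qed.

Lemma endpoint_emb e u : endpoint (embs e) (emb u) = zendpoint e u.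
Proof. by rewrite /endpoint !(inj_eq emb_inj). Qed.

Lemma chain_emb l : chain [seq emb u | u <- l] = [seq embs e | e <- zchain l].
Proof.
rewrite /chain /zchain; case: l => //= a l.
by elim: l a => //= b l IH a; rewrite IH.
Qed.

Lemma segs_emb L : segs (picture (embl L)) = [seq embs e | e <- zsegs L].
Proof.
rewrite /= /zsegs map_flatten -!map_comp; congr flatten; apply: eq_map => l /=.
exact: chain_emb.
Qed.

Lemma segs_embP L (e : segment R) : e \in segs (picture (embl L)) <->
  exists2 e', e' \in zsegs L & e = embs e'.
Proof. by rewrite segs_emb; split=> [/mapP|h]; last exact/mapP. Qed.

Lemma over_emb L e f :
  over (picture (embl L)) (embs e) (embs f) = (zlevel L e < zlevel L f)%N.
Proof.
have lE k : find (fun l => embs k \in chain l) (embl L) = zlevel L k.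
  rewrite /zlevel /embl find_map; apply: eq_find => l /=.
  by rewrite chain_emb (mem_map embs_inj).
by rewrite /= !lE.
Qed.

Lemma sat_cat a b q : sat (a ++ b) q = sat a q && sat b q.
Proof. exact: all_cat. Qed.

Lemma zonP e q : e.1 != e.2 -> on_segment (embs e) q <-> sat (zon e) q.
Proof.
move=> ne; have ne' : (embs e).1 != (embs e).2 by rewrite embs_neq.
rewrite (on_segmentP _ ne') dir_embs /sat /zon /=.
set a : aff := (_, _, _); set b : aff := (_, _, _).
have -> : det2 (emb (zdir e)) (q - emb e.1) = value a q.
  by rewrite /value /linear /a /= /det2 /= !(zrN, zrD, zrM); ring.
have -> : dot (emb (zdir e)) (q - emb e.1) = value b q.
  by rewrite /value /linear /b /= /dot /= !(zrN, zrD, zrM); ring.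
rewrite /holds /= value_add !value_scale dot_emb zrN zr1 !mulN1r andbT oppr_ge0 subr_ge0.
have -> : value (0%R, 0%R, zdot (zdir e) (zdir e)) q = zr (zdot (zdir e) (zdir e)).
  by rewrite /value /linear /= zr0; ring.
split=> [[-> -> ->]|/and4P[h1 h2 h3 h4]]; first by rewrite lexx.
by split => //; apply/eqP; rewrite eq_le h1 h2.
Qed.

Lemma side_convex (e : segment R) (f : segment R) t :
  det2 (dir e) (param f t - e.1) =
  (1 - t) * det2 (dir e) (f.1 - e.1) + t * det2 (dir e) (f.2 - e.1).
Proof. by rewrite /param /shift /dir /det2 /=; ring. Qed.

Lemma proj_convex (e : segment R) (f : segment R) t :
  dot (dir e) (param f t - e.1) =
  (1 - t) * dot (dir e) (f.1 - e.1) + t * dot (dir e) (f.2 - e.1).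
Proof. by rewrite /param /shift /dir /dot /=; ring. Qed.

Lemma mix_gt0 (a b t : R) : 0 <= t <= 1 -> 0 < a -> 0 < b -> 0 < (1 - t) * a + t * b.
Proof.
move=> /andP[t0 t1] a0 b0; have [->|tn] := eqVneq t 0; first by rewrite subr0 mul1r mul0r addr0.
rewrite ltr_wpDl ?mulr_ge0 ?subr_ge0 ?(ltW a0) // mulr_gt0 // lt_neqAle t0 eq_sym tn //.
Qed.

Lemma same_side (a b t : R) : 0 <= t <= 1 -> 0 < a * b -> (1 - t) * a + t * b != 0.
Proof.
move=> t01; have [a0|a0|->] := ltgtP a 0; last by rewrite mul0r ltxx.
  rewrite nmulr_rgt0 // => b0; rewrite -oppr_eq0 opprD -!mulrN gt_eqF // mix_gt0 ?oppr_gt0 //.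
by rewrite pmulr_rgt0 // => b0; rewrite gt_eqF // mix_gt0.
Qed.

Lemma zdisjointP e f q : e.1 != e.2 -> f.1 != f.2 -> zdisjoint e f ->
  on_segment (embs e) q -> on_segment (embs f) q -> False.
Proof.
move=> ne nf zd one onf.
have ne' : (embs e).1 != (embs e).2 by rewrite embs_neq.
have nf' : (embs f).1 != (embs f).2 by rewrite embs_neq.
have [he he1 he2] := (on_segmentP _ ne').1 one.
have [hf _ _] := (on_segmentP _ nf').1 onf.
have [s [s01 qe]] := one; have [t [t01 qf]] := onf.
case/or3P: zd => zd.
- move: he; rewrite qf side_convex !side_emb => /eqP; apply/negP; apply: same_side => //.
  by rewrite -zrM zr_gt0.
- move: hf; rewrite qe side_convex !side_emb => /eqP; apply/negP; apply: same_side => //.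
  by rewrite -zrM zr_gt0.
- have dd : dot (dir (embs e)) (dir (embs e)) = zr (zdot (zdir e) (zdir e)) by rewrite dir_embs dot_emb.
  move: he1 he2; rewrite dd qf proj_convex !proj_emb.
  case/orP: zd => /andP[z1 z2].
    rewrite leNgt => /negP h _; apply: h; rewrite -oppr_gt0 opprD -!mulrN mix_gt0 //.
      by rewrite oppr_gt0 zr_lt0.
    by rewrite oppr_gt0 zr_lt0.
  move=> _; rewrite leNgt => /negP; apply; rewrite -subr_gt0.
  set d := zr (zdot _ _); rewrite (_ : _ - d = (1 - t) * (zr (zproj e f.1) - d) + t * (zr (zproj e f.2) - d)).
    by apply: mix_gt0 => //; rewrite subr_gt0 -subr_gt0 -zrB zr_gt0 subr_gt0.
  by ring.
Qed.

Lemma two_lines (u v x y : plane R) : det2 u v != 0 -> det2 u (x - y) = 0 ->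
  det2 v (x - y) = 0 -> x = y.
Proof.
move=> d h1 h2; apply/eqP; rewrite -subr_eq0; apply/eqP.
have e1 : det2 u v * (x - y).1 = 0.
  rewrite (_ : _ * _ = v.1 * det2 u (x - y) - u.1 * det2 v (x - y)); last by rewrite /det2; ring.
  by rewrite h1 h2; ring.
have e2 : det2 u v * (x - y).2 = 0.
  rewrite (_ : _ * _ = v.2 * det2 u (x - y) - u.2 * det2 v (x - y)); last by rewrite /det2; ring.
  by rewrite h1 h2; ring.
move/eqP: e1; rewrite mulf_eq0 (negbTE d) /= => /eqP e1.
move/eqP: e2; rewrite mulf_eq0 (negbTE d) /= => /eqP e2.
by rewrite [LHS]surjective_pairing; congr (_, _).
Qed.

Lemma on_line (e : segment R) q : on_segment e q -> det2 (dir e) (q - e.1) = 0.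
Proof. by move=> [t [_ ->]]; rewrite paramE /det2 /=; ring. Qed.

Lemma endpoint_line (e : segment R) q : endpoint e q -> det2 (dir e) (q - e.1) = 0.
Proof. by move/endpoint_on/on_line. Qed.

Lemma det2_diff (u x y z : plane R) : det2 u (x - z) = 0 -> det2 u (y - z) = 0 ->
  det2 u (x - y) = 0.
Proof. 
move=> h1 h2; rewrite (_ : det2 u (x - y) = det2 u (x - z) - det2 u (y - z)); last first.
  by rewrite /det2 /=; ring.
by rewrite h1 h2 subr0.
Qed.

(** Two transversal lines meet in a single point, which is the common endpoint or
    the crossing. *)
Lemma zmeetP e f q : e.1 != e.2 -> f.1 != f.2 -> zmeet e f ->
  on_segment (embs e) q -> on_segment (embs f) q ->
  zdet (zdir e) (zdir f) != 0 /\
  ((endpoint (embs e) q /\ endpoint (embs f) q) \/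
   [/\ inner (embs e) q, inner (embs f) q & zcross e f]).
Proof.
move=> ne nf /orP[zd|/andP[d sc]] one onf; first by case: (zdisjointP ne nf zd one onf).
split => //.
have d' : det2 (dir (embs e)) (dir (embs f)) != 0 by rewrite !dir_embs det2_emb zr_eq0.
have le := on_line one; have lf := on_line onf.
case/orP: sc => [sh|cr].
  left; have [u [ue uf]] : exists u, zendpoint e u /\ zendpoint f u.
    by case/orP: sh => h; [exists e.1|exists e.2]; rewrite h /zendpoint eqxx ?orbT.
  have -> : q = emb u; last by rewrite !endpoint_emb.
  apply: (two_lines d'); [apply: (det2_diff le)|apply: (det2_diff lf)];
    by apply: endpoint_line; rewrite endpoint_emb.
right; case/andP: (cr) => c1 c2.
have nend g h : zside g h.1 * zside g h.2 < 0 -> on_segment (embs g) q ->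
    on_segment (embs h) q -> inner (embs h) q.
  move=> c og /inner_or_endpoint[//|]; have := on_line og => l /orP[]/eqP qE.
    move: l; rewrite qE side_emb => /eqP; rewrite zr_eq0 => /eqP z.
    by rewrite z mul0r ltxx in c.
  move: l; rewrite qE side_emb => /eqP; rewrite zr_eq0 => /eqP z.
  by rewrite z mulr0 ltxx in c.
by split => //; [exact: nend c2 onf one|exact: nend c1 one onf].
Qed.

Lemma ztameP L p : ztame L -> tame (picture (embl L)) p.
Proof.
set S := zsegs L => /and4P[us /allP nd /allP pr /allP vx].
have meet e f : e \in S -> f \in S -> e != f -> zmeet e f.
  by move=> /pr/allP h /h; case: eqP => //= _ /and3P[].
split.
- by move=> _ /segs_embP[e eS ->]; rewrite embs_neq; exact: nd.
- move=> _ _ /segs_embP[e eS ->] /segs_embP[f fS ->]; rewrite (inj_eq embs_inj) => ef one onf.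
  have [d [[ee fe]|[ie if_ _]]] := zmeetP (nd e eS) (nd f fS) (meet e f eS fS ef) one onf.
    left; split => //; apply/negP => /andP[/eqP h _]; case/eqP: d.
    apply/eqP; rewrite -(zr_eq0 R) -det2_emb -!dir_embs; move: h.
    by case: (outdirE (embs e) p) => ->; case: (outdirE (embs f) p) => ->;
      rewrite ?det2Nl ?det2Nr ?opprK => /eqP; rewrite ?oppr_eq0.
  by right; split => //; rewrite !dir_embs det2_emb zr_eq0.
- move=> _ _ _ /segs_embP[e eS ->] /segs_embP[f fS ->] /segs_embP[g gS ->].
  rewrite /= !inE !(inj_eq embs_inj) negb_or => /and3P[/andP[ef eg] fg _] [ie if_ ig].
  have [oe of_ og] := And3 (inner_on ie) (inner_on if_) (inner_on ig).
  have [_ [[ee _]|[_ _ c]]] := zmeetP (nd e eS) (nd f fS) (meet e f eS fS ef) oe of_.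
    have ne' : (embs e).1 != (embs e).2 by rewrite embs_neq; exact: nd.
    by have := inner_endpoint ne' ie; rewrite ee.
  have := allP (pr e eS) f fS; rewrite (negbTE ef) c orFb !implyTb => /and3P[_ _ /allP/(_ g gS)].
  rewrite eq_sym (negbTE eg) eq_sym (negbTE fg) !orFb => /(infeasibleP p)/negP; apply.
  by rewrite !sat_cat; apply/and3P; split; apply/zonP => //; exact: nd.
- move=> _ _ /segs_embP[e eS ->] /segs_embP[f fS ->]; rewrite (inj_eq embs_inj) => ef ie if_.
  have [oe of_] := conj (inner_on ie) (inner_on if_).
  have [_ [[ee _]|[_ _ c]]] := zmeetP (nd e eS) (nd f fS) (meet e f eS fS ef) oe of_.
    have ne' : (embs e).1 != (embs e).2 by rewrite embs_neq; exact: nd.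
    by have := inner_endpoint ne' ie; rewrite ee.
  have := allP (pr e eS) f fS; rewrite (negbTE ef) c /= => /and3P[_ lv _].
  have [h1 h2] := conj (over_emb L e f) (over_emb L f e).
  by rewrite /= in h1 h2; rewrite h1 h2; case: ltngtP lv.
- move=> [_ [_ [/segs_embP[e eS ->] /segs_embP[f fS ->]]]]; rewrite (inj_eq embs_inj) => ef V.
  have [u pu c3] : exists2 u, p = emb u & count (zendpoint^~ u) S = 3%N.
    have := allP (vx e eS) f fS; rewrite (negbTE ef) /= => /andP[v1 v2].
    case: V => -[e1 e2].
      exists e.1 => //; apply/eqP; apply: (implyP v1).
      by rewrite -(inj_eq emb_inj); apply/eqP; rewrite [LHS]e1.
    exists e.2 => //; apply/eqP; apply: (implyP v2).
    by rewrite -(inj_eq emb_inj); apply/eqP; rewrite [LHS]e1.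
  have uf : uniq [seq e <- S | zendpoint e u] by rewrite filter_uniq.
  have h k : (k \in [seq e <- S | zendpoint e u]) = zendpoint k u && (k \in S).
    by rewrite mem_filter.
  move: c3 uf h; rewrite -size_filter; case: [seq _ <- _ | _] => [|a [|b [|c []]]] // _ uf h.
  exists (embs a), (embs b), (embs c); split.
    by rewrite -[[:: _; _; _]]/(map embs [:: a; b; c]) map_inj_uniq //; exact: embs_inj.
  move=> k; rewrite -[[:: _; _; _]]/(map embs [:: a; b; c]).
  apply/idP/mapP => [/andP[/segs_embP[k' kS ->]]|[k' k'in ->]].
    by rewrite pu endpoint_emb => ku; exists k' => //; rewrite h ku kS.
  move: k'in; rewrite h => /andP[ku kS]; rewrite pu endpoint_emb ku andbT.
  by apply/segs_embP; exists k'.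
Qed.

End Embedding.

(** * Regions as unions of convex cells *)

(** An open convex cell, and the label of the region that contains it. *)
Definition cell := (nat * seq aff)%type.
(** Homogeneous coordinates, the last one being positive: crossings and points in
    the cells are rational. *)
Definition hpt := (Z * Z * Z)%type.

Section Frame.
Local Open Scope Z_scope.
(** The outer disk, and the four half planes whose union is the complement of the
    inner disk. *)
Definition zouter : seq aff := [:: (1, 0, 3); (-1, 0, 3); (0, 1, 3); (0, -1, 3)].
Definition zpieces : seq aff := [:: (1, 0, -2); (-1, 0, -2); (0, 1, -2); (0, -1, -2)].
End Frame.

Definition body (k : cell) : seq aff := zouter ++ k.2.

Definition zlinear (k : aff) (u : zpt) : Z := k.1.1 * u.1 + k.1.2 * u.2.
Definition zvalue (k : aff) (h : hpt) : Z := k.1.1 * h.1.1 + k.1.2 * h.1.2 + k.2 * h.2.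
Definition zin (h : hpt) (ks : seq aff) : bool :=
  (0 < h.2) && all (fun k => 0 < zvalue k h) ks.

(** Each cell shares a point of ws with an earlier cell of the same label, if there is
    one, so that the cells with a given label have a connected union. *)
Fixpoint linked (acc cs : seq cell) (ws : seq hpt) : bool :=
  if cs is k :: cs' then
    has (fun w => zin w (body k) &&
      (all (fun l => l.1 != k.1) acc ||
       has (fun l => (l.1 == k.1) && zin w l.2) acc)) ws && linked (k :: acc) cs' ws
  else true.

(** The cells are certified to describe the regions of the disk cut out by the
    segments S: they are disjoint from S, cells with different labels are
    disjoint, cells and segments cover the disk, and the cells with a given label
    have a connected union.  Hence a color for each label defines a coloring, by
    [paints_exists], and every coloring arises in this way, by [off_paints]. *)
Definition geometry (S : seq zseg) (cs : seq cell) (ws : seq hpt) : bool :=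
  [&& cs != [::],
      all (fun e => e.1 != e.2) S,
      all (fun k => all (fun e => infeasible (strict (body k) ++ zon e)) S) cs,
      all (fun k => all (fun l => (k.1 == l.1) ||
        infeasible (strict (body k) ++ strict l.2)) cs) cs,
      covered (strict zouter) ([seq strict k.2 | k <- cs] ++ [seq zon e | e <- S]) &
      linked [::] cs ws].

(** The points p + t w, for w in the open sector from u to v and small t, satisfy the
    constraint k, where h is the point p: either k is positive at p, or it
    vanishes there and increases throughout the sector. *)
Definition germ1 (h : hpt) (u v : zpt) (k : aff) : bool :=
  (0 < zvalue k h) ||
  [&& zvalue k h == 0, 0 <= zlinear k u, 0 <= zlinear k v &
      (0 < zlinear k u) || (0 < zlinear k v)].

(** The label of the region that occupies the sector from u to v at the point h.
    Only sectors of less than half a turn occur in the pictures of the moves;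
    they are positive combinations of u and v. *)
Definition zlabel (cs : seq cell) (h : hpt) (u v : zpt) : option nat :=
  if 0 < zdet u v then omap fst (ohead [seq k <- cs | all (germ1 h u v) k.2]) else None.

(** The equations that a coloring of a picture must satisfy, in terms of the labels
    of its regions. *)
Inductive condition :=
| CrossCond of nat & nat & nat & nat
| VertexCond of nat & nat & nat.

Definition satisfies X (N : niebrzydowski_algebra X) (col : nat -> X) c : Prop :=
  match c with
  | CrossCond n w s e => col n = N (col w) (col s) (col e)
  | VertexCond m w e => nmul N (col w) (col e) = Some (col m)
  end.

(** By Cramer's rule, with the denominator squared to make it positive. *)
Definition zcrosspt (e f : zseg) : hpt :=
  let d := zdet (zdir e) (zdir f) in
  let s := zdet (zdir f) (zsub e.1 f.1) in
  (d * (e.1.1 * d + (zdir e).1 * s), d * (e.1.2 * d + (zdir e).2 * s), d * d).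

Definition cross_cond (cs : seq cell) (e f : zseg) : option condition :=
  let h := zcrosspt e f in
  let pos := 0 < zdet (zdir e) (zdir f) in
  let u := if pos then zdir e else zdir f in
  let v := if pos then zdir f else zdir e in
  if zin h zouter then
    match zlabel cs h v (zopp u), zlabel cs h (zopp u) (zopp v),
          zlabel cs h (zopp v) u, zlabel cs h u v with
    | Some xW, Some xS, Some xE, Some xN =>
      Some (if pos then CrossCond xN xW xS xE else CrossCond xS xW xN xE)
    | _, _, _, _ => None
    end
  else None.

(** As for [labelled_ray], the boolean tells whether segments start or end at the
    vertex. *)
Definition zout (o : bool) (e : zseg) : zpt := if o then zdir e else zopp (zdir e).
Definition zend (o : bool) (e : zseg) : zpt := if o then e.1 else e.2.

Definition vertex_cond (cs : seq cell) (o : bool) (e0 e1 e2 : zseg) : option condition :=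
  let h := (zend o e1, 1) in
  let r0 := zout (~~ o) e0 in let r1 := zout o e1 in let r2 := zout o e2 in
  if zin h zouter then
    match zlabel cs h r0 r1, zlabel cs h r1 r2, zlabel cs h r2 r0 with
    | Some x0, Some xM, Some x1 =>
      Some (if o then VertexCond xM x1 x0 else VertexCond xM x0 x1)
    | _, _, _ => None
    end
  else None.

Definition crossings (L : seq (seq zpt)) : seq (zseg * zseg) :=
  [seq e <- [seq (e, f) | e <- zsegs L, f <- zsegs L] |
     (zlevel L e.1 < zlevel L e.2)%N && zcross e.1 e.2].

Definition vertices (L : seq (seq zpt)) (o : bool) : seq (zseg * zseg * zseg) :=
  [seq e <- [seq (e, f) | e <- [seq (e, f) | e <- zsegs L, f <- zsegs L], f <- zsegs L] |
     [&& zend (~~ o) e.1.1 == zend o e.1.2, zend o e.1.2 == zend o e.2 &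
         zccw (zout (~~ o) e.1.1) (zout o e.1.2) (zout o e.2)]].

Definition conditions (L : seq (seq zpt)) (cs : seq cell) : seq (option condition) :=
  [seq cross_cond cs e.1 e.2 | e <- crossings L] ++
  [seq vertex_cond cs true e.1.1 e.1.2 e.2 | e <- vertices L true] ++
  [seq vertex_cond cs false e.1.1 e.1.2 e.2 | e <- vertices L false].

Section Painting.
Variable R : realType.
Implicit Types (p q : plane R).
Local Notation zr := (zr R).
Local Notation emb := (emb R).
Local Notation embs := (embs R).

Lemma outerP q : outer_disk q <-> sat (strict zouter) q.
Proof.
rewrite /sat /= /holds /= /value /linear /=.
rewrite -[zr 1]/(1 : R) -[zr (-1)]/(- 1 : R) -[zr 0]/(0 : R) -[zr 3]/(3 : R).
rewrite !mul0r !addr0 !add0r !mul1r !mulN1r andbT /outer_disk /=.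
rewrite !ltr_norml; split; first by move=> [/andP[? ?] /andP[? ?]]; apply/and4P; split; lra.
by move=> /and4P[? ? ? ?]; split; apply/andP; split; lra.
Qed.

Lemma strict_cat a b : strict (a ++ b) = strict a ++ strict b.
Proof. exact: map_cat. Qed.

Lemma bodyP k q : sat (strict (body k)) q <-> outer_disk q /\ sat (strict k.2) q.
Proof.
rewrite /body strict_cat sat_cat; split=> [/andP[/outerP]//|[/outerP-> ->//]].
Qed.

Definition at_hpt (h : hpt) p : Prop :=
  [/\ 0 < h.2, zr h.1.1 = zr h.2 * p.1 & zr h.1.2 = zr h.2 * p.2].

Lemma at_hpt_exists h : 0 < h.2 -> exists p, at_hpt h p.
Proof.
move=> h0; have h0' : zr h.2 != 0 by rewrite gt_eqF // zr_gt0.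
by exists (zr h.1.1 / zr h.2, zr h.1.2 / zr h.2); split => //=; rewrite mulrC divfK.
Qed.

Lemma zvalueE k h p : at_hpt h p -> zr (zvalue k h) = zr h.2 * value k p.
Proof.
move=> [_ e1 e2]; rewrite /zvalue /value /linear !zrD !zrM e1 e2; ring.
Qed.

Lemma zvalue_gt0 k h p : at_hpt h p -> (0 < zvalue k h) = (0 < value k p).
Proof.
move=> a; have [h0 _ _] := a.
by rewrite -(zr_gt0 R) (zvalueE k a) pmulr_rgt0 // zr_gt0.
Qed.

Lemma zvalue_eq0 k h p : at_hpt h p -> (zvalue k h == 0) = (value k p == 0).
Proof.
move=> a; have [h0 _ _] := a.
by rewrite -(zr_eq0 R) (zvalueE k a) mulf_eq0 (gt_eqF (_ : 0 < zr h.2)) // zr_gt0.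
Qed.

Lemma zinP h ks p : at_hpt h p -> zin h ks = sat (strict ks) p.
Proof.
move=> a; have [h0 _ _] := a; rewrite /zin h0 /sat /strict all_map; apply: eq_all => k /=.
exact: zvalue_gt0.
Qed.

Lemma zlinearE k u : zr (zlinear k u) = linear k (emb u).
Proof. by rewrite /zlinear zrD !zrM. Qed.

Section Cells.
Variables (S : seq zseg) (cs : seq cell) (ws : seq hpt) (C : set (plane R)).
Hypothesis geo : geometry S cs ws.
Hypothesis CE : forall q, C q <-> exists2 e, e \in S & on_segment (embs e) q.
Variable X : Type.
Implicit Types (G : plane R -> option X) (col : nat -> X).

Lemma cell_off k q : k \in cs -> sat (strict (body k)) q -> ~ C q.
Proof.
move=> kcs sk /CE[e eS on]; have /and5P[_ /allP nd /allP/(_ k kcs)/allP/(_ e eS) inf _ _] := geo.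
have := infeasibleP q inf; rewrite sat_cat sk /= => /negP; apply.
by apply/zonP => //; exact: nd.
Qed.

Lemma cell_label k l q : k \in cs -> l \in cs -> sat (strict (body k)) q ->
  sat (strict (body l)) q -> k.1 = l.1.
Proof.
move=> kcs lcs sk /bodyP[_ sl].
have /and5P[_ _ _ /allP/(_ k kcs)/allP/(_ l lcs)/orP[/eqP//|inf] _] := geo.
by have := infeasibleP q inf; rewrite sat_cat sk sl.
Qed.

Lemma cell_cover q : outer_disk q -> ~ C q -> exists2 k, k \in cs & sat (strict (body k)) q.
Proof.
move=> Oq nC; have /and5P[_ /allP nd _ _ /andP[cov _]] := geo.
have [p] := coveredP cov ((outerP q).1 Oq).
rewrite mem_cat => /orP[/mapP[k kcs ->] sk|/mapP[e eS ->] se].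
  by exists k => //; apply/bodyP.
by case: nC; apply/CE; exists e => //; apply/zonP => //; exact: nd.
Qed.

Definition paints G col : Prop := forall q, outer_disk q ->
  (C q -> G q = None) /\
  forall k, k \in cs -> sat (strict (body k)) q -> G q = Some (col k.1).

Lemma paints_exists col : exists G, paints G col.
Proof.
have ch q : exists x : option X, outer_disk q -> (C q -> x = None) /\
   forall k, k \in cs -> sat (strict (body k)) q -> x = Some (col k.1).
  have [Oq|//] := pselect (outer_disk q); last by move=> n; exists None.
  have [Cq|nC] := pselect (C q).
    by exists None => _; split => // k kcs sk; case: (cell_off kcs sk Cq).
  have [k kcs sk] := cell_cover Oq nC; exists (Some (col k.1)) => _; split=> [//|l lcs sl].
  by rewrite (cell_label kcs lcs sk sl).
by exists (fun q => sval (cid (ch q))) => q Oq; case: cid => x /= h; exact: h.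
Qed.

Lemma paints_off G col q : paints G col -> outer_disk q -> colored_off C G q.
Proof.
move=> pG Oq; have [h1 h2] := pG q Oq; split.
  split=> [Gq|/h1//]; apply: contrapT => nC; have [k kcs sk] := cell_cover Oq nC.
  by rewrite (h2 k kcs sk) in Gq.
move=> nC; have [k kcs sk] := cell_cover Oq nC.
apply: filterS (near_sat sk) => q' sk'; rewrite (h2 k kcs sk).
by have [Oq' _] := (bodyP _ _).1 sk'; have [_ h] := pG q' Oq'; exact: h.
Qed.

Lemma sat_convex ks p q t : 0 <= t <= 1 -> sat (strict ks) p -> sat (strict ks) q ->
  sat (strict ks) (shift p (q - p) t).
Proof.
move=> t01; rewrite /sat /strict !all_map => /allP hp /allP hq; apply/allP => k kin.
rewrite /= /holds /= value_shift.
have -> : linear k (q - p) = value k q - value k p by rewrite /value /linear /=; ring.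
rewrite (_ : _ + _ = (1 - t) * value k p + t * value k q); last by ring.
by apply: mix_gt0 => //; [exact: hp k kin|exact: hq k kin].
Qed.

(** A cell is convex and disjoint from the carrier. *)
Lemma constant_on_cell G k p q : (forall q, outer_disk q -> colored_off C G q) ->
  k \in cs -> sat (strict (body k)) p -> sat (strict (body k)) q -> G q = G p.
Proof.
move=> off kcs sp sq.
pose f (t : R) := shift p (q - p) t.
have fc : {within `[0, 1]%classic, continuous f}.
  by apply: continuous_subspaceT => t; exact: continuous_ray_point.
have c : connected (f @` `[0, 1]%classic).
  by apply: connected_continuous_connected fc; exact: segment_connected.
have i t : (`[0, 1]%classic : set R) t -> sat (strict (body k)) (f t).
  move=> t01; apply: (sat_convex (ks := body k) _ sp sq).
  by move: t01; rewrite /= in_itv.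
apply: (@constant_on_connected R X [set q | ~ outer_disk q \/ C q] _ G _ _ c).
- move=> z /not_orP[/contrapT Oz nC].
  have [l lcs sl] := cell_cover Oz nC.
  apply: filterS (near_sat sl) => z' sl' /=.
  by case=> [|]; [case/bodyP: (sl') => Oz' _; exact|exact: cell_off lcs sl'].
- by move=> z /not_orP[/contrapT Oz nC]; have [_] := off z Oz; exact.
- move=> z [t t01 <-] [|]; first by case/bodyP: (i t t01) => Oz _; exact.
  exact: cell_off kcs (i t t01).
- exists 0; first by rewrite /= in_itv /= lexx ler01.
  by rewrite /f /shift !mul0r !addr0 -surjective_pairing.
- exists 1; first by rewrite /= in_itv /= lexx ler01.
  by rewrite /f /shift !mul1r; rewrite [RHS]surjective_pairing; congr (_, _) => /=; ring.
Qed.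

(** The color of each label is determined when its first cell is reached; the point
    shared with an earlier cell shows that the following cells have the same
    color. *)
Lemma off_paints G : (forall q, outer_disk q -> colored_off C G q) ->
  exists col, paints G col.
Proof.
move=> off; have /and5P[cs0 _ _ _ /andP[_ lk]] := geo.
have some k q : k \in cs -> sat (strict (body k)) q -> exists x, G q = Some x.
  move=> kcs sk; have [Oq _] := (bodyP _ _).1 sk; case Gq: (G q) => [x|]; first by exists x.
  by have [[/(_ Gq) Cq] _] := off q Oq; case: (cell_off kcs sk).
have [x0 _] : exists x : X, True.
  case: (cs) cs0 lk some => // k cs' _ /= /andP[/hasP[w _ /andP[wk _]] _] some.
  have [p wp] := at_hpt_exists (proj1 (andP wk)).
  rewrite (zinP _ wp) in wk.
  by have := some k p; rewrite inE eqxx => /(_ isT wk)[x _]; exists x.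
have main acc cs' : {subset acc <= cs} -> {subset cs' <= cs} -> linked acc cs' ws ->
   forall col, (forall k q, k \in acc -> sat (strict (body k)) q -> G q = Some (col k.1)) ->
   exists col', forall k q, (k \in acc) || (k \in cs') -> sat (strict (body k)) q ->
     G q = Some (col' k.1).
  elim: cs' acc => [|k cs' IH] acc sa sc; first by move=> _ col h; exists col => l q; rewrite orbF; exact: h.
  move=> /= /andP[/hasP[w _ /andP[wk lnk]] lk'] col h.
  have [p wp] := at_hpt_exists (proj1 (andP wk)).
  have sk : sat (strict (body k)) p by rewrite -(zinP _ wp).
  have kcs : k \in cs by apply: sc; rewrite inE eqxx.
  have sa' : {subset k :: acc <= cs} by move=> l; rewrite inE => /orP[/eqP->|/sa].
  have sc' : {subset cs' <= cs} by move=> l lin; apply: sc; rewrite inE lin orbT.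
  suff [col' h'] : exists col', forall l q, l \in k :: acc -> sat (strict (body l)) q ->
      G q = Some (col' l.1).
    have [col2 h2] := IH _ sa' sc' lk' col' h'; exists col2 => l q lin.
    by apply: h2; move: lin; rewrite !inE; case: (l == k); rewrite ?orbT.
  case/orP: lnk => [/allP new|/hasP[l lacc /andP[/eqP lk1 wl]]].
    have [x Gp] := some k p kcs sk.
    exists (fun i => if i == k.1 then x else col i) => l q; rewrite inE => /orP[/eqP->|lacc] sl.
      by rewrite eqxx -Gp; apply: constant_on_cell sl.
    by rewrite (negbTE (new l lacc)); exact: h.
  exists col => l' q; rewrite inE => /orP[/eqP->|]; last exact: h.
  move=> sq; rewrite (constant_on_cell off kcs sk sq) -lk1; apply: h => //.
  apply/bodyP; split; first by case/bodyP: sk.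
  by rewrite -(zinP _ wp).
have [//|//|//|col h] := main [::] cs _ _ lk (fun=> x0).
exists col => q Oq; split; [move=> Cq; exact: (off q Oq).1.2|by move=> k kcs; apply: h; rewrite kcs orbT].
Qed.

(** A vector in a sector of less than half a turn is a positive combination of u
    and v. *)
Lemma linear_sector k (u v w : plane R) : 0 < det2 u v -> ccw u w v ->
  0 <= linear k u -> 0 <= linear k v -> (0 < linear k u) || (0 < linear k v) ->
  0 < linear k w.
Proof.
move=> d c u0 v0 uv.
have [a b] : 0 < det2 u w /\ 0 < det2 w v.
  move: c; rewrite /ccw (det2C v u) oppr_gt0 (ltNge (det2 u v)) (ltW d) /= andbF !orbF.
  by move/andP.
have E : det2 u v * linear k w = det2 w v * linear k u + det2 u w * linear k v.
  by rewrite /linear /det2; ring.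
rewrite -(pmulr_rgt0 _ d) E; case/orP: uv => h.
  by rewrite ltr_wpDr // ?mulr_ge0 ?mulr_gt0 // ltW.
by rewrite ltr_wpDl // ?mulr_ge0 ?mulr_gt0 // ltW.
Qed.

Lemma germ_near h u v ks p w : at_hpt h p -> 0 < zdet u v -> all (germ1 h u v) ks ->
  ccw (emb u) w (emb v) -> \forall t \near 0^'+, sat (strict ks) (shift p w t).
Proof.
move=> hp d; have d' : 0 < det2 (emb u) (emb v) by rewrite det2_emb zr_gt0.
elim: ks => [|k ks IH] /=; first by move=> _ _; apply: filterE.
move=> /andP[g gs] c; have n1 : \forall t \near 0^'+, holds (shift p w t) (k, true).
  case/orP: g => [|/and4P[k0 ku kv kuv]].
    by rewrite (zvalue_gt0 k hp) => /near_value_gt0/near_shift; exact.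
  near=> t; have t0 : 0 < t by near: t; exact: nbhs_right_gt.
  rewrite /holds /= value_shift; move: k0; rewrite (zvalue_eq0 k hp) => /eqP->.
  rewrite add0r mulr_gt0 // (linear_sector d' c) // -!zlinearE ?zr_ge0 // !zr_gt0 //.
by apply: filterS (filterI n1 (IH gs c)) => t [-> ->].
Unshelve. all: by end_near.
Qed.

(** By [germ_near] the points of the sector close to p lie in one cell. *)
Lemma zlabelP G col h u v p l x : paints G col -> at_hpt h p -> outer_disk p ->
  zlabel cs h u v = Some l -> sectorF G p (emb u) (emb v) x <-> x = col l.
Proof.
move=> pG hp Op; rewrite /zlabel; case: ifP => // d.
case E : [seq _ <- _ | _] => [|k ks] //= [<-] {l}.
have : k \in [seq k <- cs | all (germ1 h u v) k.2] by rewrite E inE eqxx.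
rewrite mem_filter => /andP[g kcs].
have nearO w : \forall t \near 0^'+, outer_disk (shift p w t).
  by apply: near_shift; move: (@open_outer R); rewrite openE => /(_ p Op).
have key w : ccw (emb u) w (emb v) -> \forall t \near 0^'+, G (shift p w t) = Some (col k.1).
  move=> c; apply: filterS (filterI (nearO w) (germ_near hp d g c)) => t [Ot st].
  by have [_ h2] := pG _ Ot; apply: h2 => //; apply/bodyP.
split=> [sx|-> //].
have d' : 0 < det2 (emb u) (emb v) by rewrite det2_emb zr_gt0.
have c : ccw (emb u) (emb u + emb v) (emb v).
  rewrite /ccw; apply/orP; left; apply/andP; split.
    by rewrite (_ : det2 _ _ = det2 (emb u) (emb v)) // /det2 /=; ring.
  by rewrite (_ : det2 _ _ = det2 (emb u) (emb v)) // /det2 /=; ring.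
near (0 : R)^'+ => t.
have t1 : G (shift p (emb u + emb v) t) = Some x by near: t; exact: sx.
have t2 : G (shift p (emb u + emb v) t) = Some (col k.1) by near: t; exact: key.
by move: t1; rewrite t2 => -[].
Unshelve. all: by end_near.
Qed.

End Cells.

End Painting.

(** * Colorings of a picture as labellings of its regions *)

Definition zrev (e : zseg) : zseg := (e.2, e.1).

(** The segments of a picture up to orientation.  One family of cells thus serves
    for all the orientations and over-under choices of a move. *)
Definition same_support (S S' : seq zseg) : bool :=
  all (fun e => (e \in S') || (zrev e \in S')) S &&
  all (fun e => (e \in S) || (zrev e \in S)) S'.

(** Together with [geometry], all that has to be computed about an oriented picture;
    the last condition says that every sector has been found among the cells. *)
Definition checked (S0 : seq zseg) (cs : seq cell) (L : seq (seq zpt)) : bool :=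
  [&& same_support S0 (zsegs L), ztame L & all isSome (conditions L cs)].

Definition all_satisfied X (N : niebrzydowski_algebra X) col (cs : seq (option condition)) :=
  foldr (fun c P => if c is Some c then satisfies N col c /\ P else P) True cs.

Section Conditions.
Variable R : realType.
Implicit Types (p q : plane R).
Local Notation zr := (zr R).
Local Notation emb := (emb R).
Local Notation embs := (embs R).

Lemma on_zrev e q : on_segment (embs (zrev e)) q <-> on_segment (embs e) q.
Proof.
have h k : on_segment (embs k) q -> on_segment (embs (zrev k)) q.
  move=> [t [/andP[t0 t1] ->]]; exists (1 - t); split.
    by rewrite subr_ge0 t1 lerBlDr lerDl.
  by rewrite /param /shift /dir /=; congr (_, _); ring.
by split=> /h //; rewrite /zrev; case: e.
Qed.

Lemma carrier_picture S0 L q : same_support S0 (zsegs L) ->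
  carrier (picture (embl R L)) q <-> exists2 e, e \in S0 & on_segment (embs e) q.
Proof.
move=> /andP[/allP h1 /allP h2].
split=> [[_ /segs_embP[e eL ->] on]|[e eS on]].
  by case/orP: (h2 e eL) => eS; [exists e|exists (zrev e) => //; apply/on_zrev].
case/orP: (h1 e eS) => eL.
  by exists (embs e) => //; apply/segs_embP; exists e.
exists (embs (zrev e)); last exact/on_zrev.
by apply/segs_embP; exists (zrev e).
Qed.

Lemma zcross_det e f : zcross e f -> zdet (zdir e) (zdir f) != 0.
Proof.
move=> /andP[_ c]; apply/eqP => d; have E : zside f e.2 = zside f e.1.
  apply/eqP; rewrite -subr_eq0; apply/eqP; rewrite -[RHS]oppr0 -d.
  by rewrite /zside /zdet /zdir /zsub /=; ring.
by move: c; rewrite E ltNge sqr_ge0.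
Qed.

Lemma crosspt_at e f p : zdet (zdir e) (zdir f) != 0 ->
  on_segment (embs e) p -> on_segment (embs f) p -> at_hpt (zcrosspt e f) p.
Proof.
move=> d [s [_ ps]] onf; have := on_line onf; rewrite ps side_convex !side_emb => hs.
set dd := zdet _ _ in d; pose s0 := zdet (zdir f) (zsub e.1 f.1).
have E : zr s0 = s * zr dd.
  have e2 : zr (zside f e.2) = zr (zside f e.1) - zr dd.
    by rewrite -zrB; congr zr; rewrite /zside /dd /zdet /zdir /zsub /=; ring.
  move: hs; rewrite e2 -/(zside f e.1) => hs; apply/eqP; rewrite -subr_eq0; apply/eqP.
  by rewrite -[RHS]hs; ring.
split.
- by rewrite /zcrosspt /= -/dd -expr2 exprn_even_gt0.
- rewrite -[(zcrosspt e f).1.1]/(dd * (e.1.1 * dd + (zdir e).1 * s0)) -[(zcrosspt e f).2]/(dd * dd).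
  rewrite /param /shift dir_embs -[X in _ = _ * X]/(zr e.1.1 + s * zr (zdir e).1); clearbody dd s0; rewrite !zrM zrD !zrM E; ring.
- rewrite -[(zcrosspt e f).1.2]/(dd * (e.1.2 * dd + (zdir e).2 * s0)) -[(zcrosspt e f).2]/(dd * dd).
  rewrite /param /shift dir_embs -[X in _ = _ * X]/(zr e.1.2 + s * zr (zdir e).2); clearbody dd s0; rewrite !zrM zrD !zrM E; ring.
Qed.

Lemma between (a d : R) : a * (a - d) < 0 -> 0 < a / d < 1.
Proof.
move=> h; have d0 : d != 0 by apply: contraTneq h => ->; rewrite subr0 -leNgt sqr_ge0.
have dd : 0 < d * d by rewrite -expr2 exprn_even_gt0.
have E1 : a / d = (a * d) / (d * d) by field.
have a2 : 0 <= a * a by exact: sqr_ge0.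
have E2 : 0 <= (a - d) * (a - d) by exact: sqr_ge0.
rewrite E1 divr_gt0 //=; last by lra.
by rewrite ltr_pdivrMr //; lra.
Qed.

(** Segments which separate each other's endpoints meet at inner points. *)
Lemma crosspt_exists e f : zcross e f ->
  exists p, inner (embs e) p /\ inner (embs f) p.
Proof.
move=> c; have d := zcross_det c; case/andP: c => c1 c2.
have d' : zr (zdet (zdir e) (zdir f)) != 0 by rewrite zr_eq0.
set dd := zdet _ _ in d d'.
have b2 : 0 < zr (zside f e.1) / zr dd < 1.
  apply: between; rewrite -zrB -zrM zr_lt0.
  by rewrite (_ : _ - dd = zside f e.2) // /zside /dd /zdet /zdir /zsub /=; ring.
have b1 : 0 < - zr (zside e f.1) / zr dd < 1.
  apply: between; rewrite -zrN -zrB -zrM zr_lt0.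
  by rewrite (_ : _ * _ = zside e f.1 * zside e f.2) // /zside /dd /zdet /zdir /zsub /=; ring.
exists (param (embs e) (zr (zside f e.1) / zr dd)); split; first by eexists; split; [exact: b2|].
exists (- zr (zside e f.1) / zr dd); split => //.
rewrite /param /shift !dir_embs; congr (_, _) => /=; apply/eqP; rewrite -subr_eq0; apply/eqP;
  apply: (mulfI d'); rewrite mulr0 mulrBr !mulrDr ![zr dd * (_ / _ * _)]mulrA
    ![zr dd * (_ / _)]mulrC !divfK // /dd /zside /zdet /zdir /zsub /= ?zrN ?zrB ?zrM ?zrB;
  by ring.
Qed.

Lemma inner_cross e f p : e.1 != e.2 -> f.1 != f.2 -> zmeet e f ->
  inner (embs e) p -> inner (embs f) p -> zcross e f.
Proof.
move=> ne nf m ie if_.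
have [_ [[ee _]|[_ _ //]]] := zmeetP ne nf m (inner_on ie) (inner_on if_).
have ne' : (embs e).1 != (embs e).2 by rewrite embs_neq.
by have := inner_endpoint ne' ie; rewrite ee.
Qed.

Section Checked.
Variables (S0 : seq zseg) (cs : seq cell) (ws : seq hpt) (L : seq (seq zpt)).
Hypothesis geo : geometry S0 cs ws.
Hypothesis chk : checked S0 cs L.
Variables (X : Type) (N : niebrzydowski_algebra X).
Implicit Types (G : plane R -> option X) (col : nat -> X).

Local Notation P := (picture (embl R L)).
Local Notation C := (carrier P).

Let CE q : C q <-> exists2 e, e \in S0 & on_segment (embs e) q.
Proof. by case/and3P: chk => s _ _; exact: carrier_picture. Qed.

Let tL : ztame L.
Proof. by case/and3P: chk. Qed.

Lemma aroundF_labels G col h p u v W S E T : paints cs C G col -> at_hpt h p ->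
  outer_disk p -> zlabel cs h v (zopp u) = Some W -> zlabel cs h (zopp u) (zopp v) = Some S ->
  zlabel cs h (zopp v) u = Some E -> zlabel cs h u v = Some T ->
  forall w s e n, aroundF G p (emb u) (emb v) w s e n <->
    [/\ w = col W, s = col S, e = col E & n = col T].
Proof.
move=> pG hp Op lW lS lE lT w s e n; rewrite /aroundF !emb_opp.
have eW := zlabelP w pG hp Op lW; have eS := zlabelP s pG hp Op lS.
have eE := zlabelP e pG hp Op lE; have eT := zlabelP n pG hp Op lT.
by split=> -[/eW ? /eS ? /eE ? /eT ?].
Qed.

Lemma cross_condP G col e f c p : paints cs C G col -> cross_cond cs e f = Some c ->
  at_hpt (zcrosspt e f) p ->
  outer_disk p /\ (crossing_eqF N G p (embs e) (embs f) <-> satisfies N col c).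
Proof.
move=> pG; rewrite /cross_cond; case: ifP => // i + hp.
have Op : outer_disk p by apply/outerP; rewrite -(zinP _ hp).
rewrite /crossing_eqF !dir_embs det2_emb zr_gt0; case: ifP => _.
  case eW: zlabel => [W|] //; case eS: zlabel => [S|] //.
  case eE: zlabel => [E|] //; case eT: zlabel => [T|] // [<-]; split => //=.
  have ar := aroundF_labels pG hp Op eW eS eE eT.
  split=> [[w [s [e' [n [/ar[-> -> -> ->]]]]]] //|h].
  by exists (col W), (col S), (col E), (col T); split => //; apply/ar.
case eW: zlabel => [W|] //; case eS: zlabel => [S|] //.
case eE: zlabel => [E|] //; case eT: zlabel => [T|] // [<-]; split => //=.
have ar := aroundF_labels pG hp Op eW eS eE eT.
split=> [[w [s [e' [n [/ar[-> -> -> ->]]]]]] //|h].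
by exists (col W), (col S), (col E), (col T); split => //; apply/ar.
Qed.

Definition vertex_eqF G p o r0 r1 r2 := exists x0 xM x1,
    [/\ sectorF G p r0 r1 x0, sectorF G p r1 r2 xM, sectorF G p r2 r0 x1 &
        (if o then nmul N x1 x0 else nmul N x0 x1) = Some xM].

Lemma vertex_condP G col o e0 e1 e2 c : paints cs C G col ->
  vertex_cond cs o e0 e1 e2 = Some c ->
  outer_disk (emb (zend o e1)) /\
  (vertex_eqF G (emb (zend o e1)) o (emb (zout (~~ o) e0)) (emb (zout o e1)) (emb (zout o e2))
     <-> satisfies N col c).
Proof.
move=> pG; rewrite /vertex_cond; case: ifP => // i.
set h := (zend o e1, 1) in i *.
have hp : at_hpt h (emb (zend o e1)) by split => //=; rewrite mul1r.
have Op : outer_disk (emb (zend o e1)) by apply/outerP; rewrite -(zinP _ hp).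
case l0: zlabel => [x0|] //; case lM: zlabel => [xM|] //.
case l1: zlabel => [x1|] // [<-]; split => //.
have s0 := zlabelP _ pG hp Op l0; have sM := zlabelP _ pG hp Op lM.
have s1 := zlabelP _ pG hp Op l1.
rewrite /vertex_eqF; split=> [[a [b [d [/s0-> /sM-> /s1->]]]]|h']; first by case: (o).
exists (col x0), (col xM), (col x1); split; [exact/s0|exact/sM|exact/s1|].
by move: h'; case: (o).
Qed.

Lemma all_satisfied_cat col c1 c2 : all_satisfied N col (c1 ++ c2) <->
  all_satisfied N col c1 /\ all_satisfied N col c2.
Proof.
elim: c1 => [|[c|] c1 IH] /=; [tauto| |exact: IH].
by rewrite /all_satisfied /= -!/(all_satisfied _ _ _); tauto.
Qed.

Lemma all_satisfied_map (T : eqType) (g : T -> option condition) (s : seq T) col :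
  all isSome (map g s) ->
  all_satisfied N col (map g s) <-> forall x, x \in s ->
    exists2 c, g x = Some c & satisfies N col c.
Proof.
elim: s => [|x s IH] //=; case gx: (g x) => [c|] //= /IH{}IH; split.
  move=> [sc /IH h] y; rewrite inE => /orP[/eqP->|/h//]; by exists c.
move=> h; split; last by apply/IH => y ys; apply: h; rewrite inE ys orbT.
by have [|c'] := h x; rewrite ?inE ?eqxx // gx => -[<-].
Qed.

(** The crossings and vertices of the picture have been enumerated, and each sector
    there has the color of its label, so that the coloring conditions amount to
    finitely many equations. *)
Lemma conditionsP G col : paints cs C G col ->
  (forall p, outer_disk p -> crossing_okF N P G p /\ vertex_okF N P G p) <->
  all_satisfied N col (conditions L cs).
Proof.
move=> pG; have /and3P[_ _ som] := chk.
have /and4P[_ /allP nd /allP pr _] := tL.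
have meet e f : e \in zsegs L -> f \in zsegs L -> e != f -> zmeet e f.
  by move=> /pr/allP h /h; case: eqP => //= _ /and3P[].
move: som; rewrite /conditions !all_cat => /and3P[som1 som2 som3].
rewrite !all_satisfied_cat !all_satisfied_map //.
pose vs := vertices L; pose xs := crossings L.
have vmem o e0 e1 e2 : ((e0, e1, e2) \in vs o) <-> [/\ [/\ e0 \in zsegs L, e1 \in zsegs L & e2 \in zsegs L],
    zend (~~ o) e0 = zend o e1, zend o e1 = zend o e2 & zccw (zout (~~ o) e0) (zout o e1) (zout o e2)].
  rewrite mem_filter; split.
    move=> /andP[/and3P[/eqP h1 /eqP h2 h3]] /allpairsP[[[a b] d] [/= /allpairsP[[a' b'] [/= aL bL [-> ->]]] dL [? ? ?]]].
    by subst.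
  move=> [[m0 m1 m2] -> -> /= h3]; rewrite !eqxx h3 /=.
  by apply/allpairsP; exists ((e0, e1), e2); split => //=; apply/allpairsP; exists (e0, e1).
have somv o : all isSome [seq vertex_cond cs o e.1.1 e.1.2 e.2 | e <- vs o] by case: o.
have someP (T : eqType) (g : T -> option condition) (s : seq T) x : all isSome (map g s) ->
    x \in s -> exists c, g x = Some c.
  rewrite all_map => /allP h /h /=; case: (g x) => // c _; by exists c.
have lr o p (u : plane R) : labelled_ray P p o u <->
    exists e, [/\ e \in zsegs L, p = emb (zend o e) & u = emb (zout o e)].
  split=> [[_ /segs_embP[e eL ->] h]|[e [eL -> ->]]].
    exists e; split => //; first by case: o h => -[<-].
    by case: o h => -[_ ->]; rewrite dir_embs // emb_opp.
  exists (embs e); first by apply/segs_embP; exists e.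
  by case: o; rewrite dir_embs // emb_opp.
have xmem e f : ((e, f) \in xs) <-> [/\ e \in zsegs L, f \in zsegs L,
    (zlevel L e < zlevel L f)%N & zcross e f].
  rewrite mem_filter; split.
    by move=> /andP[/andP[h1 h2]] /allpairsP[[a b] [/= aL bL [? ?]]]; subst.
  move=> [eL fL h1 h2] /=; rewrite h1 h2 /=.
  by apply/allpairsP; exists (e, f).
split=> [ok|[h1 [h2 h3]] p Op].
- have hv o x : x \in vs o -> exists2 c, vertex_cond cs o x.1.1 x.1.2 x.2 = Some c & satisfies N col c.
    move=> xv; have [c Ec] := someP _ _ _ _ (somv o) xv; exists c => //.
    case: x xv Ec => -[e0 e1] e2 /vmem[[m0 m1 m2] p0 p2 cc] Ec.
    have [Op E] := vertex_condP pG Ec; apply/E.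
    have /vertex_okP := (ok _ Op).2; apply.
    + by apply/lr; exists e0; rewrite p0.
    + by apply/lr; exists e1.
    + by apply/lr; exists e2; rewrite p2.
    + by rewrite ccw_emb.
  split; last by split => x; [exact: (hv true)|exact: (hv false)].
  move=> [e f] xv; have [c Ec] := someP _ _ _ _ som1 xv; exists c => //.
  have [eL fL lt cr] := (xmem e f).1 xv.
  have [p [ie if_]] := crosspt_exists cr.
  have at_p := crosspt_at (zcross_det cr) (inner_on ie) (inner_on if_).
  have [Op E] := cross_condP pG (Ec : cross_cond cs e f = Some c) at_p.
  apply/E/(ok p Op).1; split => //.
  + by apply/segs_embP; exists e.
  + by apply/segs_embP; exists f.
  + by rewrite (inj_eq (@embs_inj R)); apply: contraTneq lt => ->; rewrite ltnn.
  + by rewrite over_emb.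
- split.
    move=> _ _ [/segs_embP[e eL ->] /segs_embP[f fL ->] ef [ie if_]].
    rewrite over_emb => lt; rewrite (inj_eq (@embs_inj R)) in ef.
    have cr : zcross e f := inner_cross (nd e eL) (nd f fL) (meet e f eL fL ef) ie if_.
    have at_p := crosspt_at (zcross_det cr) (inner_on ie) (inner_on if_).
    have [c Ec sc] := h1 (e, f) ((xmem e f).2 (And4 eL fL lt cr)).
    by have [_ E] := cross_condP pG Ec at_p; apply/E.
  apply/vertex_okP => o _ _ _ /lr[e0 [m0 p0 ->]] /lr[e1 [m1 p1 ->]] /lr[e2 [m2 p2 ->]].
  rewrite ccw_emb => cc.
  have xv : (e0, e1, e2) \in vs o.
    by apply/vmem; split => //; apply: (@emb_inj R); rewrite -?p0 -?p1 -?p2.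
  have [c Ec sc] : exists2 c, vertex_cond cs o e0 e1 e2 = Some c & satisfies N col c.
    by case: (o) xv; [exact: h2|exact: h3].
  by have [_ E] := vertex_condP pG Ec; rewrite p1; apply/E.
Qed.

Lemma valid_paints G : valid_on N (@outer_disk R) P G ->
  exists2 col, paints cs C G col & all_satisfied N col (conditions L cs).
Proof.
move=> v; have [|col pG] := off_paints geo CE (G := G); first by move=> q /v[].
by exists col => //; apply/(conditionsP pG) => p /v[].
Qed.

Lemma paints_valid G col : paints cs C G col -> all_satisfied N col (conditions L cs) ->
  valid_on N (@outer_disk R) P G.
Proof.
move=> pG /(conditionsP pG) h p Op; have [cr ve] := h p Op; split => //.
exact: (paints_off geo CE pG Op).
Qed.

Lemma paints_unique G G' col col' : paints cs C G col -> paints cs C G' col' ->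
  (forall k, k \in cs -> col k.1 = col' k.1) -> forall p, outer_disk p -> G p = G' p.
Proof.
move=> pG pG' E p Op; have [h1 h2] := pG p Op; have [h1' h2'] := pG' p Op.
have [Cp|nC] := pselect (C p); first by rewrite h1 // h1'.
by have [k kcs sk] := cell_cover geo CE Op nC; rewrite (h2 k) // (h2' k) // E.
Qed.

End Checked.

Definition zyoriented (L : seq (seq zpt)) : bool :=
  let S := zsegs L in
  let ok (p : zpt) := ~~ zin (p, 1) zouter || has (fun e => e.1 == p) S && has (fun e => e.2 == p) S in
  all (fun e => all (fun f => (e == f) ||
    ((e.1 == f.1) ==> ok e.1) && ((e.2 == f.2) ==> ok e.2)) S) S.

Lemma zyorientedP L : y_oriented (picture (embl R L)) -> zyoriented L.
Proof.
move=> yo; apply/allP => e eL; apply/allP => f fL; case: eqVneq => //= ef.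
have ok (p : zpt) : vertex (picture (embl R L)) (emb p) -> ~~ zin (p, 1) zouter ||
    has (fun e => e.1 == p) (zsegs L) && has (fun e => e.2 == p) (zsegs L).
  move=> V; case: (boolP (zin _ _)) => //= i.
  have hp : at_hpt (p, 1) (emb p) by split => //=; rewrite mul1r.
  have Op : outer_disk (emb p) by apply/outerP; rewrite -(zinP _ hp).
  have [[_ /segs_embP[a aL ->] ap] [_ /segs_embP[b bL ->] bp]] := yo _ Op V.
  apply/andP; split; apply/hasP; [exists a|exists b] => //; apply/eqP; exact: (@emb_inj R).
apply/andP; split; apply/implyP => /eqP E; apply: ok; exists (embs e), (embs f); split;
  try (by rewrite (inj_eq (@embs_inj R))); try (by apply/segs_embP; (exists e + exists f)).
  by left; rewrite /= E.
by right; rewrite /= E.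
Qed.

Lemma annulusP q : ~ inner_disk q <-> has (fun m : aff => 0 < value m q) zpieces.
Proof.
rewrite /has /value /linear /=.
rewrite -[zr 1]/(1 : R) -[zr (-1)]/(- 1 : R) -[zr 0]/(0 : R) -[zr (-2)]/(- 2 : R).
rewrite !mul0r !addr0 !add0r !mul1r !mulN1r orbF /inner_disk /= !ler_norml.
split=> [n|h [/andP[h1 h2] /andP[h3 h4]]]; last by case/or4P: h => h; lra.
apply/negPn/negP; rewrite !negb_or -!leNgt => /and4P[h1 h2 h3 h4].
by apply: n; split; apply/andP; split; lra.
Qed.

(** The pairs in A contain the labels of any two regions which share a point of the
    annulus, and the pictures have the same carrier there.  Colorings with
    matching colors on A thus agree on the annulus. *)
Definition related (S S' : seq zseg) (cs cs' : seq cell) (A : seq (nat * nat)) : bool :=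
  all (fun m : aff =>
    [&& all (fun k => all (fun l => ((k.1, l.1) \in A) ||
          infeasible (strict (m :: body k ++ l.2))) cs') cs,
        all (fun e => all (fun l => infeasible (strict (m :: body l) ++ zon e)) cs') S &
        all (fun e => all (fun l => infeasible (strict (m :: body l) ++ zon e)) cs) S']) zpieces.

(** Agreement on the annulus conversely fixes the colors of the labels in B. *)
Definition reaching (B : seq nat) (cs : seq cell) (ws : seq hpt) : bool :=
  all (fun l => has (fun k : cell => (k.1 == l) && has (fun w => zin w (body k) &&
     has (fun m : aff => 0 < zvalue m w) zpieces) ws) cs) B.

Lemma sat_cons k ks q : sat (strict (k :: ks)) q = (0 < value k q) && sat (strict ks) q.
Proof. by []. Qed.

Lemma related_agree S S' cs cs' ws ws' C C' A X (G G' : plane R -> option X) col col' :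
  geometry S cs ws -> geometry S' cs' ws' ->
  (forall q, C q <-> exists2 e, e \in S & on_segment (embs e) q) ->
  (forall q, C' q <-> exists2 e, e \in S' & on_segment (embs e) q) ->
  related S S' cs cs' A -> paints cs C G col -> paints cs' C' G' col' ->
  (forall x, x \in A -> col x.1 = col' x.2) -> agree G G'.
Proof.
move=> geo geo' CE CE' /allP rel pG pG' E q Oq nI.
have /annulusP/hasP[m min m0] := nI.
have /and3P[/allP r1 /allP r2 /allP r3] := rel m min.
have [h1 h2] := pG q Oq; have [h1' h2'] := pG' q Oq.
have /and5P[_ /allP nd _ _ _] := geo; have /and5P[_ /allP nd' _ _ _] := geo'.
have [Cq|nC] := pselect (C q); have [C'q|nC'] := pselect (C' q).
- by rewrite h1 ?h1'.
- have [l lcs sl] := cell_cover geo' CE' Oq nC'.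
  have /CE[e eS on] := Cq; have /allP/(_ l lcs)/(infeasibleP q) := r2 e eS.
  rewrite sat_cat sat_cons m0 sl => /negP[].
  by apply/zonP => //; exact: nd.
- have [k kcs sk] := cell_cover geo CE Oq nC.
  have /CE'[e eS on] := C'q; have /allP/(_ k kcs)/(infeasibleP q) := r3 e eS.
  rewrite sat_cat sat_cons m0 sk => /negP[].
  by apply/zonP => //; exact: nd'.
have [k kcs sk] := cell_cover geo CE Oq nC; have [l lcs sl] := cell_cover geo' CE' Oq nC'.
rewrite (h2 k) // (h2' l) //; have /allP/(_ l lcs)/orP[/E/=->//|/(infeasibleP q)] := r1 k kcs.
rewrite sat_cons m0 strict_cat sat_cat sk.
by have /bodyP[_ ->] := sl.
Qed.

(** The statement [extends] about functions on the disk is reduced to one about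
    finitely many colors: a labelling of the first picture yields one of the
    second with the same colors along the annulus, and the latter is determined
    by the colors of the labels that reach the annulus. *)
Lemma extends_of_check S S' cs cs' ws ws' L L' A B X (N : niebrzydowski_algebra X) :
  geometry S cs ws -> geometry S' cs' ws' -> checked S cs L -> checked S' cs' L' ->
  related S S' cs cs' A -> reaching B cs' ws' ->
  (forall col, all_satisfied N col (conditions L cs) ->
    exists2 col', all_satisfied N col' (conditions L' cs') &
      forall x, x \in A -> col x.1 = col' x.2) ->
  (forall col col', all_satisfied N col (conditions L' cs') ->
     all_satisfied N col' (conditions L' cs') -> (forall l, l \in B -> col l = col' l) ->
     forall k, k \in cs' -> col k.1 = col' k.1) ->
  extends N (picture (embl R L)) (picture (embl R L')).
Proof.
move=> geo geo' chk chk' rel rea ex un.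
have CE q := carrier_picture q (proj1 (andP chk)).
have CE' q := carrier_picture q (proj1 (andP chk')).
split=> [G vG|G G' vG vG' ag].
  have [col pG sc] := valid_paints geo chk vG; have [col' sc' E] := ex col sc.
  have [G' pG'] := paints_exists geo' CE' col'.
  exists G'; first exact: (paints_valid geo' chk' pG' sc').
  exact: (related_agree geo geo' CE CE' rel pG pG' E).
have [col pG sc] := valid_paints geo' chk' vG; have [col' pG' sc'] := valid_paints geo' chk' vG'.
apply: (paints_unique geo' chk' pG pG'); apply: un sc sc' _ => l lB.
have /hasP[k kcs /andP[/eqP <- /hasP[w _ /andP[wk /hasP[m min m0]]]]] := allP rea l lB.
have [p wp] := at_hpt_exists R (proj1 (andP wk)); rewrite (zinP _ wp) in wk.
have [Op _] := (bodyP _ _).1 wk.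
have nI : ~ inner_disk p.
  by apply/annulusP/hasP; exists m => //; rewrite -(zvalue_gt0 m wp).
have := ag p Op nI; have [_ h] := pG p Op; have [_ h'] := pG' p Op.
by rewrite (h k) // (h' k) // => -[].
Qed.

End Conditions.

(** * The cells of the pictures *)

(** In each pair, a stands for the picture before the move and b for the picture
    after it (r1c is the mirror image of r1b).  Regions that correspond to each
    other have the same label where possible.  The lists of points show that
    the cells of a region are connected to each other, and that the regions reach the annulus. *)
Section Certificates.
Local Open Scope Z_scope.
Definition r1a_lines : seq (seq zpt) := [:: [:: (0, -3); (0, 3)]].
Definition r1b_lines : seq (seq zpt) := [:: [:: (0, -3); (0, 1); (1, 1)];
  [:: (1, 1); (1, 0); (-1, 0); (-1, 2); (0, 2); (0, 3)]].
Definition r1c_lines : seq (seq zpt) := [:: [:: (0, -3); (0, 1); (-1, 1)];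
  [:: (-1, 1); (-1, 0); (1, 0); (1, 2); (0, 2); (0, 3)]].
Definition r2a_lines : seq (seq zpt) := [:: [:: (-1, -3); (-1, 3)];
  [:: (1, -3); (1, 3)]].
Definition r2b_lines : seq (seq zpt) := [:: [:: (-1, -3); (-1, -1); (2, 0); (-1, 1); (-1, 3)];
  [:: (1, -3); (1, 3)]].
Definition r3a_lines : seq (seq zpt) := [:: [:: (-2, -3); (2, 3)];
  [:: (2, -3); (-2, 3)];
  [:: (-3, 0); (-2, 0); (0, 1); (2, 0); (3, 0)]].
Definition r3b_lines : seq (seq zpt) := [:: [:: (-2, -3); (2, 3)];
  [:: (2, -3); (-2, 3)];
  [:: (-3, 0); (-2, 0); (0, -1); (2, 0); (3, 0)]].
Definition r4a_lines : seq (seq zpt) := [:: [:: (0, 0); (0, -3)];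
  [:: (0, 0); (-1, 1); (-1, 3)];
  [:: (0, 0); (1, 1); (1, 3)]].
Definition r4b_lines : seq (seq zpt) := [:: [:: (0, 0); (0, -3)];
  [:: (0, 0); (1, 1); (-1, 2); (-1, 3)];
  [:: (0, 0); (-1, 1); (1, 2); (1, 3)]].
Definition r5a_lines : seq (seq zpt) := [:: [:: (0, 0); (0, -3)];
  [:: (0, 0); (-1, 3)];
  [:: (0, 0); (1, 3)];
  [:: (-3, 0); (-2, 0); (-1, -1); (1, -1); (2, 0); (3, 0)]].
Definition r5b_lines : seq (seq zpt) := [:: [:: (0, 0); (0, -3)];
  [:: (0, 0); (-1, 3)];
  [:: (0, 0); (1, 3)];
  [:: (-3, 0); (-2, 0); (-1, 1); (1, 1); (2, 0); (3, 0)]].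
Definition iha_lines : seq (seq zpt) := [:: [:: (0, 1); (-2, 2); (-2, 3)];
  [:: (0, 1); (2, 2); (2, 3)];
  [:: (0, -1); (-2, -2); (-2, -3)];
  [:: (0, -1); (2, -2); (2, -3)];
  [:: (0, -1); (0, 1)]].
Definition ihb_lines : seq (seq zpt) := [:: [:: (-1, 0); (-2, 2); (-2, 3)];
  [:: (1, 0); (2, 2); (2, 3)];
  [:: (-1, 0); (-2, -2); (-2, -3)];
  [:: (1, 0); (2, -2); (2, -3)];
  [:: (-1, 0); (1, 0)]].
Definition r1a_cells : seq cell := [::
  (0%N, [:: (-1, 0, 0)]);
  (1%N, [:: (1, 0, 0)])].
Definition r1a_points : seq hpt := [:: (-1, 0, 20); (1, 0, 20); (-5, -5, 2); (5, 5, 2)].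
Definition r1b_cells : seq cell := [::
  (0%N, [:: (-1, 0, -1)]);
  (0%N, [:: (-1, 0, 0); (0, -1, 0)]);
  (0%N, [:: (-1, 0, 0); (0, 1, -2)]);
  (1%N, [:: (0, 1, -1); (1, 0, 0)]);
  (1%N, [:: (1, 0, -1)]);
  (1%N, [:: (0, -1, 0); (1, 0, 0)]);
  (1%N, [:: (0, -1, 2); (0, 1, -1); (1, 0, 1)]);
  (1%N, [:: (-1, 0, 0); (0, -1, 2); (0, 1, 0); (1, 0, 1)]);
  (2%N, [:: (-1, 0, 1); (0, -1, 1); (0, 1, 0); (1, 0, 0)])].
Definition r1b_points : seq hpt := [:: (-40, 41, 20); (-21, -30, 20); (2, 2, 1); (21, -30, 20); (10, 21, 20); (-10, 21, 20); (1, 10, 20); (-5, -5, 2); (5, 5, 2); (1, 1, 2)].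
Definition r1c_cells : seq cell := [::
  (0%N, [:: (-1, 0, 0); (0, 1, -1)]);
  (0%N, [:: (-1, 0, -1)]);
  (0%N, [:: (-1, 0, 0); (0, -1, 0)]);
  (0%N, [:: (-1, 0, 1); (0, -1, 2); (0, 1, -1)]);
  (0%N, [:: (-1, 0, 1); (0, -1, 2); (0, 1, 0); (1, 0, 0)]);
  (1%N, [:: (1, 0, -1)]);
  (1%N, [:: (0, -1, 0); (1, 0, 0)]);
  (1%N, [:: (0, 1, -2); (1, 0, 0)]);
  (2%N, [:: (-1, 0, 0); (0, -1, 1); (0, 1, 0); (1, 0, 1)])].
Definition r1c_points : seq hpt := [:: (-40, 41, 20); (-21, -30, 20); (-40, 39, 20); (10, 21, 20); (2, 2, 1); (21, -30, 20); (40, 41, 20); (-10, 19, 20); (-5, -5, 2); (5, 5, 2); (-1, 1, 2)].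
Definition r2a_cells : seq cell := [::
  (0%N, [:: (-1, 0, -1)]);
  (1%N, [:: (-1, 0, 1); (1, 0, 1)]);
  (2%N, [:: (1, 0, -1)])].
Definition r2a_points : seq hpt := [:: (-21, 0, 20); (19, 0, 20); (21, 0, 20); (-5, 0, 2); (0, 5, 2); (0, -5, 2); (5, 0, 2)].
Definition r2b_cells : seq cell := [::
  (0%N, [:: (-1, 0, -1)]);
  (0%N, [:: (-1, -3, 2); (-1, 0, 1); (-1, 3, 2)]);
  (1%N, [:: (-1, 0, 1); (1, -3, -2); (1, 0, 1)]);
  (2%N, [:: (1, 0, -1); (1, 3, -2)]);
  (2%N, [:: (1, -3, -2); (1, 0, -1)]);
  (3%N, [:: (-1, 0, 1); (1, 0, 1); (1, 3, -2)]);
  (4%N, [:: (-1, -3, 2); (-1, 3, 2); (1, 0, -1)])].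
Definition r2b_points : seq hpt := [:: (-117, 89, 60); (-123, -71, 60); (57, -100, 60); (153, -1, 60); (3, 49, 60); (87, -1, 60); (-5, 0, 2); (0, -5, 2); (5, 0, 2); (0, 5, 2); (3, 0, 2)].
Definition r3a_cells : seq cell := [::
  (0%N, [:: (-3, -2, 0); (-1, 2, -2); (0, 1, 0)]);
  (1%N, [:: (-3, -2, 0); (-3, 2, 0); (1, -2, 2)]);
  (1%N, [:: (-3, 2, 0); (0, -1, 0)]);
  (2%N, [:: (-3, 2, 0); (-1, 2, -2); (3, 2, 0)]);
  (2%N, [:: (-3, 2, 0); (1, 2, -2); (3, 2, 0)]);
  (3%N, [:: (-3, 2, 0); (-1, -2, 2); (1, -2, 2); (3, 2, 0)]);
  (5%N, [:: (-3, -2, 0); (3, -2, 0)]);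
  (6%N, [:: (0, 1, 0); (1, 2, -2); (3, -2, 0)]);
  (7%N, [:: (-1, -2, 2); (3, -2, 0); (3, 2, 0)]);
  (7%N, [:: (0, -1, 0); (3, 2, 0)])].
Definition r3a_points : seq hpt := [:: (-50, 1, 20); (-20, -1, 20); (9, 27, 20); (-4, 19, 40); (-17, -32, 20); (2, 2, 1); (20, -1, 20); (0, 5, 2); (0, -5, 2); (-5, 2, 2); (-5, -2, 2); (5, 2, 2); (5, -2, 2); (0, 1, 2)].
Definition r3b_cells : seq cell := [::
  (0%N, [:: (-3, -2, 0); (-3, 2, 0); (1, 2, 2)]);
  (0%N, [:: (-3, -2, 0); (0, 1, 0)]);
  (1%N, [:: (-3, 2, 0); (-1, -2, -2); (0, -1, 0)]);
  (2%N, [:: (-3, 2, 0); (3, 2, 0)]);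
  (4%N, [:: (-3, -2, 0); (-1, 2, 2); (1, 2, 2); (3, -2, 0)]);
  (5%N, [:: (-3, -2, 0); (-1, -2, -2); (3, -2, 0)]);
  (5%N, [:: (-3, -2, 0); (1, -2, -2); (3, -2, 0)]);
  (6%N, [:: (-1, 2, 2); (3, -2, 0); (3, 2, 0)]);
  (6%N, [:: (0, 1, 0); (3, -2, 0)]);
  (7%N, [:: (0, -1, 0); (1, -2, -2); (3, 2, 0)])].
Definition r3b_points : seq hpt := [:: (-23, 28, 20); (-39, -42, 20); (17, 32, 20); (8, -31, 40); (9, -27, 20); (20, -1, 20); (20, 1, 20); (33, -43, 20); (0, 5, 2); (0, -5, 2); (-5, 2, 2); (-5, -2, 2); (5, 2, 2); (5, -2, 2); (0, -1, 2)].
Definition r4a_cells : seq cell := [::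
  (0%N, [:: (-1, -1, 0); (-1, 0, 0)]);
  (0%N, [:: (-1, 0, -1)]);
  (1%N, [:: (-1, 0, 1); (-1, 1, 0); (1, 0, 1); (1, 1, 0)]);
  (2%N, [:: (1, -1, 0); (1, 0, 0)]);
  (2%N, [:: (1, 0, -1)])].
Definition r4a_points : seq hpt := [:: (-21, -40, 20); (-9, 11, 20); (1, 0, 1); (41, 39, 20); (-5, 0, 2); (0, 5, 2); (5, 0, 2)].
Definition r4b_cells : seq cell := [::
  (0%N, [:: (-1, -1, 0); (-1, 0, 0)]);
  (0%N, [:: (-1, -2, 3); (-1, 2, -3)]);
  (0%N, [:: (-1, 0, -1)]);
  (1%N, [:: (-1, 0, 1); (-1, 2, -3); (1, 0, 1); (1, 2, -3)]);
  (2%N, [:: (1, -1, 0); (1, 0, 0)]);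
  (2%N, [:: (1, -2, 3); (1, 2, -3)]);
  (2%N, [:: (1, 0, -1)]);
  (3%N, [:: (-1, -2, 3); (-1, 1, 0); (1, -2, 3); (1, 1, 0)])].
Definition r4b_points : seq hpt := [:: (-1, -1, 1); (-41, 39, 20); (-2, -2, 1); (9, 37, 20); (41, 39, 20); (2, 2, 1); (1, 15, 20); (-5, 0, 2); (0, 5, 2); (5, 0, 2); (0, 1, 1)].
Definition r5a_cells : seq cell := [::
  (0%N, [:: (-3, -1, 0); (-1, 0, 0); (0, 1, 1); (1, 1, 2)]);
  (0%N, [:: (-3, -1, 0); (0, 1, 0)]);
  (1%N, [:: (-3, 1, 0); (3, 1, 0)]);
  (2%N, [:: (-1, 1, 2); (0, 1, 1); (1, 0, 0); (3, -1, 0)]);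
  (2%N, [:: (0, 1, 0); (3, -1, 0)]);
  (3%N, [:: (-1, 0, 0); (0, -1, -1)]);
  (3%N, [:: (-1, -1, -2); (-1, 1, 2); (0, -1, 0)]);
  (4%N, [:: (0, -1, -1); (1, 0, 0)]);
  (4%N, [:: (0, -1, 0); (1, -1, -2); (1, 0, 0)])].
Definition r5a_points : seq hpt := [:: (-1, 0, 1); (-49, 11, 20); (7, 31, 20); (1, -10, 20); (49, 11, 20); (-3, -5, 4); (-3, -18, 10); (11, -49, 20); (-5, 2, 2); (0, 5, 2); (5, 2, 2); (-5, -5, 2); (5, -5, 2)].
Definition r5b_cells : seq cell := [::
  (0%N, [:: (-3, -1, 0); (0, 1, -1)]);
  (0%N, [:: (-3, -1, 0); (-1, 1, -2); (0, 1, 0)]);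
  (1%N, [:: (-3, 1, 0); (0, 1, -1); (3, 1, 0)]);
  (2%N, [:: (0, 1, -1); (3, -1, 0)]);
  (2%N, [:: (0, 1, 0); (1, 1, -2); (3, -1, 0)]);
  (3%N, [:: (-3, -1, 0); (-1, 0, 0); (0, -1, 1); (1, -1, 2)]);
  (3%N, [:: (-1, 0, 0); (0, -1, 0)]);
  (4%N, [:: (-1, -1, 2); (0, -1, 1); (1, 0, 0); (3, -1, 0)]);
  (4%N, [:: (0, -1, 0); (3, 1, 0)]);
  (5%N, [:: (-3, 1, 0); (0, -1, 1); (3, 1, 0)])].
Definition r5b_points : seq hpt := [:: (-3, 5, 4); (-8, 13, 10); (-3, 18, 10); (3, 5, 4); (40, 21, 20); (-1, 0, 1); (-49, -11, 20); (13, -29, 20); (1, 10, 20); (-5, 2, 2); (0, 5, 2); (5, 2, 2); (-5, -5, 2); (5, -5, 2); (0, 1, 2)].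
Definition iha_cells : seq cell := [::
  (0%N, [:: (-1, 0, 2); (-1, 2, -2); (1, 0, 2); (1, 2, -2)]);
  (1%N, [:: (-1, -2, -2); (-1, 0, 2); (1, -2, -2); (1, 0, 2)]);
  (2%N, [:: (-1, -2, 2); (-1, 0, 0); (-1, 2, 2)]);
  (2%N, [:: (-1, 0, -2)]);
  (3%N, [:: (1, -2, 2); (1, 0, 0); (1, 2, 2)]);
  (3%N, [:: (1, 0, -2)])].
Definition iha_points : seq hpt := [:: (1, 40, 20); (1, -40, 20); (-51, -3, 20); (19, -8, 20); (51, 3, 20); (0, 5, 2); (0, -5, 2); (-5, 0, 2); (5, 0, 2)].
Definition ihb_cells : seq cell := [::
  (0%N, [:: (-2, 1, 2); (-1, 0, 2); (0, 1, 0); (1, 0, 2); (2, 1, 2)]);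
  (1%N, [:: (-2, -1, 2); (-1, 0, 2); (0, -1, 0); (1, 0, 2); (2, -1, 2)]);
  (2%N, [:: (-2, -1, -2); (-2, 1, -2)]);
  (2%N, [:: (-1, 0, -2)]);
  (3%N, [:: (2, -1, -2); (2, 1, -2)]);
  (3%N, [:: (1, 0, -2)])].
Definition ihb_points : seq hpt := [:: (8, 19, 20); (-7, -49, 20); (-2, -1, 1); (-41, -20, 20); (41, -20, 20); (0, 5, 2); (0, -5, 2); (-5, 0, 2); (5, 0, 2)].

End Certificates.

Lemma r1a_geometry : geometry (zsegs r1a_lines) r1a_cells r1a_points.
Proof. by vm_compute. Qed.

Lemma r1b_geometry : geometry (zsegs r1b_lines) r1b_cells r1b_points.
Proof. by vm_compute. Qed.

Lemma r1c_geometry : geometry (zsegs r1c_lines) r1c_cells r1c_points.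
Proof. by vm_compute. Qed.

Lemma r2a_geometry : geometry (zsegs r2a_lines) r2a_cells r2a_points.
Proof. by vm_compute. Qed.

Lemma r2b_geometry : geometry (zsegs r2b_lines) r2b_cells r2b_points.
Proof. by vm_compute. Qed.

Lemma r3a_geometry : geometry (zsegs r3a_lines) r3a_cells r3a_points.
Proof. by vm_compute. Qed.

Lemma r3b_geometry : geometry (zsegs r3b_lines) r3b_cells r3b_points.
Proof. by vm_compute. Qed.

Lemma r4a_geometry : geometry (zsegs r4a_lines) r4a_cells r4a_points.
Proof. by vm_compute. Qed.

Lemma r4b_geometry : geometry (zsegs r4b_lines) r4b_cells r4b_points.
Proof. by vm_compute. Qed.

Lemma r5a_geometry : geometry (zsegs r5a_lines) r5a_cells r5a_points.
Proof. by vm_compute. Qed.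

Lemma r5b_geometry : geometry (zsegs r5b_lines) r5b_cells r5b_points.
Proof. by vm_compute. Qed.

Lemma iha_geometry : geometry (zsegs iha_lines) iha_cells iha_points.
Proof. by vm_compute. Qed.

Lemma ihb_geometry : geometry (zsegs ihb_lines) ihb_cells ihb_points.
Proof. by vm_compute. Qed.

(** * The moves in integral coordinates *)

Definition zorient (b : bool) (l : seq zpt) : seq zpt := if b then l else rev l.
Definition zmirror (m : bool) (l : seq zpt) : seq zpt :=
  if m then [seq (- p.1, p.2) | p <- l] else l.

Section ZMoves.
Local Open Scope Z_scope.
Definition zR1 (b : bool) : seq (seq zpt) := [:: zorient b [:: (0, -3); (0, 3)]].
Definition zR1' (b m o : bool) : seq (seq zpt) :=
  let k1 := zorient b (zmirror m [:: (0, -3); (0, 1); (1, 1)]) in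
  let k2 := zorient b (zmirror m [:: (1, 1); (1, 0); (-1, 0); (-1, 2); (0, 2); (0, 3)]) in
  if o then [:: k1; k2] else [:: k2; k1].
Definition zR2 (b1 b2 : bool) : seq (seq zpt) :=
  [:: zorient b1 [:: (-1, -3); (-1, 3)]; zorient b2 [:: (1, -3); (1, 3)]].
Definition zR2' (b1 b2 o : bool) : seq (seq zpt) :=
  let l' := zorient b1 [:: (-1, -3); (-1, -1); (2, 0); (-1, 1); (-1, 3)] in
  let k := zorient b2 [:: (1, -3); (1, 3)] in
  if o then [:: l'; k] else [:: k; l'].
Definition zR3 (b1 b2 b3 : bool) (s : seq nat) : seq (seq zpt) :=
  [seq nth [::] [:: zorient b1 [:: (-2, -3); (2, 3)]; zorient b2 [:: (2, -3); (-2, 3)];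
     zorient b3 [:: (-3, 0); (-2, 0); (0, 1); (2, 0); (3, 0)]] i | i <- s].
Definition zR3' (b1 b2 b3 : bool) (s : seq nat) : seq (seq zpt) :=
  [seq nth [::] [:: zorient b1 [:: (-2, -3); (2, 3)]; zorient b2 [:: (2, -3); (-2, 3)];
     zorient b3 [:: (-3, 0); (-2, 0); (0, -1); (2, 0); (3, 0)]] i | i <- s].
Definition zR4 (b0 b1 b2 : bool) : seq (seq zpt) :=
  [:: zorient b0 [:: (0, 0); (0, -3)]; zorient b1 [:: (0, 0); (-1, 1); (-1, 3)];
      zorient b2 [:: (0, 0); (1, 1); (1, 3)]].
Definition zR4' (b0 b1 b2 o : bool) : seq (seq zpt) :=
  let e0 := zorient b0 [:: (0, 0); (0, -3)] in
  let e1 := zorient b1 [:: (0, 0); (1, 1); (-1, 2); (-1, 3)] in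
  let e2 := zorient b2 [:: (0, 0); (-1, 1); (1, 2); (1, 3)] in
  if o then [:: e0; e1; e2] else [:: e0; e2; e1].
Definition zY (b0 b1 b2 : bool) : seq (seq zpt) :=
  [:: zorient b0 [:: (0, 0); (0, -3)]; zorient b1 [:: (0, 0); (-1, 3)];
      zorient b2 [:: (0, 0); (1, 3)]].
Definition zR5 (b0 b1 b2 b o : bool) : seq (seq zpt) :=
  let l := zorient b [:: (-3, 0); (-2, 0); (-1, -1); (1, -1); (2, 0); (3, 0)] in
  if o then l :: zY b0 b1 b2 else rcons (zY b0 b1 b2) l.
Definition zR5' (b0 b1 b2 b o : bool) : seq (seq zpt) :=
  let l := zorient b [:: (-3, 0); (-2, 0); (-1, 1); (1, 1); (2, 0); (3, 0)] in
  if o then l :: zY b0 b1 b2 else rcons (zY b0 b1 b2) l.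
Definition zI (b1 b2 b3 b4 b : bool) : seq (seq zpt) :=
  [:: zorient b1 [:: (0, 1); (-2, 2); (-2, 3)]; zorient b2 [:: (0, 1); (2, 2); (2, 3)];
      zorient b3 [:: (0, -1); (-2, -2); (-2, -3)]; zorient b4 [:: (0, -1); (2, -2); (2, -3)];
      zorient b [:: (0, -1); (0, 1)]].
Definition zH (b1 b2 b3 b4 b : bool) : seq (seq zpt) :=
  [:: zorient b1 [:: (-1, 0); (-2, 2); (-2, 3)]; zorient b2 [:: (1, 0); (2, 2); (2, 3)];
      zorient b3 [:: (-1, 0); (-2, -2); (-2, -3)]; zorient b4 [:: (1, 0); (2, -2); (2, -3)];
      zorient b [:: (-1, 0); (1, 0)]].
End ZMoves.

Section Literals.
Variable R : realType.
Local Notation emb := (emb R).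
Local Notation embl := (embl R).

Lemma orient_emb b l : orient b (map emb l) = map emb (zorient b l).
Proof. by case: b => //=; rewrite map_rev. Qed.

Lemma mirror_emb m l : mirror m (map emb l) = map emb (zmirror m l).
Proof.
case: m => //=; rewrite -!map_comp; apply: eq_map => p /=.
by rewrite /emb /= zrN.
Qed.

(** The pictures of the moves only involve integral points, so each of them is the
    image of one that can be computed with. *)
Lemma R1_emb L L' : @R1 R L L' ->
  exists b m o, L = embl (zR1 b) /\ L' = embl (zR1' b m o).
Proof.
case=> b m o k1 k2; exists b, m, o; split; first by rewrite /embl /= -orient_emb.
have -> : embl (zR1' b m o) = if o then [:: k1; k2] else [:: k2; k1].
  by rewrite /zR1' /embl; case: o => /=; rewrite -!orient_emb -!mirror_emb.
by [].
Qed.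

Lemma R2_emb L L' : @R2 R L L' ->
  exists b1 b2 o, L = embl (zR2 b1 b2) /\ L' = embl (zR2' b1 b2 o).
Proof.
case=> b1 b2 o l l' k; exists b1, b2, o; split; first by rewrite /embl /= -!orient_emb.
have -> : embl (zR2' b1 b2 o) = if o then [:: l'; k] else [:: k; l'].
  by rewrite /zR2' /embl; case: o => /=; rewrite -!orient_emb.
by [].
Qed.

Lemma R3_emb L L' : @R3 R L L' -> exists b1 b2 b3 s,
  [/\ perm_eq s (iota 0 3), L = embl (zR3 b1 b2 b3 s) & L' = embl (zR3' b1 b2 b3 s)].
Proof.
case=> b1 b2 b3 s ps l1 l2 l3 l3'; exists b1, b2, b3, s; split => //.
  rewrite /embl -map_comp; apply/eq_in_map => i; rewrite (perm_mem ps) mem_iota /=.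
  by case: i => [|[|[|]]] //= _; rewrite -orient_emb.
rewrite /embl -map_comp; apply/eq_in_map => i; rewrite (perm_mem ps) mem_iota /=.
by case: i => [|[|[|]]] //= _; rewrite -orient_emb.
Qed.

Lemma R4_emb L L' : @R4 R L L' -> exists b0 b1 b2 o,
  L = embl (zR4 b0 b1 b2) /\ L' = embl (zR4' b0 b1 b2 o).
Proof.
case=> b0 b1 b2 o e0 e1 e2 e1' e2'; exists b0, b1, b2, o.
split; first by rewrite /embl /= -!orient_emb.
have -> : embl (zR4' b0 b1 b2 o) = if o then [:: e0; e1'; e2'] else [:: e0; e2'; e1'].
  by rewrite /zR4' /embl; case: o => /=; rewrite -!orient_emb.
by [].
Qed.

Lemma R5_emb L L' : @R5 R L L' -> exists b0 b1 b2 b o,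
  L = embl (zR5 b0 b1 b2 b o) /\ L' = embl (zR5' b0 b1 b2 b o).
Proof.
case=> b0 b1 b2 b o v l l'; exists b0, b1, b2, b, o; split.
  have -> : embl (zR5 b0 b1 b2 b o) = if o then l :: v else rcons v l.
    by rewrite /zR5 /embl; case: o => /=; rewrite -!orient_emb.
  by [].
have -> : embl (zR5' b0 b1 b2 b o) = if o then l' :: v else rcons v l'.
  by rewrite /zR5' /embl; case: o => /=; rewrite -!orient_emb.
by [].
Qed.

Lemma IH_emb L L' : @IH R L L' -> exists b1 b2 b3 b4 b b',
  L = embl (zI b1 b2 b3 b4 b) /\ L' = embl (zH b1 b2 b3 b4 b').
Proof.
case=> b1 b2 b3 b4 b b' arm; exists b1, b2, b3, b4, b, b'.
by split; rewrite /embl /= -!orient_emb.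
Qed.

End Literals.

(** * Algebra of crossings and vertices *)

Section Algebra.
Variables (X : Type) (N : niebrzydowski_algebra X).
Implicit Types (a b c d x y : X).

(** The first axiom of tribrackets, split into cancellation and solvability. *)
Lemma tri_cancel1 a a' b c : N a b c = N a' b c -> a = a'.
Proof. by have [y [_ u]] := tri_inv1 N b c (N a' b c) => E; rewrite -(u a E); apply: u. Qed.
Lemma tri_cancel2 a b b' c : N a b c = N a b' c -> b = b'.
Proof. by have [y [_ u]] := tri_inv2 N a c (N a b' c) => E; rewrite -(u b E); apply: u. Qed.
Lemma tri_cancel3 a b c c' : N a b c = N a b c' -> c = c'.
Proof. by have [y [_ u]] := tri_inv3 N a b (N a b c') => E; rewrite -(u c E); apply: u. Qed.
Lemma tri_solve1 b c d : exists a, d = N a b c.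
Proof. by have [a [<- _]] := tri_inv1 N b c d; exists a. Qed.
Lemma tri_solve2 a c d : exists b, d = N a b c.
Proof. by have [b [<- _]] := tri_inv2 N a c d; exists b. Qed.
Lemma tri_solve3 a b d : exists c, d = N a b c.
Proof. by have [c [<- _]] := tri_inv3 N a b d; exists c. Qed.

Definition corners (c : condition) : seq nat :=
  if c is CrossCond n w s e then [:: n; w; s; e] else [::].

Definition determines (B : seq nat) (l : nat) (c : option condition) : bool :=
  if c is Some c then (count_mem l (corners c) == 1%N) &&
    all (fun i => (i == l) || (i \in B)) (corners c) else false.

(** Each label that is not in B occurs exactly once in a crossing condition whose
    other labels are in B, so its color is forced by those of B. *)
Definition determined (B : seq nat) (cs : seq cell) (conds : seq (option condition)) : bool :=
  all (fun k => (k.1 \in B) || has (determines B k.1) conds) cs.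

Definition update (col : nat -> X) l x := fun i => if i == l then x else col i.

Lemma cross_unique col col' (k : condition) l : satisfies N col k -> satisfies N col' k ->
  count_mem l (corners k) = 1%N ->
  (forall i, i \in corners k -> i != l -> col i = col' i) -> col l = col' l.
Proof.
case: k => [n w s e|] //= h h' + E.
have En : n != l -> col n = col' n by apply: E; rewrite !inE eqxx ?orbT.
have Ew : w != l -> col w = col' w by apply: E; rewrite !inE eqxx ?orbT.
have Es : s != l -> col s = col' s by apply: E; rewrite !inE eqxx ?orbT.
have Ee : e != l -> col e = col' e by apply: E; rewrite !inE eqxx ?orbT.
case: (eqVneq n l) En => [Enl|_] En; case: (eqVneq w l) Ew => [Ewl|_] Ew;
  case: (eqVneq s l) Es => [Esl|_] Es; case: (eqVneq e l) Ee => [Eel|_] Ee //= _.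
- by rewrite -Enl h h' Ew // Es // Ee.
- by subst l; apply: (@tri_cancel1 _ _ (col s) (col e)); rewrite -h Es // Ee // -h' En.
- by subst l; apply: (@tri_cancel2 (col w) _ _ (col e)); rewrite -h Ew // Ee // -h' En.
- by subst l; apply: (@tri_cancel3 (col w) (col s)); rewrite -h Ew // Es // -h' En.
Qed.

Lemma cross_solve col (k : condition) l : count_mem l (corners k) = 1%N ->
  exists x, satisfies N (update col l x) k.
Proof.
case: k => [n w s e|] //=; rewrite /update.
case: (eqVneq n l) => [_|_]; case: (eqVneq w l) => [_|_];
  case: (eqVneq s l) => [_|_]; case: (eqVneq e l) => [_|_] //= _.
- by exists (N (col w) (col s) (col e)).
- exact: tri_solve1.
- exact: tri_solve2.
- exact: tri_solve3.
Qed.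

Lemma determinedP B cs conds col col' : determined B cs conds ->
  all_satisfied N col conds -> all_satisfied N col' conds ->
  (forall l, l \in B -> col l = col' l) -> forall k, k \in cs -> col k.1 = col' k.1.
Proof.
move=> /allP dt sc sc' E k /dt/orP[/E//|].
elim: conds sc sc' {dt} => [|c conds IH] //= sc sc' /orP[|h]; last first.
  by case: c sc sc' => [c [_ sc] [_ sc']|sc sc']; apply: IH h.
case: c sc sc' => // c [sc _] [sc' _] /andP[/eqP c1 /allP cB].
by apply: cross_unique sc sc' c1 _ => i /cB/orP[/eqP->|/E//]; rewrite eqxx.
Qed.

(** ** Three strands *)

Implicit Type C : bool -> bool -> bool -> X.

(** The strands are numbered from top to bottom, and C gives the color of the region
    with given sides of the three strands, true being the left side.  At a
    crossing of either sign the color on the left of the over strand only is the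
    tribracket of the colors on the left of both strands, on the left of the
    under strand only, and on the right of both.  The third strand has this
    crossing on its side t. *)
Definition face01 C t := C true false t = N (C true true t) (C false true t) (C false false t).
Definition face02 C t := C true t false = N (C true t true) (C false t true) (C false t false).
Definition face12 C t := C t true false = N (C t true true) (C t false true) (C t false false).

(** The three crossings of the strands form three faces of the cube of all possible
    sides: one of the two pictures of R3 shows the faces around one corner, and
    the other picture those around the opposite corner.  The corner is the central
    triangle, and no region of the picture is opposite to it. *)
Definition corner_faces C (s0 s1 s2 : bool) := [/\ face01 C s2, face02 C s1 & face12 C s0].

(** The colors a, b, c, d follow a path from the region on the left of all strands to
    the one on their right, changing sides of the strands from top to bottom.
    The two axioms say that the two ways to compute the remaining colors with two
    faces agree. *)
Definition cube_of a b c d (s0 s1 s2 : bool) : X :=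
  match s0, s1, s2 with
  | true, true, true => a
  | false, true, true => b
  | false, false, true => c
  | false, false, false => d
  | true, false, true => N a b c
  | false, true, false => N b c d
  | true, true, false => N a b (N b c d)
  | true, false, false => N (N a b c) c d
  end.

Lemma cube_of_faces a b c d s0 s1 s2 : corner_faces (cube_of a b c d) s0 s1 s2.
Proof.
split; first by case: s2; rewrite /face01 //= tri_ax2.
  by case: s1.
by case: s0; rewrite /face12 //= tri_ax1.
Qed.

(** Three faces around a corner determine the cube.  The colors on the path are read
    off, except the one opposite to the corner if it is on the path, which is
    obtained by solving an equation. *)
Lemma cube_complete C s0 s1 s2 : corner_faces C s0 s1 s2 -> exists a b c d,
  forall t0 t1 t2, (t0 == s0) || (t1 == s1) || (t2 == s2) ->
    C t0 t1 t2 = cube_of a b c d t0 t1 t2.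
Proof.
rewrite /corner_faces /face01 /face02 /face12; case=> f1 f2 f3.
set a := C true true true; set b := C false true true.
set c := C false false true; set d := C false false false.
have ax1 := tri_ax1 N; have ax2 := tri_ax2 N.
move: s0 s1 s2 f1 f2 f3 => [] [] [] f1 f2 f3.
- have [x Ex] := tri_solve3 b c (C false true false); exists a, b, c, x.
  have E : C true false false = N (N a b c) c x.
    apply: (@tri_cancel3 a (C true false true)).
    by rewrite -f3 f2 Ex f1 -/a -/b -/c ax1.
  by move=> [] [] [] //= _; rewrite f2 Ex.
- have [x Ex] := tri_solve2 b d (C false true false); exists a, b, x, d.
  have E1 : C true true false = N a b (N b x d) by rewrite f2 Ex.
  have E2 : C true false false = N (N a b x) x d by rewrite ax2 f1 E1 Ex.
  have E3 : C true false true = N a b x.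
    by apply: (@tri_cancel2 a _ _ (C true false false)); rewrite -f3 E1 E2 ax1.
  by move=> [] [] [].
- exists a, b, c, d; have E1 : C true false false = N (N a b c) c d by rewrite f2 f1.
  by move=> [] [] [] //= _; rewrite f3 f1 E1 ax1.
- have [x Ex] := tri_solve2 a c (C true false true); exists a, x, c, d.
  have E1 : C true false false = N (N a x c) c d by rewrite f2 Ex.
  have E2 : C true true false = N a x (N x c d) by rewrite f3 Ex E1 [RHS]ax1.
  have E3 : C false true false = N x c d.
    by apply: (@tri_cancel2 (C true true false) _ _ d); rewrite -f1 E1 E2 -ax2.
  by move=> [] [] [].
- exists a, b, c, d; have E1 : C false true false = N b c d by [].
  by move=> [] [] [] //= _; rewrite f2 E1.
- exists a, b, c, d; have E1 : C true true false = N a b (N b c d) by rewrite f2 f3.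
  by move=> [] [] [] //= _; rewrite f1 E1 f3 ax2.
- exists a, b, c, d; have E1 : C true false false = N (N a b c) c d by rewrite f2 f1.
  by move=> [] [] [].
- have [x Ex] := tri_solve1 b c (C true false true); exists x, b, c, d.
  have E1 : C true false false = N (N x b c) c d by rewrite f2 Ex.
  have E2 : C true true false = N x b (N b c d).
    by apply: (@tri_cancel1 _ _ (N b c d) d); rewrite -ax2 -E1 f1 f3.
  by move=> [] [] [].
Qed.

(** ** Half twists *)

(** A half twist of an incoming and an outgoing edge replaces a vertex where p z = q
    by a vertex where o q = p, with a crossing of the regions o, p, q, z; of the
    regions o and z between the twisted edges, one is created by the move and the
    other one is separated from the vertex by it.  Both kinds of crossings are
    then consistent, since each side of [ntri_mulr] and [ntri_mull] collapses by
    [ntri_mul].  The next four lemmas recover either vertex from the other one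
    and one of the two crossing conditions. *)
Lemma twist o p q z : nmul N o q = Some p -> nmul N p z = Some q ->
  q = N o p z /\ p = N o q z.
Proof.
move=> oq pz; rewrite (ntri_mulr o pz) (ntri_mull z oq) (ntri_mul oq) (ntri_mul pz).
by rewrite (ntri_mul oq).
Qed.

Lemma twist_left o p q z : nmul N p z = Some q -> q = N o p z -> nmul N o q = Some p.
Proof.
move=> pz E; have := nmul_tril N o p z; rewrite pz -E /= => ->; congr Some.
by apply: (@tri_cancel1 _ _ q z); rewrite -(ntri_mulr o pz) -E (ntri_mul pz).
Qed.

Lemma twist_right o p q z : nmul N o q = Some p -> p = N o q z -> nmul N p z = Some q.
Proof.
move=> oq E; have := nmul_trir N o q z; rewrite oq -E /= => ->; congr Some.
by apply: (@tri_cancel3 o p); rewrite -(ntri_mull z oq) -E (ntri_mul oq).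
Qed.

Lemma twist_left' o p q z : nmul N p z = Some q -> p = N o q z -> nmul N o q = Some p.
Proof.
move=> pz E; have [x Ex] := tri_solve1 p z q; have xq := twist_left pz Ex.
by rewrite (_ : o = x) //; apply: (@tri_cancel1 _ _ q z); rewrite -E; have [] := twist xq pz.
Qed.

Lemma twist_right' o p q z : nmul N o q = Some p -> q = N o p z -> nmul N p z = Some q.
Proof.
move=> oq E; have [x Ex] := tri_solve3 o q p; have px := twist_right oq Ex.
by rewrite (_ : z = x) //; apply: (@tri_cancel3 o p); rewrite -E; have [] := twist oq px.
Qed.

(** ** A strand and a vertex *)

(** The colors w, m, e around a vertex, on the left of a strand, and w', m', e' on its
    right.  An edge between the regions p and q crosses under or over the strand. *)
Definition under_edge p p' q q' := q = N p p' q'.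
Definition over_edge p p' q q' := p' = N p q q'.

Section Prism.
Variables (w w' m m' e e' : X).

(** All relations between the six colors: a vertex on either side of the strand and
    the three edges crossing the strand.  Before the move one has a vertex and one
    edge, with one color missing; after it the other vertex and two edges.  The
    lemmas below derive the whole prism from a vertex and two edges, in all
    cases: the first word of their names tells how the edges cross the strand,
    then left or right on which side the given vertex is, and the last letters
    which edges are given. *)
Definition prism (edge : X -> X -> X -> X -> Prop) :=
  (nmul N w e = Some m /\ nmul N w' e' = Some m') /\
  [/\ edge w w' m m', edge m m' e e' & edge w w' e e'].

Local Notation L := (nmul N w e = Some m).
Local Notation R := (nmul N w' e' = Some m').

(** The case in which the axioms [nmul_tril] and [ntri_mulr] apply directly.  The
    other cases are reduced to it by solving and cancellation. *)
Lemma under_full : R -> under_edge w w' m m' -> under_edge w w' e e' -> prism under_edge.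
Proof.
rewrite /prism /under_edge => r wm we; have l : L by rewrite {1}we nmul_tril r /= -wm.
by split => //; split => //; rewrite we (ntri_mulr w r) -wm.
Qed.

Lemma under_right_wm_me : R -> under_edge w w' m m' -> under_edge m m' e e' -> prism under_edge.
Proof.
move=> r wm me; apply: under_full => //.
by rewrite /under_edge (ntri_mulr w r) -wm.
Qed.

Lemma under_right_me_we : R -> under_edge m m' e e' -> under_edge w w' e e' -> prism under_edge.
Proof.
move=> r me we; apply: under_full => //.
by apply: (@tri_cancel1 _ _ m' e'); rewrite -me we (ntri_mulr w r).
Qed.

(** Across the strand, the axiom is read backwards: since w e is defined, so is
    w' x. *)
Lemma under_left x : L -> e = N w w' x -> exists2 y, nmul N w' x = Some y & m = N w w' y.
Proof.
move=> l E; have := nmul_tril N w w' x; rewrite -E l.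
by case: (nmul N w' x) => //= y [my]; exists y.
Qed.

Lemma under_left_wm_we : L -> under_edge w w' m m' -> under_edge w w' e e' -> prism under_edge.
Proof.
move=> l wm we; have [y r my] := under_left l we; apply: under_full => //.
by rewrite r; congr Some; apply: (@tri_cancel3 w w'); rewrite -wm.
Qed.

Lemma under_left_me_we : L -> under_edge m m' e e' -> under_edge w w' e e' -> prism under_edge.
Proof.
move=> l me we; have [y r my] := under_left l we.
have ym : y = m'.
  by apply: (@tri_cancel2 m _ _ e'); rewrite -me we (ntri_mulr w r) -my.
by apply: under_full => //; rewrite -?ym.
Qed.

Lemma under_left_wm_me : L -> under_edge w w' m m' -> under_edge m m' e e' -> prism under_edge.
Proof.
move=> l wm me; have [x Ex] := tri_solve3 w w' e; have [y r my] := under_left l Ex.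
have ym : y = m' by apply: (@tri_cancel3 w w'); rewrite -wm.
have xe : x = e'.
  by apply: (@tri_cancel3 m m'); rewrite -me Ex (ntri_mulr w r) -my ym.
by apply: under_full => //; rewrite -?ym -?xe.
Qed.

Lemma over_full : L -> over_edge m m' e e' -> over_edge w w' e e' -> prism over_edge.
Proof.
rewrite /prism /over_edge => l me we; have r : R by rewrite {1}we nmul_trir l /= -me.
by split => //; split => //; rewrite we (ntri_mull e' l) -me.
Qed.

Lemma over_left_wm_me : L -> over_edge w w' m m' -> over_edge m m' e e' -> prism over_edge.
Proof.
move=> l wm me; apply: over_full => //.
by rewrite /over_edge (ntri_mull e' l) -me.
Qed.

Lemma over_left_wm_we : L -> over_edge w w' m m' -> over_edge w w' e e' -> prism over_edge.
Proof.
move=> l wm we; apply: over_full => //.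
by apply: (@tri_cancel3 w m); rewrite -wm we (ntri_mull e' l).
Qed.

Lemma over_right x : R -> w' = N x e e' -> exists2 y, nmul N x e = Some y & m' = N y e e'.
Proof.
move=> r E; have := nmul_trir N x e e'; rewrite -E r.
by case: (nmul N x e) => //= y [my]; exists y.
Qed.

Lemma over_right_me_we : R -> over_edge m m' e e' -> over_edge w w' e e' -> prism over_edge.
Proof.
move=> r me we; have [y l my] := over_right r we; apply: over_full => //.
by rewrite l; congr Some; apply: (@tri_cancel1 _ _ e e'); rewrite -me.
Qed.

Lemma over_right_wm_we : R -> over_edge w w' m m' -> over_edge w w' e e' -> prism over_edge.
Proof.
move=> r wm we; have [y l my] := over_right r we.
have ym : y = m.
  by apply: (@tri_cancel2 w _ _ m'); rewrite -wm we (ntri_mull e' l) -my.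
by apply: over_full => //; rewrite -?ym.
Qed.

Lemma over_right_wm_me : R -> over_edge w w' m m' -> over_edge m m' e e' -> prism over_edge.
Proof.
move=> r wm me; have [x Ex] := tri_solve1 e e' w'; have [y l my] := over_right r Ex.
have ym : y = m by apply: (@tri_cancel1 _ _ e e'); rewrite -me.
have xe : x = w.
  by apply: (@tri_cancel1 _ _ m m'); rewrite -wm Ex (ntri_mull e' l) -my ym.
by apply: over_full => //; rewrite -?ym -?xe.
Qed.

End Prism.

End Algebra.

(** * Colorings across each move *)

(** The strand i of the picture has height [index i s] and is reversed if its
    boolean in b is false.  The regions have been labelled so that the binary
    digits of a label are the sides of the three strands before reversal. *)
Definition cube_label (b : seq bool) (s : seq nat) (t0 t1 t2 : bool) : nat :=
  let side i := nat_of_bool (nth false [:: t0; t1; t2] (index i s) != nth false b i) in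
  (4 * side 0 + 2 * side 1 + side 2)%N.

Definition cube_corners (lab : bool -> bool -> bool -> nat) (s0 s1 s2 : bool) : seq (seq nat) :=
  [:: [:: lab true false s2; lab true true s2; lab false true s2; lab false false s2];
      [:: lab true s1 false; lab true s1 true; lab false s1 true; lab false s1 false];
      [:: lab s0 true false; lab s0 true true; lab s0 false true; lab s0 false false]].

(** The conditions are those of three faces around the corner (s0, s1, s2), for a
    labelling of the cube in which the label of this corner is not repeated. *)
Definition is_cube (lab : bool -> bool -> bool -> nat) (s0 s1 s2 : bool)
    (conds : seq (option condition)) : bool :=
  perm_eq [seq (if c is Some c then corners c else [::]) | c <- conds]
    (cube_corners lab s0 s1 s2) &&
  all (fun t => (lab t.1.1 t.1.2 t.2 == lab s0 s1 s2) ==>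
     [&& t.1.1 == s0, t.1.2 == s1 & t.2 == s2])
    [seq (t, t2) | t <- [seq (t0, t1) | t0 <- [:: true; false], t1 <- [:: true; false]],
       t2 <- [:: true; false]].

(** The conditions of [extends_of_check] for both directions of a move. *)
Definition compatible S S' (cs cs' : seq cell) ws ws' (A : seq (nat * nat)) B B' : bool :=
  [&& related S S' cs cs' A, related S' S cs' cs [seq (x.2, x.1) | x <- A],
      reaching B cs ws & reaching B' cs' ws'].

Ltac reduce_conditions := repeat
  match goal with |- context [conditions ?L ?cs] =>
    let c := eval vm_compute in (conditions L cs) in
    have -> : conditions L cs = c by vm_compute
  end.

(** The shape of the three given relations selects the lemma that applies to them. *)
Ltac prism_of V A B :=
  first
  [ have := under_full V A B | have := under_right_wm_me V A B
  | have := under_right_me_we V A B | have := under_left_wm_we V A B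
  | have := under_left_me_we V A B | have := under_left_wm_me V A B
  | have := over_full V A B | have := over_left_wm_me V A B
  | have := over_left_wm_we V A B | have := over_right_me_we V A B
  | have := over_right_wm_we V A B | have := over_right_wm_me V A B ].

Section Moves.
Variables (R : realType) (X : Type) (N : niebrzydowski_algebra X).
Implicit Types (col : nat -> X).
Local Notation P L := (picture (embl R L)).
Local Notation sat_all := (all_satisfied N).

(** Uniqueness follows from [determined]; what is left for each move is to extend
    solutions of the equations of one picture to those of the other. *)
Lemma extends_both S S' cs cs' ws ws' A B B' L L' :
  geometry S cs ws -> geometry S' cs' ws' -> compatible S S' cs cs' ws ws' A B B' ->
  checked S cs L && determined B cs (conditions L cs) ->
  checked S' cs' L' && determined B' cs' (conditions L' cs') ->
  (forall col, sat_all col (conditions L cs) ->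
    exists2 col', sat_all col' (conditions L' cs') & forall x, x \in A -> col x.1 = col' x.2) ->
  (forall col', sat_all col' (conditions L' cs') ->
    exists2 col, sat_all col (conditions L cs) & forall x, x \in A -> col x.1 = col' x.2) ->
  extends N (P L) (P L') /\ extends N (P L') (P L).
Proof.
move=> geo geo' /and4P[r1 r2 b1 b2] /andP[c1 d1] /andP[c2 d2] ex ex'; split.
  apply: (extends_of_check R geo geo' c1 c2 r1 b2 ex) => col col' sc sc' E.
  exact: determinedP d2 sc sc' E.
apply: (extends_of_check R geo' geo c2 c1 r2 b1).
  move=> col' /ex'[col sc E]; exists col => // x /mapP[y yA ->] /=; exact/esym/E.
by move=> col col' sc sc' E; exact: determinedP d1 sc sc' E.
Qed.

Lemma R1b_compatible : compatible (zsegs r1a_lines) (zsegs r1b_lines) r1a_cells r1b_cells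
  r1a_points r1b_points [:: (0, 0); (1, 1)]%N [:: 0; 1]%N [:: 0; 1]%N.
Proof. by vm_compute. Qed.

Lemma R1c_compatible : compatible (zsegs r1a_lines) (zsegs r1c_lines) r1a_cells r1c_cells
  r1a_points r1c_points [:: (0, 0); (1, 1)]%N [:: 0; 1]%N [:: 0; 1]%N.
Proof. by vm_compute. Qed.

Lemma R1a_checked b : checked (zsegs r1a_lines) r1a_cells (zR1 b) &&
  determined [:: 0; 1]%N r1a_cells (conditions (zR1 b) r1a_cells).
Proof. by case: b; vm_compute. Qed.

Lemma R1b_checked b o : checked (zsegs r1b_lines) r1b_cells (zR1' b false o) &&
  determined [:: 0; 1]%N r1b_cells (conditions (zR1' b false o) r1b_cells).
Proof. by case: b; case: o; vm_compute. Qed.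

Lemma R1c_checked b o : checked (zsegs r1c_lines) r1c_cells (zR1' b true o) &&
  determined [:: 0; 1]%N r1c_cells (conditions (zR1' b true o) r1c_cells).
Proof. by case: b; case: o; vm_compute. Qed.

Lemma cross_solve1 (A : seq (nat * nat)) conds c l col :
  conds = [:: Some c] -> count_mem l (corners c) = 1%N ->
  all (fun x => (x.1 == x.2) && (x.2 != l)) A ->
  exists2 col', sat_all col' conds & forall x, x \in A -> col x.1 = col' x.2.
Proof.
move=> -> /(cross_solve N col)[x sx] /allP hA; exists (update col l x) => // y /hA/andP[/eqP-> yl].
by rewrite /update (negbTE yl).
Qed.

(** The region enclosed by the loop occurs once in the equation of its crossing,
    which can be solved for its color. *)
Lemma R1_extends b m o : extends N (P (zR1 b)) (P (zR1' b m o)) /\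
  extends N (P (zR1' b m o)) (P (zR1 b)).
Proof.
have e0 cs col' : exists2 col, sat_all col (conditions (zR1 b) r1a_cells) &
    forall x, x \in [:: (0, 0); (1, 1)]%N -> col x.1 = col' x.2.
  exists col'; first by case: (b); reduce_conditions.
  by move=> x; rewrite !inE => /orP[]/eqP->.
case: m.
  apply: (extends_both r1a_geometry r1c_geometry R1c_compatible (R1a_checked b) (R1c_checked b o));
    last by move=> col' _; exact: e0.
  move=> col _; case: b {e0}; case: o; reduce_conditions; apply: (@cross_solve1 _ _ _ 2%N); by [].
apply: (extends_both r1a_geometry r1b_geometry R1b_compatible (R1a_checked b) (R1b_checked b o));
  last by move=> col' _; exact: e0.
move=> col _; case: b {e0}; case: o; reduce_conditions; apply: (@cross_solve1 _ _ _ 2%N); by [].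
Qed.

Lemma R2_compatible : compatible (zsegs r2a_lines) (zsegs r2b_lines) r2a_cells r2b_cells
  r2a_points r2b_points [:: (0, 0); (1, 1); (1, 3); (2, 2)]%N [:: 0; 1; 2]%N [:: 0; 1; 2; 3]%N.
Proof. by vm_compute. Qed.

Lemma R2a_checked b1 b2 : checked (zsegs r2a_lines) r2a_cells (zR2 b1 b2) &&
  determined [:: 0; 1; 2]%N r2a_cells (conditions (zR2 b1 b2) r2a_cells).
Proof. by case: b1; case: b2; vm_compute. Qed.

Lemma R2b_checked b1 b2 o : checked (zsegs r2b_lines) r2b_cells (zR2' b1 b2 o) &&
  determined [:: 0; 1; 2; 3]%N r2b_cells (conditions (zR2' b1 b2 o) r2b_cells).
Proof. by case: b1; case: b2; case: o; vm_compute. Qed.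

(** The two crossings give the same equation for the two regions 1 and 3 separated by
    the bent strand, which are the same region in the first picture. *)
Lemma R2_extends b1 b2 o : extends N (P (zR2 b1 b2)) (P (zR2' b1 b2 o)) /\
  extends N (P (zR2' b1 b2 o)) (P (zR2 b1 b2)).
Proof.
apply: (extends_both r2a_geometry r2b_geometry R2_compatible (R2a_checked b1 b2) (R2b_checked b1 b2 o)).
- move=> col _.
  (* the regions 1 and 3 are one region before the move *)
  pose col1 := update col 3 (col 1%N).
  have [c h4 hs] : exists2 c, count_mem 4%N (corners c) = 1%N &
     forall x, satisfies N (update col1 4 x) c -> sat_all (update col1 4 x) (conditions (zR2' b1 b2 o) r2b_cells).
    case: b1; case: b2; case: o; reduce_conditions;
      (eexists; last by move=> x h; split; [exact: h|split; [exact: h|]]); by [].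
  have [x sx] := cross_solve N col1 h4; exists (update col1 4 x); first exact: hs.
  by move=> y; rewrite !inE => /or4P[]/eqP->.
- move=> col' sc'; exists col'; first by case: (b1); case: (b2); reduce_conditions.
  have E : col' 1%N = col' 3%N.
    move: sc'; case: b1; case: b2; case: o; reduce_conditions => -[/= h1 [h2 _]];
    first [exact: (etrans h1 (esym h2)) | exact: (etrans h2 (esym h1))
      | exact: tri_cancel1 (etrans (esym h1) h2) | exact: tri_cancel1 (etrans (esym h2) h1)
      | exact: tri_cancel2 (etrans (esym h1) h2) | exact: tri_cancel2 (etrans (esym h2) h1)
      | exact: tri_cancel3 (etrans (esym h1) h2) | exact: tri_cancel3 (etrans (esym h2) h1)].
  by move=> y; rewrite !inE => /or4P[]/eqP->.
Qed.

Lemma R4_compatible : compatible (zsegs r4a_lines) (zsegs r4b_lines) r4a_cells r4b_cells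
  r4a_points r4b_points [:: (0, 0); (1, 1); (2, 2)]%N [:: 0; 1; 2]%N [:: 0; 1; 2]%N.
Proof. by vm_compute. Qed.

Lemma R4a_checked b0 b1 b2 : checked (zsegs r4a_lines) r4a_cells (zR4 b0 b1 b2) &&
  determined [:: 0; 1; 2]%N r4a_cells (conditions (zR4 b0 b1 b2) r4a_cells).
Proof. by case: b0; case: b1; case: b2; vm_compute. Qed.

Lemma R4b_checked b0 b1 b2 o :
  checked (zsegs r4b_lines) r4b_cells (zR4' b0 b1 b2 o) &&
  determined [:: 0; 1; 2]%N r4b_cells (conditions (zR4' b0 b1 b2 o) r4b_cells).
Proof. by case: b0; case: b1; case: b2; case: o; vm_compute. Qed.

Lemma twist_solve_left p q z : nmul N p z = Some q -> exists o, [/\ nmul N o q = Some p, q = N o p z & p = N o q z].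
Proof.
move=> pz; have [x E] := tri_solve1 N p z q; exists x.
have oq := twist_left pz E; split => //; by have [] := twist oq pz.
Qed.

Lemma twist_solve_right o q p : nmul N o q = Some p -> exists z, [/\ nmul N p z = Some q, q = N o p z & p = N o q z].
Proof.
move=> oq; have [z E] := tri_solve3 N o q p; exists z.
have pz := twist_right oq E; split => //; by have [] := twist oq pz.
Qed.

(** If the twisted edges are both incoming or both outgoing then the new region has
    the same color as the region between the edges, by the axiom [ntri_mul];
    otherwise this is a half twist of an incoming and an outgoing edge. *)
Lemma R4_extends b0 b1 b2 o : zyoriented (zR4 b0 b1 b2) ->
  extends N (P (zR4 b0 b1 b2)) (P (zR4' b0 b1 b2 o)) /\
  extends N (P (zR4' b0 b1 b2 o)) (P (zR4 b0 b1 b2)).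
Proof.
move=> yo; apply: (extends_both r4a_geometry r4b_geometry R4_compatible (R4a_checked b0 b1 b2)
  (R4b_checked b0 b1 b2 o)).
- have ok col x y : y \in [:: (0, 0); (1, 1); (2, 2)]%N -> col y.1 = update col 3 x y.2.
    by rewrite !inE => /or3P[]/eqP->.
  move=> col; move: yo; case: b0; case: b1; case: b2; case: o => yo;
  try (exfalso; vm_compute in yo; discriminate); clear yo;
  reduce_conditions => -[/= H _];
  first [ exists (update col 3 (col 1%N)); [| exact: ok];
          by split; [exact/esym/(ntri_mul H)|split; [exact: H|]]
        | have [x [h1 h2 h3]] := twist_solve_left H; exists (update col 3 x); [| exact: ok];
          by split; [first [exact: h2|exact: h3]|split; [exact: h1|]]
        | have [x [h1 h2 h3]] := twist_solve_right H; exists (update col 3 x); [| exact: ok];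
          by split; [first [exact: h2|exact: h3]|split; [exact: h1|]] ].
- move=> col sc; exists col; last by move=> y; rewrite !inE => /or3P[]/eqP->.
  move: yo sc; case: b0; case: b1; case: b2; case: o => yo;
  try (exfalso; vm_compute in yo; discriminate); clear yo;
  reduce_conditions => -[/= H1 [H2 _]]; (split; [|exact: I]);
  first [ exact: twist_left H2 H1 | exact: twist_left' H2 H1
        | exact: twist_right H2 H1 | exact: twist_right' H2 H1
        | by rewrite H1 (ntri_mul H2) | by rewrite (tri_cancel2 (etrans (ntri_mul H2) H1)) in H2 *
        | by rewrite -(tri_cancel2 (etrans (ntri_mul H2) H1)) ].
Qed.

Lemma R5_compatible : compatible (zsegs r5a_lines) (zsegs r5b_lines) r5a_cells r5b_cells
  r5a_points r5b_points [:: (0, 0); (1, 1); (2, 2); (3, 3); (4, 4)]%N [:: 0; 1; 2; 3; 4]%N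
  [:: 0; 1; 2; 3; 4]%N.
Proof. by vm_compute. Qed.

Lemma R5a_checked b0 b1 b2 b o : checked (zsegs r5a_lines) r5a_cells (zR5 b0 b1 b2 b o) &&
  determined [:: 0; 1; 2; 3; 4]%N r5a_cells (conditions (zR5 b0 b1 b2 b o) r5a_cells).
Proof. by case: b0; case: b1; case: b2; case: b; case: o; vm_compute. Qed.

Lemma R5b_checked b0 b1 b2 b o : checked (zsegs r5b_lines) r5b_cells (zR5' b0 b1 b2 b o) &&
  determined [:: 0; 1; 2; 3; 4]%N r5b_cells (conditions (zR5' b0 b1 b2 b o) r5b_cells).
Proof. by case: b0; case: b1; case: b2; case: b; case: o; vm_compute. Qed.

(** The color of the new region is found from one crossing, and the prism gives the
    other equations. *)
Lemma R5_forward b0 b1 b2 b o col : zyoriented (zR5 b0 b1 b2 b o) ->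
  sat_all col (conditions (zR5 b0 b1 b2 b o) r5a_cells) ->
  exists x, sat_all (update col 5 x) (conditions (zR5' b0 b1 b2 b o) r5b_cells).
Proof.
case: b0; case: b1; case: b2; case: b; case: o => yo; try (exfalso; vm_compute in yo; discriminate); clear yo;
reduce_conditions => -[H [V _]]; rewrite /= in H V;
match goal with |- context [Some ?c :: _] =>
  have [x] := @cross_solve X N col c 5 erefl; rewrite /update /= => Hx; exists x
end; rewrite /update /=;
(prism_of V Hx H || prism_of V H Hx) => -[[? ?] [? ? ?]]; do 3 (split; first assumption); exact: I.
Qed.

Lemma R5_backward b0 b1 b2 b o col : zyoriented (zR5 b0 b1 b2 b o) ->
  sat_all col (conditions (zR5' b0 b1 b2 b o) r5b_cells) ->
  sat_all col (conditions (zR5 b0 b1 b2 b o) r5a_cells).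
Proof.
case: b0; case: b1; case: b2; case: b; case: o => yo; try (exfalso; vm_compute in yo; discriminate); clear yo;
reduce_conditions => -[/= H [H' [V _]]];
(prism_of V H H' || prism_of V H' H) => -[[? ?] [? ? ?]]; do 2 (split; first assumption); exact: I.
Qed.

Lemma R5_extends b0 b1 b2 b o : zyoriented (zR5 b0 b1 b2 b o) ->
  extends N (P (zR5 b0 b1 b2 b o)) (P (zR5' b0 b1 b2 b o)) /\
  extends N (P (zR5' b0 b1 b2 b o)) (P (zR5 b0 b1 b2 b o)).
Proof.
move=> yo; apply: (extends_both r5a_geometry r5b_geometry R5_compatible
  (R5a_checked b0 b1 b2 b o) (R5b_checked b0 b1 b2 b o)).
- move=> col /(R5_forward yo)[x sx]; exists (update col 5 x) => // y.
  by rewrite !inE => /orP[/eqP->|/or4P[] /eqP->].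
- move=> col /(R5_backward yo) sc; exists col => // y.
  by rewrite !inE => /orP[/eqP->|/or4P[] /eqP->].
Qed.

Lemma is_cubeP lab s0 s1 s2 conds col : is_cube lab s0 s1 s2 conds ->
  sat_all col conds <-> corner_faces N (fun t0 t1 t2 => col (lab t0 t1 t2)) s0 s1 s2.
Proof.
move=> /andP[pe _]; pose holds l := if l is [:: n; w; s; e] then col n = N (col w) (col s) (col e) else True.
have E cs : [::] \notin [seq (if c is Some c then corners c else [::]) | c <- cs] ->
    sat_all col cs <-> forall l, l \in [seq (if c is Some c then corners c else [::]) | c <- cs] -> holds l.
  elim: cs => [|c cs IH] //=; case: c => [[n w s e|m w e]|]; rewrite ?inE //= => nc.
  have {}IH := IH nc; split=> [[h hs] l|h].
    by rewrite inE => /orP[/eqP->//|]; apply: IH.1.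
  split; first by apply: (h [:: n; w; s; e]); rewrite inE eqxx.
  by apply: IH.2 => l lc; apply: h; rewrite inE lc orbT.
rewrite E ?(perm_mem pe) //; split=> [h|[h1 h2 h3] l].
  by split; (apply: (h [:: _; _; _; _]); rewrite (perm_mem pe) !inE eqxx ?orbT).
by rewrite (perm_mem pe) !inE => /or3P[] /eqP->.
Qed.

Lemma mem_cube t0 t1 t2 : (t0, t1, t2) \in
  [seq (t, t2) | t <- [seq (t0, t1) | t0 <- [:: true; false], t1 <- [:: true; false]],
       t2 <- [:: true; false]].
Proof. by case: t0; case: t1; case: t2. Qed.

(** The solution for one picture of R3 is completed to a cube, which contains the
    solution for the other picture. *)
Lemma is_cube_extend lab s0 s1 s2 conds conds' col :
  is_cube lab s0 s1 s2 conds -> is_cube lab (~~ s0) (~~ s1) (~~ s2) conds' ->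
  sat_all col conds -> exists2 col', sat_all col' conds' &
    forall l, l != lab (~~ s0) (~~ s1) (~~ s2) -> col l = col' l.
Proof.
move=> c c'; rewrite (is_cubeP _ c) => /cube_complete[x1 [x2 [x3 [x4 h]]]].
set l0 := lab _ _ _ in c' *.
exists (update col l0 (cube_of N x1 x2 x3 x4 (~~ s0) (~~ s1) (~~ s2))); last first.
  by move=> l; rewrite /update => /negbTE->.
apply/(is_cubeP _ c'); set C := (fun _ _ _ => _).
have CE t0 t1 t2 : C t0 t1 t2 = cube_of N x1 x2 x3 x4 t0 t1 t2.
  rewrite /C /update; case: ifP => [/eqP tE|tn].
    have /andP[_ /allP/(_ (t0, t1, t2)) hh] := c'.
    have /implyP hh' := hh (mem_cube t0 t1 t2).
    by have /and3P[/= /eqP-> /eqP-> /eqP->] := hh' (introT eqP tE).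
  apply: h; apply: contraFT tn; rewrite !negb_or /l0.
  by case: (t0); case: (t1); case: (t2); case: (s0); case: (s1); case: (s2).
have [f1 f2 f3] := cube_of_faces N x1 x2 x3 x4 (~~ s0) (~~ s1) (~~ s2).
by split; rewrite /face01 /face02 /face12 !CE.
Qed.

(** The side, in terms of the strand at height j, on which the other two strands cross
    in the first picture. *)
Definition R3_side (b1 b2 b3 : bool) (s : seq nat) j :=
  (nth false [:: false; true; true] (nth 0%N s j) != nth false [:: b1; b2; b3] (nth 0%N s j)).

Definition R3_check (b1 b2 b3 : bool) (s : seq nat) : bool :=
  let lab := cube_label [:: b1; b2; b3] s in
  let s0 := R3_side b1 b2 b3 s 0 in let s1 := R3_side b1 b2 b3 s 1 in
  let s2 := R3_side b1 b2 b3 s 2 in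
  let c := conditions (zR3 b1 b2 b3 s) r3a_cells in
  let c' := conditions (zR3' b1 b2 b3 s) r3b_cells in
  let B := [:: 0; 1; 2; 5; 6; 7]%N in
  [&& checked (zsegs r3a_lines) r3a_cells (zR3 b1 b2 b3 s) && determined B r3a_cells c,
      checked (zsegs r3b_lines) r3b_cells (zR3' b1 b2 b3 s) && determined B r3b_cells c',
      is_cube lab s0 s1 s2 c, is_cube lab (~~ s0) (~~ s1) (~~ s2) c',
      lab s0 s1 s2 == 3 & lab (~~ s0) (~~ s1) (~~ s2) == 4]%N.

Lemma R3_checked b1 b2 b3 s : perm_eq s (iota 0 3) -> R3_check b1 b2 b3 s.
Proof.
rewrite -mem_permutations => sp.
have : all (R3_check b1 b2 b3) (permutations (iota 0 3)).
  by case: b1; case: b2; case: b3; vm_compute.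
by move/allP/(_ s sp).
Qed.

Lemma R3_compatible : compatible (zsegs r3a_lines) (zsegs r3b_lines) r3a_cells r3b_cells
  r3a_points r3b_points [:: (0, 0); (1, 1); (2, 2); (5, 5); (6, 6); (7, 7)]%N
  [:: 0; 1; 2; 5; 6; 7]%N [:: 0; 1; 2; 5; 6; 7]%N.
Proof. by vm_compute. Qed.

Lemma R3_extends b1 b2 b3 s : perm_eq s (iota 0 3) ->
  extends N (P (zR3 b1 b2 b3 s)) (P (zR3' b1 b2 b3 s)) /\
  extends N (P (zR3' b1 b2 b3 s)) (P (zR3 b1 b2 b3 s)).
Proof.
move=> /(R3_checked b1 b2 b3)/and5P[ca cb cube cube' /andP[/eqP l3 /eqP l4]].
apply: (extends_both r3a_geometry r3b_geometry R3_compatible ca cb) => col sc.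
  have [col' sc' E] := is_cube_extend cube cube' sc; exists col' => // x.
  by rewrite l4 in E; rewrite !inE => /or3P[/eqP->|/eqP->|/or4P[] /eqP->]; rewrite E.
rewrite -[R3_side b1 b2 b3 s 0]negbK -[R3_side b1 b2 b3 s 1]negbK -[R3_side b1 b2 b3 s 2]negbK in cube l3.
have [col' sc' E] := is_cube_extend cube' cube sc; exists col' => // x.
by rewrite l3 in E; rewrite !inE => /or3P[/eqP->|/eqP->|/or4P[] /eqP->]; rewrite E.
Qed.

(** In the idempotent case a product is defined only if both factors and the result
    are equal, so the two vertices connected by an edge force all regions around
    to have the same color, in either shape. *)
Definition monochrome col := exists2 x, nmul N x x = Some x &
  [/\ col 0 = x, col 1 = x, col 2 = x & col 3 = x]%N.

Lemma I_compatible : compatible (zsegs iha_lines) (zsegs ihb_lines) iha_cells ihb_cells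
  iha_points ihb_points [:: (0, 0); (1, 1); (2, 2); (3, 3)]%N [:: 0; 1; 2; 3]%N
  [:: 0; 1; 2; 3]%N.
Proof. by vm_compute. Qed.

Lemma I_checked b1 b2 b3 b4 b : checked (zsegs iha_lines) iha_cells (zI b1 b2 b3 b4 b) &&
  determined [:: 0; 1; 2; 3]%N iha_cells (conditions (zI b1 b2 b3 b4 b) iha_cells).
Proof. by case: b1; case: b2; case: b3; case: b4; case: b; vm_compute. Qed.

Lemma H_checked b1 b2 b3 b4 b : checked (zsegs ihb_lines) ihb_cells (zH b1 b2 b3 b4 b) &&
  determined [:: 0; 1; 2; 3]%N ihb_cells (conditions (zH b1 b2 b3 b4 b) ihb_cells).
Proof. by case: b1; case: b2; case: b3; case: b4; case: b; vm_compute. Qed.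

Hypothesis idem : idempotent_algebra N.

Lemma idempotent_mul x y z : nmul N x y = Some z -> x = z /\ y = z.
Proof.
move=> h; have [h1 h2] := idem h; split; first exact: nmul_injl h h2.
exact: nmul_injr h h1.
Qed.

Lemma I_monochrome b1 b2 b3 b4 b col : zyoriented (zI b1 b2 b3 b4 b) ->
  sat_all col (conditions (zI b1 b2 b3 b4 b) iha_cells) <-> monochrome col.
Proof.
case: b1; case: b2; case: b3; case: b4; case: b => yo; try (exfalso; vm_compute in yo; discriminate);
clear yo; reduce_conditions; (split=> [[/= h [h' _]]|[x xx [h0 h1 h2 h3]]]);
try (by rewrite /= h0 h1 h2 h3).
all: have [e1 e2] := idempotent_mul h; have [e3 e4] := idempotent_mul h'.
all: exists (col 2%N); first by move: h h'; congruence.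
all: by split; congruence.
Qed.

Lemma H_monochrome b1 b2 b3 b4 b col : zyoriented (zH b1 b2 b3 b4 b) ->
  sat_all col (conditions (zH b1 b2 b3 b4 b) ihb_cells) <-> monochrome col.
Proof.
case: b1; case: b2; case: b3; case: b4; case: b => yo; try (exfalso; vm_compute in yo; discriminate);
clear yo; reduce_conditions; (split=> [[/= h [h' _]]|[x xx [h0 h1 h2 h3]]]);
try (by rewrite /= h0 h1 h2 h3).
all: have [e1 e2] := idempotent_mul h; have [e3 e4] := idempotent_mul h'.
all: exists (col 2%N); first by move: h h'; congruence.
all: by split; congruence.
Qed.

Lemma IH_extends b1 b2 b3 b4 b b' : zyoriented (zI b1 b2 b3 b4 b) ->
  zyoriented (zH b1 b2 b3 b4 b') ->
  extends N (P (zI b1 b2 b3 b4 b)) (P (zH b1 b2 b3 b4 b')) /\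
  extends N (P (zH b1 b2 b3 b4 b')) (P (zI b1 b2 b3 b4 b)).
Proof.
move=> yI yH; apply: (extends_both iha_geometry ihb_geometry I_compatible
  (I_checked b1 b2 b3 b4 b) (H_checked b1 b2 b3 b4 b')) => col.
- move=> /(I_monochrome _ yI)/(H_monochrome _ yH) sc; exists col => // y.
  by rewrite !inE => /or4P[] /eqP->.
- move=> /(H_monochrome _ yH)/(I_monochrome _ yI) sc; exists col => // y.
  by rewrite !inE => /or4P[] /eqP->.
Qed.

End Moves.

(** * Invariance *)

Section Final.
Variables (R : realType) (X : Type) (N : niebrzydowski_algebra X).

Lemma checked_tame S cs L p : checked S cs L -> tame (picture (embl R L)) p.
Proof. by case/and3P => _ t _; exact: ztameP. Qed.

Lemma reidemeister_step_card (D D' : diagram R) : reidemeister_step D D' ->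
  colorings N D #= colorings N D'.
Proof.
case=> [iso|r|r|[r|r|r]]; first exact: planar_isotopic_card.
- apply: (move_card _ _ r) => L L' /R1_emb[b [m [c [-> ->]]]].
    split=> p _; first exact: (checked_tame p (proj1 (andP (R1a_checked b)))).
    case: m; first exact: (checked_tame p (proj1 (andP (R1c_checked b c)))).
    exact: (checked_tame p (proj1 (andP (R1b_checked b c)))).
  by move=> _ _; exact: R1_extends.
- apply: (move_card _ _ r) => L L' /R2_emb[b1 [b2 [c [-> ->]]]].
    split=> p _; first exact: (checked_tame p (proj1 (andP (R2a_checked b1 b2)))).
    exact: (checked_tame p (proj1 (andP (R2b_checked b1 b2 c)))).
  by move=> _ _; exact: R2_extends.
- apply: (move_card _ _ r) => L L' /R3_emb[b1 [b2 [b3 [s [ps -> ->]]]]].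
    have /and3P[/andP[c1 _] /andP[c2 _] _] := R3_checked b1 b2 b3 ps.
    by split=> p _; [exact: checked_tame p c1|exact: checked_tame p c2].
  by move=> _ _; exact: R3_extends.
- apply: (move_card _ _ r) => L L' /R4_emb[b0 [b1 [b2 [c [-> ->]]]]].
    split=> p _; first exact: (checked_tame p (proj1 (andP (R4a_checked b0 b1 b2)))).
    exact: (checked_tame p (proj1 (andP (R4b_checked b0 b1 b2 c)))).
  by move=> /zyorientedP y _; exact: R4_extends.
- apply: (move_card _ _ r) => L L' /R5_emb[b0 [b1 [b2 [b [c [-> ->]]]]]].
    split=> p _; first exact: (checked_tame p (proj1 (andP (R5a_checked b0 b1 b2 b c)))).
    exact: (checked_tame p (proj1 (andP (R5b_checked b0 b1 b2 b c)))).
  by move=> /zyorientedP y _; exact: R5_extends.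
Qed.

Lemma IH_card (D D' : diagram R) : idempotent_algebra N -> replacement (@IH R) D D' ->
  colorings N D #= colorings N D'.
Proof.
move=> idem r; apply: (move_card _ _ r) => L L' /IH_emb[b1 [b2 [b3 [b4 [b [b' [-> ->]]]]]]].
  split=> p _; first exact: (checked_tame p (proj1 (andP (I_checked b1 b2 b3 b4 b)))).
  exact: (checked_tame p (proj1 (andP (H_checked b1 b2 b3 b4 b')))).
by move=> /zyorientedP y /zyorientedP y'; exact: IH_extends.
Qed.

Lemma card_clos (r : diagram R -> diagram R -> Prop) :
  (forall D D', r D D' -> colorings N D #= colorings N D') ->
  forall D D', Relation_Operators.clos_refl_sym_trans _ r D D' ->
  colorings N D #= colorings N D'.
Proof.
move=> h D D'; elim=> [A B /h //|A|A B _|A B C _ h1 _ h2].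
- exact: card_eqxx.
- by rewrite card_eq_sym.
- exact: card_eq_trans h1 h2.
Qed.

End Final.

Theorem theorem3 (R : realType) (X : Type) (N : niebrzydowski_algebra X) :
  (forall D D' : diagram R, reidemeister_equivalent D D' ->
     colorings N D #= colorings N D') /\
  (idempotent_algebra N ->
   forall D D' : diagram R, handlebody_equivalent D D' ->
     colorings N D #= colorings N D').
Proof.
split; first exact: card_clos (@reidemeister_step_card R X N).
move=> idem; apply: card_clos => D D' [|]; first exact: reidemeister_step_card.
exact: IH_card.
Qed.
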